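(* Let $V$ be a unital JB-algebra with positive cone $\Omega$. Then $G(\Omega)$ is an embedded Banach-Lie subgroup of $GL(V)$ with $\mathrm{Lie}(G(\Omega))=\mathrm{str}(V)$. Moreover $G(\Omega)$ is a disjoint union $G(\Omega)=\bigsqcup_i \mathrm{Str}(V)_0\cdot k_i$, where the $k_i\in\mathrm{Aut}(V)$ belong to pairwise different connected components of $\mathrm{Aut}(V)$.
   Context: A (unital) JB-algebra is a real Jordan algebra $(V,\circ)$ with unit $1$ (the product is bilinear, commutative and $x^2\circ(x\circ y)=x\circ(x^2\circ y)$) with a complete norm such that $\|x\circ y\|\le\|x\|\|y\|$, $\|x^2\|=\|x\|^2$, $\|x^2\|\le\|x^2+y^2\|$; it may be infinite dimensional. $B(V)$ is the algebra of bounded linear operators on $V$ with the operator norm and $GL(V)$ its group of invertible elements. $L_xy=x\circ y$, $U_x=2L_x^2-L_{x^2}$, $U_{x,y}=\frac12(U_{x+y}-U_x-U_y)$. An element $x$ is invertible if $U_x$ is an invertible operator, $\sigma(x)=\{\lambda\in\mathbb R: x-\lambda1\text{ not invertible}\}$, and $\Omega=\{x\in V:\sigma(x)\subset(0,+\infty)\}$. $G(\Omega)=\{g\in GL(V):g(\Omega)=\Omega\}$. $\mathrm{Aut}(V)$ is the group of $k\in GL(V)$ with $k(a\circ b)=k(a)\circ k(b)$ for all $a,b\in V$. The structure group $\mathrm{Str}(V)$ is the set of $g\in GL(V)$ for which there is $g^*\in GL(V)$ with $U_{gx}=gU_xg^*$ for all $x\in V$; $\mathrm{Str}(V)_0$ is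 its connected component of the identity in the norm topology. $\mathrm{str}(V)=\{H\in B(V):\exists\,\overline H\in B(V)\text{ with }2U_{x,Hx}=HU_x-U_x\overline H\ \forall x\in V\}$, the Lie algebra of $\mathrm{Str}(V)$. An embedded Banach-Lie subgroup of $GL(V)$ is a closed subgroup $G$ that is an embedded submanifold and a Banach-Lie group with the induced (norm) topology; its Lie algebra is $\mathrm{Lie}(G)=T_{\mathrm{Id}}G=\{H\in B(V): e^{tH}\in G\ \forall t\in\mathbb R\}$. *)

(* Defs.v *)
From HB Require Import structures.
From mathcomp Require Import all_boot all_order all_algebra.
From mathcomp Require Import all_classical all_reals all_analysis.

Set Implicit Arguments.
Unset Strict Implicit.
Unset Printing Implicit Defensive.

Import Order.TTheory GRing.Theory Num.Theory.
Import numFieldNormedType.Exports.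

Local Open Scope classical_set_scope.
Local Open Scope ring_scope.

Section BoundedOperators.
Context {R : realType} {E F : normedModType R}.

Definition bounded_op : {pred E -> F} :=
  mem [set f : E -> F | linear f /\ continuous f].

Record bop := Bop { bop_fun :> E -> F ; bopP : bop_fun \in bounded_op }.

HB.instance Definition _ := [isSub for bop_fun].
HB.instance Definition _ := [Choice of bop by <:].

Lemma bop_linear (f : bop) : linear f.
Proof. by have := bopP f; rewrite inE => -[]. Qed.

Lemma bop_continuous (f : bop) : continuous f.
Proof. by have := bopP f; rewrite inE => -[]. Qed.

HB.instance Definition _ (f : bop) :=
  GRing.isLinear.Build R E F *:%R f (bop_linear f).

Lemma bounded_op_submod : submod_closed bounded_op.
Proof.
split; first by rewrite inE; split; [move=> k x y; rewrite scaler0 addr0|exact: cst_continuous].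
move=> a f g; rewrite !inE => -[lf cf] [lg cg]; split.
  move=> k x y; rewrite !fctE lf lg !scalerDr !scalerA (mulrC a k).
  by rewrite addrACA.
by move=> x; apply: cvgD; [apply: cvgZr; exact: cf|exact: cg].
Qed.

HB.instance Definition _ := GRing.isSubmodClosed.Build R (E -> F) bounded_op
  bounded_op_submod.
HB.instance Definition _ := [SubChoice_isSubLmodule of bop by <:].

Lemma bop_eqP (f g : bop) : f =1 g -> f = g.
Proof. by move=> fg; apply: val_inj; apply/funext. Qed.

Lemma bop0E x : (0 : bop) x = 0. Proof. by []. Qed.
Lemma bopDE (f g : bop) x : (f + g) x = f x + g x. Proof. by []. Qed.
Lemma bopNE (f : bop) x : (- f) x = - f x. Proof. by []. Qed.
Lemma bopZE k (f : bop) x : (k *: f) x = k *: f x. Proof. by []. Qed.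

Definition op_norm (f : bop) : R :=
  sup [set `|f x| | x in [set x : E | `|x| <= 1]].

Let S (f : bop) := [set `|f x| | x in [set x : E | `|x| <= 1]].

Lemma bop_bounded (f : bop) : exists2 M, 0 < M & forall x, `|f x| <= M * `|x|.
Proof.
have /linear_bounded_continuous/linear_boundedP := @bop_continuous f.
by move=> /pinfty_ex_gt0[M M0 fM]; exists M.
Qed.

Lemma op_norm_has_sup (f : bop) : has_sup (S f).
Proof.
split; first by exists `|f 0|, 0 => //=; rewrite normr0 ler01.
have [M M0 fM] := bop_bounded f; exists M => _ [x /= x1 <-].
by rewrite (le_trans (fM x))// ler_piMr// ltW.
Qed.

Lemma op_norm_le (f : bop) x : `|f x| <= op_norm f * `|x|.
Proof.
have [->|x0] := eqVneq x 0; first by rewrite linear0 !normr0 mulr0.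
rewrite -ler_pdivrMr ?normr_gt0//.
apply: (ub_le_sup (proj2 (op_norm_has_sup f))).
exists (`|x|^-1 *: x) => /=.
  by rewrite normrZ ger0_norm ?invr_ge0// mulVf ?normr_eq0.
by rewrite linearZ/= normrZ ger0_norm ?invr_ge0// mulrC.
Qed.

Lemma op_norm_lub (f : bop) M : 0 <= M ->
  (forall x, `|f x| <= M * `|x|) -> op_norm f <= M.
Proof.
move=> M0 fM; apply: ge_sup; first exact: (op_norm_has_sup f).1.
by move=> _ [x /= x1 <-]; rewrite (le_trans (fM x))// ler_piMr.
Qed.

Lemma op_norm_ge0 (f : bop) : 0 <= op_norm f.
Proof.
apply: (le_trans (normr_ge0 (f 0))).
apply: (ub_le_sup (proj2 (op_norm_has_sup f))).
by exists 0 => //=; rewrite normr0 ler01.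
Qed.

Lemma op_normD f g : op_norm (f + g) <= op_norm f + op_norm g.
Proof.
apply: op_norm_lub => [|x]; first by rewrite addr_ge0 ?op_norm_ge0.
by rewrite bopDE mulrDl (le_trans (ler_normD _ _))// lerD ?op_norm_le.
Qed.

Let op_normZ_le k f : op_norm (k *: f) <= `|k| * op_norm f.
Proof.
apply: op_norm_lub => [|x]; first by rewrite mulr_ge0 ?op_norm_ge0.
by rewrite bopZE normrZ -mulrA ler_wpM2l ?op_norm_le.
Qed.

Lemma op_normZ k f : op_norm (k *: f) = `|k| * op_norm f.
Proof.
apply/eqP; rewrite eq_le op_normZ_le/=.
have [->|k0] := eqVneq k 0; first by rewrite normr0 mul0r op_norm_ge0.
rewrite -ler_pdivlMl ?normr_gt0// -normfV.
by rewrite -[X in op_norm X <= _](scalerK k0); exact: op_normZ_le.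
Qed.

Lemma op_norm_eq0 f : op_norm f = 0 -> f = 0.
Proof.
move=> f0; apply: bop_eqP => x; apply/normr0_eq0/eqP; rewrite eq_le normr_ge0.
by rewrite (le_trans (op_norm_le f x))// f0 mul0r.
Qed.

HB.instance Definition _ :=
  Lmodule_isNormed.Build R bop op_normD op_normZ op_norm_eq0.

End BoundedOperators.

Arguments bop {R} E F.

Section BoundedOperatorsComplete.
Context {R : realType} {E : normedModType R} {F : completeNormedModType R}.

Lemma bop_cauchy_cvg (G : set_system (bop E F)) :
  ProperFilter G -> cauchy G -> cvg G.
Proof.
move=> PG cG.
have cG' e : 0 < e -> exists f, \forall g \near G, `|f - g| <= e.
  move=> e0; have [f Gf] := (cauchyP G).1 cG e e0; exists f.
  by near=> g; apply: ltW; near: g; rewrite -ball_normE in Gf.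
have Gx (x : E) : cvg ((fun f : bop E F => f x) @ G).
  apply: cauchy_cvg; apply/cauchy_exP => e e0.
  have d0 : 0 < e / (2 * (`|x| + 1)) by rewrite divr_gt0// mulr_gt0// ltr_wpDl.
  have [f Gf] := cG' _ d0; exists (f x).
  apply: filterS Gf => g fg; rewrite -ball_normE/=.
  have -> : f x - g x = (f - g) x by [].
  rewrite (le_lt_trans (op_norm_le _ _))//.
  rewrite (@le_lt_trans _ _ (e / (2 * (`|x| + 1)) * (`|x| + 1)))//.
    by rewrite ler_pM// ?op_norm_ge0// lerDl.
  by rewrite invfM mulrA mulfVK ?gt_eqF ?ltr_wpDl// ltr_pdivrMr// ltr_pMr// ltr1n.
pose l x := lim ((fun f : bop E F => f x) @ G).
have lin_l : linear l.
  move=> k x y; apply/cvg_lim => //=.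
  have -> : (fun f : bop E F => f (k *: x + y)) = (fun f => k *: f x + f y).
    by apply/funext => f; rewrite linearP.
  by apply: cvgD; [apply: cvgZr|]; exact: Gx.
pose ll := GRing.isLinear.Build R E F *:%R l lin_l.
pose L : {linear E -> F} := HB.pack l ll.
have le_l f e : (\forall g \near G, `|f - g| <= e) ->
    forall x, `|f x - l x| <= e * `|x|.
  move=> fe x.
  have : (fun g : bop E F => `|f x - g x|) @ G --> `|f x - l x|.
    by apply: cvg_norm; apply: cvgB; [exact: cvg_cst|exact: Gx].
  move=> h; rewrite -(cvg_lim _ h)//; apply: limr_le; first exact: cvgP h.
  apply: filterS fe => g fg.
  by rewrite (le_trans (op_norm_le (f - g) x))// ler_wpM2r.
have cl : continuous l.
  have [f Gf] := cG' 1 ltr01.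
  apply: (@bounded_linear_continuous _ _ _ L); apply/linear_boundedP.
  near=> M => x /=.
  have -> : l x = f x - (f x - l x) by rewrite opprB addrC subrK.
  rewrite (le_trans (ler_normB _ _))//.
  rewrite (le_trans (lerD (op_norm_le f x) (le_l _ _ Gf x)))//.
  by rewrite -mulrDl ler_wpM2r//; near: M; exact: nbhs_pinfty_ge.
have lP : l \in bounded_op by rewrite inE.
apply/cvg_ex; exists (Bop lP); apply/cvgrPdist_le => e e0.
have e20 : 0 < e / 2 by rewrite divr_gt0.
have [f Gf] := cG' _ e20.
near=> g.
have -> : Bop lP - g = (Bop lP - f) + (f - g) by rewrite addrA subrK.
rewrite (le_trans (ler_normD _ _))// [leRHS]splitr lerD//; last by near: g.
apply: op_norm_lub; first exact: ltW.
by move=> x; rewrite distrC; exact: (le_l _ _ Gf x).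
Unshelve. all: by end_near. Qed.

HB.instance Definition _ := Uniform_isComplete.Build (bop E F) bop_cauchy_cvg.

End BoundedOperatorsComplete.

Section OperatorAlgebra.
Context {R : realType} {E : normedModType R}.

Lemma op_id_subproof : (id : E -> E) \in bounded_op.
Proof. by rewrite inE; split=> [//|x]; exact: cvg_id. Qed.

Lemma op_comp_subproof (f g : bop E E) : f \o g \in bounded_op.
Proof.
rewrite inE; split=> [k x y /=|x]; first by rewrite !linearP.
by apply: continuous_comp; exact: bop_continuous.
Qed.

Definition op_id : bop E E := Bop op_id_subproof.
Definition op_comp (f g : bop E E) : bop E E := Bop (op_comp_subproof f g).

Fact op_compA : associative op_comp. Proof. by move=> f g h; exact: bop_eqP. Qed.
Fact op_comp1l : left_id op_id op_comp. Proof. by move=> f; exact: bop_eqP. Qed.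
Fact op_comp1r : right_id op_id op_comp.
Proof. by move=> f; exact: bop_eqP. Qed.
Fact op_compDl : left_distributive op_comp +%R.
Proof. by move=> f g h; exact: bop_eqP. Qed.
Fact op_compDr : right_distributive op_comp +%R.
Proof. by move=> f g h; apply: bop_eqP => x; rewrite /= linearD. Qed.

HB.instance Definition _ := GRing.Zmodule_isPzRing.Build (bop E E)
  op_compA op_comp1l op_comp1r op_compDl op_compDr.

Lemma op1E x : (1 : bop E E) x = x. Proof. by []. Qed.
Lemma opME (f g : bop E E) x : (f * g) x = f (g x). Proof. by []. Qed.

Definition GL : set (bop E E) := [set g | exists h, g * h = 1 /\ h * g = 1].

(* Only meaningful on GL; a two-sided inverse is unique. *)
Definition op_inv (g : bop E E) : bop E E :=
  get [set h | g * h = 1 /\ h * g = 1].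

Definition op_exp (H : bop E E) : bop E E :=
  lim (series (fun n => (n`!%:R : R)^-1 *: H ^+ n) @ \oo).

Definition subgroup_GL (G : set (bop E E)) : Prop :=
  [/\ G `<=` GL, G 1, forall g h, G g -> G h -> G (g * h)
    & forall g, G g -> G (op_inv g)].

Definition closed_in_GL (G : set (bop E E)) : Prop :=
  closure G `&` GL `<=` G.

End OperatorAlgebra.

Arguments GL {R} E.

Fixpoint Cn_on {R : realType} (n : nat) (E F : normedModType R) (O : set E)
    (f : E -> F) : Prop :=
  match n with
  | 0%N => forall x, O x -> {for x, continuous f}
  | m.+1 => exists df : E -> bop E F,
      (forall x, O x -> is_diff x f (df x)) /\ Cn_on m O df
  end.

Definition smooth_on {R : realType} {E F : normedModType R} (O : set E)
    (f : E -> F) : Prop :=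
  forall n, Cn_on n O f.

(* A smooth diffeomorphism between open sets of the ambient space which maps M to the
   trace of a closed linear subspace.  The subspace is presented as the image of a
   Banach space under a linear topological embedding, so that M gets
   coordinates in that Banach space.  As usual for subgroups of Banach-Lie
   groups that are not assumed to be split, the subspace need not be
   complemented. *)
Record submfd_chart {R : realType} {X : normedModType R} (M : set X) :=
  SubmfdChart {
  chart_model : completeNormedModType R;
  chart_dom : set X;
  chart_cod : set X;
  chart_map : X -> X;
  chart_inv : X -> X;
  chart_incl : bop chart_model X;
  chart_retr : X -> chart_model;
  open_chart_dom : open chart_dom;
  open_chart_cod : open chart_cod;
  chart_mapP : forall x, chart_dom x ->
    chart_cod (chart_map x) /\ chart_inv (chart_map x) = x;
  chart_invP : forall y, chart_cod y ->
    chart_dom (chart_inv y) /\ chart_map (chart_inv y) = y;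
  smooth_chart_map : smooth_on chart_dom chart_map;
  smooth_chart_inv : smooth_on chart_cod chart_inv;
  chart_incl_embedding :
    exists2 c : R, 0 < c & forall u, c * `|u| <= `|chart_incl u|;
  chart_inclK : cancel chart_incl chart_retr;
  chart_flat : forall x, chart_dom x ->
    (M x <-> range chart_incl (chart_map x))
}.

Section Submanifolds.
Context {R : realType}.

Definition embedded_submanifold {X : normedModType R} (M : set X) : Prop :=
  forall a, M a -> exists c : submfd_chart M, chart_dom c a.

Definition local_param {X : normedModType R} {M : set X} (c : submfd_chart M)
  (u : chart_model c) : X := chart_inv c (chart_incl c u).

Definition local_coord {X : normedModType R} {M : set X} (c : submfd_chart M)
  (x : X) : chart_model c := chart_retr c (chart_map c x).

(* Smoothness, in all submanifold charts, of a map f from M to N. *)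
Definition smooth_between {X Y : normedModType R} (M : set X) (N : set Y)
    (f : X -> Y) : Prop :=
  forall (c : submfd_chart M) (d : submfd_chart N),
    smooth_on [set u | chart_cod c (chart_incl c u)
                     /\ chart_dom d (f (local_param u))]
      (fun u => local_coord d (f (local_param u))).

Definition tangent_space {X : normedModType R} (M : set X) (a : X) : set X :=
  [set H | exists gamma : R -> X,
    [/\ gamma 0 = a, \forall t \near (0 : R), M (gamma t)
      & is_derive (0 : R) (1 : R) gamma H]].

End Submanifolds.

Section BanachLieSubgroups.
Context {R : realType} {E : normedModType R}.

(* The manifold topology of an embedded submanifold is the induced one, since
   its charts are restrictions of homeomorphisms of the ambient space. *)
Definition embedded_Banach_Lie_subgroup (G : set (bop E E)) : Prop :=
  [/\ subgroup_GL G, closed_in_GL G, embedded_submanifold G,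
      smooth_between (G `*` G) G (fun p : bop E E * bop E E => p.1 * p.2)
    & smooth_between G G op_inv].

Definition lie_algebra (G : set (bop E E)) : set (bop E E) :=
  [set H | forall t : R, G (op_exp (t *: H))].

End BanachLieSubgroups.

HB.mixin Record CompleteNormedModule_isJBAlgebra (R : realType) V
    & CompleteNormedModule R V := {
  jmul : V -> V -> V;
  jone : V;
  jmul_linearl : forall y, linear (jmul^~ y);
  jmul_linearr : forall x, linear (jmul x);
  jmulC : commutative jmul;
  jmul1l : left_id jone jmul;
  jordan_identity : forall x y,
    jmul (jmul x x) (jmul x y) = jmul x (jmul (jmul x x) y);
  jnormM : forall x y, `|jmul x y| <= `|x| * `|y|;
  jnorm_sqr : forall x, `|jmul x x| = `|x| ^+ 2;
  jnorm_sqrD : forall x y, `|jmul x x| <= `|jmul x x + jmul y y|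
}.

#[short(type="jbAlgebraType")]
HB.structure Definition JBAlgebra (R : realType) :=
  { V of CompleteNormedModule R V & CompleteNormedModule_isJBAlgebra R V }.

Section JBAlgebras.
Context {R : realType} {V : jbAlgebraType R}.

Lemma jmul_bounded_op (x : V) : jmul x \in bounded_op.
Proof.
rewrite inE; split; first exact: jmul_linearr.
pose ll := GRing.isLinear.Build R V V *:%R (jmul x) (jmul_linearr x).
pose L : {linear V -> V} := HB.pack (jmul x) ll.
apply: (@bounded_linear_continuous _ _ _ L); apply/linear_boundedP.
near=> M => y /=.
rewrite (le_trans (jnormM x y))// ler_wpM2r//; near: M; exact: nbhs_pinfty_ge.
Unshelve. all: by end_near. Qed.

Definition Lop (x : V) : bop V V := Bop (jmul_bounded_op x).

Definition Uop (x : V) : bop V V :=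
  (2 : R) *: (Lop x * Lop x) - Lop (jmul x x).

Definition Uop2 (x y : V) : bop V V :=
  (2 : R)^-1 *: (Uop (x + y) - Uop x - Uop y).

Definition jinvertible (x : V) : Prop := GL V (Uop x).

Definition jspectrum (x : V) : set R :=
  [set l | ~ jinvertible (x - l *: jone)].

Definition jcone : set V := [set x | jspectrum x `<=` `]0, +oo[].

Definition cone_group : set (bop V V) :=
  [set g | GL V g /\ g @` jcone = jcone].

Definition jaut : set (bop V V) :=
  [set k | GL V k /\ forall a b : V, k (jmul a b) = jmul (k a) (k b)].

Definition Str : set (bop V V) :=
  [set g | GL V g /\ exists gs : bop V V,
    GL V gs /\ forall x : V, Uop (g x) = g * Uop x * gs].

Definition Str0 : set (bop V V) := connected_component Str 1.

Definition str : set (bop V V) :=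
  [set H : bop V V | exists Hbar : bop V V,
    forall x : V, (2 : R) *: Uop2 x (H x) = H * Uop x - Uop x * Hbar].

End JBAlgebras.

Arguments cone_group {R} V.
Arguments jaut {R} V.
Arguments Str {R} V.
Arguments Str0 {R} V.
Arguments str {R} V.

(* Main.v *)
(* Let S be the set of squares. An element x with |1 - x| <= 1 is a square (the
   square root of 1 - w is the limit of an iteration with nonnegative
   coefficients, so it converges for |w| <= 1), whence S is a closed convex cone
   characterised by | |x| 1 - x | <= |x|. The cone Omega is the interior of S, and
   Omega is open and closed in the set of invertible elements; since structure
   group elements preserve invertibility, Str_0 preserves Omega, and it contains
   U_d for d in Omega. A unital g preserving Omega satisfies a Kadison inequality
   g(a^2) >= g(a)^2, as does its inverse, so it is a Jordan automorphism, and
   G(Omega) = U_Omega Aut(V). This gives the decomposition into cosets of Str_0.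

   For the manifold structure, x |-> log(a^-1 x) is a chart at a: e^H lies in Str
   iff the bilinear map (x, y) |-> U_{x,y} is fixed by e^T, where T is the
   derivation attached to H, and for small T this means that T annihilates that
   map, i.e. that H is in str(V). Power series in B(E) are smooth because the divided
   difference of a power series is an off-diagonal block of the same series at a
   2 x 2 triangular operator. *)

From HB Require Import structures.
From mathcomp Require Import all_boot all_order all_algebra.
From mathcomp Require Import all_classical all_reals all_analysis.
From mathcomp Require Import ring lra.
Require Import Defs.

Set Implicit Arguments.
Unset Strict Implicit.
Unset Printing Implicit Defensive.

Import Order.TTheory GRing.Theory Num.Theory.
Import numFieldNormedType.Exports.

Local Open Scope classical_set_scope.
Local Open Scope ring_scope.

(** * Linear combinations *)

(** No spectral theory of JB-algebras is used: positivity is extracted from the norm axioms through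
    polynomials in one element. Two steps carry the weight. An invertible square y is interior to
    the cone because otherwise powers of v = 1 - y/s would be approximate null vectors of U_y:
    |v^(2^k)| = 1, while |v^n (1 - v)| <= 1/n. The Kadison inequality, usually read off a spectral
    resolution, comes from a Bernstein partition of unity with an error of order 1/n.

    In the Lie part, Str and str are defined by existential companions g^* and Hbar. Both are
    determined at x = 1: g^* = g^-1 U_{g1} and Hbar = H - 2 U_{1,H1}. So g^* tends to 1 with g and
    has a logarithm, which supplies Hbar, and str(V) is a closed subspace. Constants for power
    series are uniform in the Banach space, since the series are also evaluated on products, on
    spaces of operators and on spaces of bilinear maps. *)

Section LinearCombinations.
Context {R : pzRingType} {V : lmodType R}.

Inductive lincomb :=
| LAtom of nat
| LZero
| LAdd of lincomb & lincomb
| LOpp of lincomb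
| LNatmul of lincomb & nat
| LScale of R & lincomb.

Fixpoint leval (env : seq V) (t : lincomb) : V :=
  match t with
  | LAtom i => nth 0 env i
  | LZero => 0
  | LAdd t u => leval env t + leval env u
  | LOpp t => - leval env t
  | LNatmul t n => leval env t *+ n
  | LScale k t => k *: leval env t
  end.

Fixpoint lcoef (i : nat) (t : lincomb) : R :=
  match t with
  | LAtom j => if eqn i j then 1 else 0
  | LZero => 0
  | LAdd t u => lcoef i t + lcoef i u
  | LOpp t => - lcoef i t
  | LNatmul t n => lcoef i t *+ n
  | LScale k t => k * lcoef i t
  end.

Fixpoint lagree (n : nat) (t u : lincomb) : Prop :=
  if n is m.+1 then lcoef m t = lcoef m u /\ lagree m t u else True.

Lemma levalE env t : leval env t = \sum_(i < size env) lcoef i t *: env`_i.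
Proof.
elim: t => [j||t IHt u IHu|t IHt|t IHt n|k t IHt] /=.
- have [jn|nj] := ltnP j (size env).
    rewrite (bigD1 (Ordinal jn))//= (_ : eqn j j = true) ?scale1r ?big1 ?addr0//; last exact/eqnP.
    move=> i ij.
    by case: eqnP => [ij'|_]; rewrite ?scale0r//; case/eqP: ij; exact: val_inj.
  rewrite nth_default// big1// => i _; case: eqnP => [ij|_]; rewrite ?scale0r//.
  by move: nj; rewrite -ij leqNgt ltn_ord.
- by rewrite big1// => i _; rewrite scale0r.
- by rewrite IHt IHu -big_split; apply: eq_bigr => i _; rewrite scalerDl.
- by rewrite IHt -sumrN; apply: eq_bigr => i _; rewrite scaleNr.
- by rewrite IHt -sumrMnl; apply: eq_bigr => i _; rewrite scalerMnl.
- by rewrite IHt scaler_sumr; apply: eq_bigr => i _; rewrite scalerA.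
Qed.

Lemma leval_eq env t u : lagree (size env) t u -> leval env t = leval env u.
Proof.
move=> tu; rewrite !levalE; apply: eq_bigr => -[i /= i_lt] _; congr (_ *: _).
elim: (size env) i_lt tu => // n IH; rewrite ltnS leq_eqVlt => /predU1P[->|lt_in].
  by case.
by case=> _; exact: IH.
Qed.

End LinearCombinations.

(* Atoms are compared up to conversion: the same vector often occurs under
   different presentations of its algebraic structure. *)
Ltac lin_index x l :=
  lazymatch l with
  | ?y :: ?l' =>
      match constr:(tt) with
      | _ => let e := constr:(erefl : x = y) in constr:(0%N)
      | _ => let i := lin_index x l' in constr:(i.+1)
      end
  end.

Ltac lin_mem x l :=
  lazymatch l with
  | nil => constr:(false)
  | ?y :: ?l' =>
      match constr:(tt) with
      | _ => let e := constr:(erefl : x = y) in constr:(true)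
      | _ => lin_mem x l'
      end
  end.

Ltac lin_atoms t l :=
  lazymatch t with
  | @Algebra.add _ ?a ?b => let l' := lin_atoms a l in lin_atoms b l'
  | @Algebra.opp _ ?a => lin_atoms a l
  | @GRing.scale _ _ _ ?a => lin_atoms a l
  | @Algebra.natmul _ ?a _ => lin_atoms a l
  | @Algebra.zero _ => l
  | _ => let b := lin_mem t l in
         lazymatch b with true => l | false => constr:(t :: l) end
  end.

Ltac lin_reify R t l :=
  lazymatch t with
  | @Algebra.add _ ?a ?b =>
      let a' := lin_reify R a l in let b' := lin_reify R b l in
      constr:(@LAdd R a' b')
  | @Algebra.opp _ ?a => let a' := lin_reify R a l in constr:(@LOpp R a')
  | @Algebra.natmul _ ?a ?n =>
      let a' := lin_reify R a l in constr:(@LNatmul R a' n)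
  | @GRing.scale _ _ ?k ?a =>
      let a' := lin_reify R a l in constr:(@LScale R k a')
  | @Algebra.zero _ => constr:(@LZero R)
  | _ => let i := lin_index t l in constr:(@LAtom R i)
  end.

(* Decides an equality between linear combinations in a real vector space by
   comparing, with [ring], the coefficients of each atom. *)
Ltac lmod_ring :=
  lazymatch goal with
  | |- @eq ?T ?a ?b =>
      let l0 := lin_atoms a (@nil T) in
      let l := lin_atoms b l0 in
      lazymatch goal with
      | RR : realType |- _ =>
          let t := lin_reify RR a l in
          let u := lin_reify RR b l in
          notypeclasses refine (@leval_eq RR _ l t u _);
          cbn [lagree lcoef size eqn];
          repeat lazymatch goal with
          | |- _ /\ _ => apply: conj
          | |- True => exact: I
          end;
          first [ring | field]
      end
  end.

(** The multipliers [k1] to [k4] are a certificate that the goal follows linearly from the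
    hypotheses; [lmod_ring] checks the last premise. Spare slots repeat a hypothesis with multiplier
    0. *)
Lemma eq_lincomb {R : pzRingType} {V : lmodType R} (l r l1 r1 l2 r2 l3 r3 l4 r4 : V)
    (k1 k2 k3 k4 : R) : l1 = r1 -> l2 = r2 -> l3 = r3 -> l4 = r4 ->
  l - r = k1 *: (l1 - r1) + k2 *: (l2 - r2) + k3 *: (l3 - r3) + k4 *: (l4 - r4) ->
  l = r.
Proof.
move=> -> -> -> ->; rewrite !subrr !scaler0 !addr0 => /eqP.
by rewrite subr_eq0 => /eqP.
Qed.

(** * Bounded operators and differentials *)

Section OperatorCalculus.
Context {R : realType}.
Implicit Types E F G : normedModType R.

Lemma bounded_opP E F (f : E -> F) (M : R) : linear f ->
  (forall x, `|f x| <= M * `|x|) -> f \in bounded_op.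
Proof.
move=> lf fM; rewrite inE; split=> //.
pose ll := GRing.isLinear.Build R E F *:%R f lf.
pose L : {linear E -> F} := HB.pack f ll.
apply: (@bounded_linear_continuous _ _ _ L); apply/linear_boundedP.
near=> N => x /=.
rewrite (le_trans (fM x))// ler_wpM2r//; near: N; exact: nbhs_pinfty_ge.
Unshelve. all: by end_near. Qed.

Lemma bop_appD E F (f : bop E F) x y : f (x + y) = f x + f y.
Proof. exact: linearD. Qed.

Lemma bop_appB E F (f : bop E F) x y : f (x - y) = f x - f y.
Proof. exact: linearB. Qed.

Lemma bop_appN E F (f : bop E F) x : f (- x) = - f x.
Proof. exact: linearN. Qed.

Lemma bop_appZ E F (f : bop E F) k x : f (k *: x) = k *: f x.
Proof. exact: linearZ. Qed.

Lemma bop_app0 E F (f : bop E F) : f 0 = 0.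
Proof. exact: linear0. Qed.

Definition bop_app := (bop_appD, bop_appB, bop_appN, bop_appZ, bop_app0).

Lemma bopBE E F (f g : bop E F) x : (f - g) x = f x - g x.
Proof. by []. Qed.

Lemma bop_ler E F (f : bop E F) x : `|f x| <= `|f| * `|x|.
Proof. exact: op_norm_le. Qed.

Lemma bop_lerl E F (f : bop E F) x M : `|x| <= M -> `|f x| <= `|f| * M.
Proof. by move=> xM; rewrite (le_trans (bop_ler f x))// ler_wpM2l. Qed.

Lemma bop_lub E F (f : bop E F) M : 0 <= M ->
  (forall x, `|f x| <= M * `|x|) -> `|f| <= M.
Proof. exact: op_norm_lub. Qed.

Lemma bop_norm1 E : `|1 : bop E E| <= 1.
Proof. by apply: bop_lub => // x; rewrite op1E mul1r. Qed.

Lemma bopM_ler E (f g : bop E E) : `|f * g| <= `|f| * `|g|.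
Proof.
apply: bop_lub => [|x]; first by rewrite mulr_ge0.
by rewrite opME -mulrA; apply: bop_lerl; exact: bop_ler.
Qed.

Lemma bop_scalerAl E k (f g : bop E E) : k *: (f * g) = (k *: f) * g.
Proof. exact: bop_eqP. Qed.

Lemma bop_scalerAr E k (f g : bop E E) : k *: (f * g) = f * (k *: g).
Proof. by apply: bop_eqP => x; rewrite bopZE !opME bopZE linearZ. Qed.

Lemma bop_normX E (f : bop E E) n : `|f ^+ n| <= `|f| ^+ n.
Proof.
elim: n => [|n IH]; first by rewrite !expr0 bop_norm1.
by rewrite !exprS (le_trans (bopM_ler _ _))// ler_wpM2l.
Qed.

(** The estimate in [e] and [h] is the form that remainder bounds produce; uniqueness of the
    differential recovers the equation hidden in [is_diff]. *)
Lemma is_diff_bopP E F (f : E -> F) (df : bop E F) (x : E) :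
  is_diff x f df <-> forall e : R, 0 < e ->
    \forall h \near (0 : E), `|f (x + h) - f x - df h| <= e * `|h|.
Proof.
split.
  move=> [dfx <-] e e0; have /diff_locally/eqaddoP/(_ e e0) := dfx.
  by apply: filterS => h; rewrite !fctE /= [h + x]addrC opprD addrA.
move=> H; have dfo : f \o shift x = cst (f x) + df +o_ (0 : E) id.
  apply/eqaddoP => e e0; have := H _ e0; apply: filterS => h.
  by rewrite !fctE /= [h + x]addrC opprD addrA.
have dE := diff_unique (@bop_continuous _ _ _ df) dfo.
apply: DiffDef => //; apply/diff_locallyP; rewrite dE; split => //.
exact: bop_continuous.
Qed.

End OperatorCalculus.

(** * Bounded bilinear maps and their product rule *)

Section Composition.
Context {R : realType}.
Implicit Types E F G H : normedModType R.

Lemma bop2P F G H (f : F -> G -> H) (M : R) : (forall v, linear (f^~ v)) ->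
  (forall u, linear (f u)) -> (forall u v, `|f u v| <= M * `|u| * `|v|) ->
  exists B : bop F (bop G H), forall u v, B u v = f u v.
Proof.
move=> lf1 lf2 fM; pose fu u : bop G H := Bop (bounded_opP (lf2 u) (fM u)).
have lfu : linear fu by move=> k u u'; apply: bop_eqP => v; exact: lf1.
have fuM u : `|fu u| <= `|M| * `|u|.
  apply: bop_lub => [|v]; first by rewrite mulr_ge0.
  by rewrite (le_trans (fM u v))// !ler_wpM2r// ler_norm.
by exists (Bop (bounded_opP lfu fuM)).
Qed.

Lemma ocomp_subproof E F G (f : bop F G) (g : bop E F) : f \o g \in bounded_op.
Proof.
apply: (@bounded_opP _ _ _ _ (`|f| * `|g|)) => [k x y|x] /=.
  by rewrite !linearP.
by rewrite -mulrA; apply: bop_lerl; exact: bop_ler.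
Qed.

Definition ocomp E F G (f : bop F G) (g : bop E F) : bop E G :=
  Bop (ocomp_subproof f g).

Lemma ocomp_ler E F G (f : bop F G) (g : bop E F) :
  `|ocomp f g| <= `|f| * `|g|.
Proof.
apply: bop_lub => [|x]; first by rewrite mulr_ge0.
by rewrite -mulrA; exact: (bop_lerl f (bop_ler g x)).
Qed.

Fact comp_op_key E F G : exists B : bop (bop F G) (bop (bop E F) (bop E G)),
  forall f g, B f g = ocomp f g.
Proof.
apply: (@bop2P _ _ _ _ 1) => [g k f f'|f k g g'|f g].
- exact: bop_eqP.
- by apply: bop_eqP => x; rewrite /= linearP.
- by rewrite mul1r ocomp_ler.
Qed.

(** Composition as a bounded bilinear map, so that the derivative of a composite is a bilinear
    expression that can be differentiated again. Being obtained by choice, it is used through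
    [comp_opE]. *)
Definition comp_op E F G : bop (bop F G) (bop (bop E F) (bop E G)) :=
  projT1 (cid (comp_op_key E F G)).

Lemma comp_opE E F G (f : bop F G) (g : bop E F) : comp_op E F G f g = ocomp f g.
Proof. exact: (projT2 (cid (comp_op_key E F G))). Qed.

Fact flip_op_key F G H (B : bop F (bop G H)) :
  exists B' : bop G (bop F H), forall u v, B' v u = B u v.
Proof.
have [B' BB'] : exists B' : bop G (bop F H), forall v u, B' v u = B u v.
  apply: (@bop2P _ _ _ _ `|B|) => [v k u u'|u k v v'|v u].
  - by rewrite linearP.
  - by rewrite linearP.
  - rewrite (le_trans (bop_ler _ _))// mulrAC ler_wpM2r// bop_ler //.
by exists B' => u v; exact: BB'.
Qed.

Definition flip_op F G H (B : bop F (bop G H)) : bop G (bop F H) :=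
  projT1 (cid (flip_op_key B)).

Lemma flip_opE F G H (B : bop F (bop G H)) u v : flip_op B v u = B u v.
Proof. exact: (projT2 (cid (flip_op_key B))). Qed.

Lemma is_diff_bop_continuous E F (f : E -> F) (df : bop E F) x :
  is_diff x f df -> {for x, continuous f}.
Proof. by move=> [dfx _]; exact: differentiable_continuous. Qed.

Lemma is_diff_ocomp E F G (f : E -> F) (g : F -> G) (df : bop E F)
  (dg : bop F G) x : is_diff x f df -> is_diff (f x) g dg ->
  is_diff x (g \o f) (ocomp dg df).
Proof. by move=> fx gx; exact: is_diff_comp. Qed.

Lemma is_diff_bop E F (f : bop E F) x : is_diff x f f.
Proof.
apply/is_diff_bopP => e e0; near=> h.
by rewrite linearD addrAC addrK subrr normr0 mulr_ge0// ltW.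
Unshelve. all: by end_near. Qed.

Lemma near0_norm_le E (e : R) : 0 < e -> \forall h \near (0 : E), `|h| <= e.
Proof.
move=> e0; have := @nbhsx_ballx _ E 0 e e0; apply: filterS => h.
by rewrite -ball_normE /= sub0r normrN => /ltW.
Qed.

Lemma is_diff_bilin E F G H (B : bop F (bop G H)) (u : E -> F) (v : E -> G)
    (du : bop E F) (dv : bop E G) x : is_diff x u du -> is_diff x v dv ->
  is_diff x (fun y => B (u y) (v y))
    (ocomp (flip_op B (v x)) du + ocomp (B (u x)) dv).
Proof.
move=> ux vx.
pose b (p : F * G) := B p.1 p.2; pose db (p : F * G) := B p.1 (v x) + B (u x) p.2.
have bdb : db \in bounded_op.
  apply: (@bounded_opP _ _ _ _ (`|B| * `|v x| + `|B| * `|u x|)) => [k p q|p].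
    by rewrite /db !bop_app !bopDE !bopZE scalerDr addrACA.
  rewrite (le_trans (ler_normD _ _))// mulrDl lerD//.
    rewrite (le_trans (bop_ler _ _))// mulrAC ler_wpM2r// bop_lerl//.
    by rewrite prod_normE le_max lexx.
  rewrite (le_trans (bop_ler _ _))// ler_pM// ?bop_ler//.
  by rewrite prod_normE le_max lexx orbT.
have bx : is_diff (u x, v x) b (Bop bdb).
  apply/is_diff_bopP => e e0.
  have e0' : 0 < e / (`|B| + 1) by rewrite divr_gt0// ltr_wpDl.
  have := near0_norm_le (F * G)%type e0'; apply: filterS => h hle.
  (* The remainder is exactly [B h.1 h.2], hence quadratic in [h]. *)
  have -> : b ((u x, v x) + h) - b (u x, v x) - Bop bdb h = B h.1 h.2.
    by rewrite /b /= /db !bop_app !bopDE; lmod_ring.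
  have h1 : `|h.1| <= `|h| by rewrite prod_normE le_max lexx.
  have h2 : `|h.2| <= `|h| by rewrite prod_normE le_max lexx orbT.
  rewrite (le_trans (bop_ler _ _))// ler_pM//.
  rewrite (le_trans (bop_lerl B (le_trans h1 hle)))//.
  by rewrite mulrCA ger_pMr// ler_pdivrMr ?ltr_wpDl// mul1r lerDl.
have pairx := is_diff_pair ux vx.
have dE : Bop bdb \o (fun y => (du y, dv y)) =
    ocomp (flip_op B (v x)) du + ocomp (B (u x)) dv :> (E -> H).
  apply/funext => h.
  by rewrite -[RHS]/(flip_op B (v x) (du h) + B (u x) (dv h)) flip_opE.
by rewrite -dE; exact: (is_diff_comp pairx bx).
Qed.

End Composition.

(** * Maps of class C^n *)

Section Smoothness.
Context {R : realType}.
Implicit Types E F G H : normedModType R.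

Lemma Cn_on_subset n E F (O O' : set E) (f : E -> F) :
  O' `<=` O -> Cn_on n O f -> Cn_on n O' f.
Proof.
elim: n F f => [|n IH] F f OO'; first by move=> fO x /OO'/fO.
by case=> df [fO dfO]; exists df; split=> [x /OO'/fO//|]; exact: IH.
Qed.

Lemma Cn_on_leS n E F (O : set E) (f : E -> F) :
  Cn_on n.+1 O f -> Cn_on n O f.
Proof.
elim: n F f => [|n IH] F f [df [fO dfO]].
  by move=> x /fO; exact: is_diff_bop_continuous.
by exists df; split=> //; exact: IH.
Qed.

Lemma Cn_on_continuous n E F (O : set E) (f : E -> F) x :
  Cn_on n O f -> O x -> {for x, continuous f}.
Proof. by move=> + Ox; elim: n => [|n IH /Cn_on_leS//] fO; exact: fO. Qed.

Lemma is_diff_bop_ext E F (O : set E) (f g : E -> F) (df : bop E F) x :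
  open O -> O x -> {in O, f =1 g} -> is_diff x f df -> is_diff x g df.
Proof.
move=> oO Ox fg /is_diff_bopP fx; apply/is_diff_bopP => e e0.
have Oh : \forall h \near (0 : E), O (x + h).
  have cx : {for (0 : E), continuous (fun h => x + h)}.
    by apply: cvgD; [exact: cvg_cst|exact: cvg_id].
  by apply: cx; rewrite addr0; exact: open_nbhs_nbhs.
near=> h; rewrite -!fg ?inE//; first by near: h; exact: fx.
by near: h.
Unshelve. all: by end_near. Qed.

Lemma Cn_on_ext n E F (O : set E) (f g : E -> F) :
  open O -> {in O, f =1 g} -> Cn_on n O f -> Cn_on n O g.
Proof.
move=> oO; case: n => [|n] fg.
  move=> fO x Ox; rewrite /prop_for /continuous_at -fg ?inE//.
  apply: cvg_trans (fO x Ox); apply: near_eq_cvg.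
  have := open_nbhs_nbhs (conj oO Ox); apply: filterS => y Oy.
  by rewrite fg ?inE.
case=> df [fO dfO]; exists df; split=> // x Ox.
exact: (is_diff_bop_ext oO Ox fg (fO x Ox)).
Qed.

Lemma Cn_on_cst n E F (O : set E) (c : F) : Cn_on n O (fun=> c).
Proof.
elim: n F c => [|n IH] F c; first by move=> x _; exact: cvg_cst.
exists (fun=> 0); split=> // x _; apply/is_diff_bopP => e e0; near=> h.
by rewrite subrr sub0r normrN bop0E normr0 mulr_ge0// ltW.
Unshelve. all: by end_near. Qed.

Lemma Cn_on_bop n E F (O : set E) (f : bop E F) : Cn_on n O f.
Proof.
case: n => [|n]; first by move=> x _; exact: bop_continuous.
exists (fun=> f); split; last exact: Cn_on_cst.
by move=> x _; exact: is_diff_bop.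
Qed.

Lemma Cn_on_id n E (O : set E) : Cn_on n O id.
Proof. exact: (@Cn_on_bop n E E O 1). Qed.

Lemma Cn_onD n E F (O : set E) (f g : E -> F) : Cn_on n O f -> Cn_on n O g ->
  Cn_on n O (fun x => f x + g x).
Proof.
elim: n F f g => [|n IH] F f g.
  by move=> fO gO x Ox; apply: cvgD; [exact: fO|exact: gO].
move=> [df [fO dfO]] [dg [gO dgO]]; exists (fun x => df x + dg x); split.
  by move=> x Ox; exact: is_diffD (fO x Ox) (gO x Ox).
exact: IH.
Qed.

(** The product rule gives a sum of two bilinear expressions of the same kind with operator-valued
    arguments; the induction therefore quantifies over the spaces and over [B]. *)
Lemma Cn_on_bilin n E F G H (O : set E) (B : bop F (bop G H)) (u : E -> F)
    (v : E -> G) : Cn_on n O u -> Cn_on n O v ->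
  Cn_on n O (fun x => B (u x) (v x)).
Proof.
elim: n F G H B u v => [|n IH] F G H B u v.
  move=> uO vO x Ox.
  have bx : {for (u x, v x), continuous (fun p : F * G => B p.1 p.2)}.
    have i1 : (fst : F * G -> F) \in bounded_op.
      apply: (@bounded_opP _ _ _ _ 1) => [k p q //|p].
      by rewrite mul1r prod_normE le_max lexx.
    have i2 : (snd : F * G -> G) \in bounded_op.
      apply: (@bounded_opP _ _ _ _ 1) => [k p q //|p].
      by rewrite mul1r prod_normE le_max lexx orbT.
    exact: is_diff_bop_continuous (is_diff_bilin B
      (is_diff_bop (Bop i1) (u x, v x)) (is_diff_bop (Bop i2) (u x, v x))).
  apply: (@continuous_comp _ _ _ (fun x => (u x, v x)) _ x _ bx).
  by apply: cvg_pair => /=; [exact: uO|exact: vO].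
move=> /[dup] /Cn_on_leS uOn [du [uO duO]] /[dup] /Cn_on_leS vOn [dv [vO dvO]].
(* [B1] and [B2] are [B] with a derivative composed into its first, respectively second,
   argument. *)
pose B1 := flip_op (ocomp (comp_op E F H) (flip_op B)).
pose B2 := ocomp (comp_op E G H) B.
exists (fun x => B1 (du x) (v x) + B2 (u x) (dv x)); split; last first.
  by apply: Cn_onD; exact: IH.
move=> x Ox; have := is_diff_bilin B (uO x Ox) (vO x Ox).
have -> : B1 (du x) (v x) = ocomp (flip_op B (v x)) (du x).
  by rewrite /B1 flip_opE; exact: (comp_opE (flip_op B (v x)) (du x)).
have -> // : B2 (u x) (dv x) = ocomp (B (u x)) (dv x).
exact: (comp_opE (B (u x)) (dv x)).
Qed.

Lemma Cn_on_comp n E F G (O : set E) (O' : set F) (f : E -> F) (g : F -> G) :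
  (forall x, O x -> O' (f x)) -> Cn_on n O f -> Cn_on n O' g ->
  Cn_on n O (fun x => g (f x)).
Proof.
elim: n E F G O O' f g => [|n IH] E F G O O' f g fOO'.
  move=> fO gO x Ox; apply: (@continuous_comp _ _ _ f g); first exact: fO.
  exact/gO/fOO'.
move=> /[dup] /Cn_on_leS fOn [df [fO dfO]] [dg [gO dgO]].
exists (fun x => comp_op E F G (dg (f x)) (df x)); split; last first.
  by apply: Cn_on_bilin => //; exact: IH fOO' fOn dgO.
move=> x Ox; rewrite comp_opE.
by apply: is_diff_ocomp; [exact: fO|exact/gO/fOO'].
Qed.

Lemma Cn_on_lin n E F G (O : set E) (L : bop F G) (f : E -> F) :
  Cn_on n O f -> Cn_on n O (fun x => L (f x)).
Proof. by move=> fO; exact: Cn_on_comp fO (@Cn_on_bop n F G setT L). Qed.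

End Smoothness.

(** * Power series of operators *)

Section ProductComplete.
Context {R : realType} {E F : completeNormedModType R}.
Let EF : normedModType R := (E * F)%type.

(** The triangular operators below act on a product, and power series are taken over complete
    spaces. *)
Lemma prod_cauchy_cvg (G : set_system EF) :
  ProperFilter G -> cauchy G -> cvg G.
Proof.
move=> PG /cauchyP cG.
have c1 : cvg ((fst : EF -> E) @ G).
  apply: cauchy_cvg; apply/cauchy_exP => e e0; have [p Gp] := cG e e0.
  exists p.1; apply: (@filterS EF G _ (ball p e) _ _ Gp) => q; rewrite -!ball_normE /= prod_normE gt_max.
  by case/andP.
have c2 : cvg ((snd : EF -> F) @ G).
  apply: cauchy_cvg; apply/cauchy_exP => e e0; have [p Gp] := cG e e0.
  exists p.2; apply: (@filterS EF G _ (ball p e) _ _ Gp) => q; rewrite -!ball_normE /= prod_normE gt_max.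
  by case/andP.
apply/cvg_ex; exists ((lim ((fst : EF -> E) @ G), lim ((snd : EF -> F) @ G)) : EF).
have -> : G = (fun p : EF => ((p.1, p.2) : EF)) @ G.
  by apply/funext => A; congr (G _); apply/funext => -[].
exact: cvg_pair c1 c2.
Qed.

HB.instance Definition _ :=
  Uniform_isComplete.Build (E * F)%type prod_cauchy_cvg.
End ProductComplete.

Lemma normed_cvg_unique {K : numFieldType} {V : normedModType K}
    (G : set_system V) {PG : ProperFilter G} (l l' : V) :
  G --> l -> G --> l' -> l = l'.
Proof. by move=> Gl Gl'; apply: (@cvg_unique V _ G PG) => //; exact: norm_hausdorff. Qed.

Section PowerSeries.
Context {R : realType}.
Implicit Types E F : completeNormedModType R.

(** Cauchy's estimate: the radius of convergence is at least [r]. *)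
Definition coef_bound (c : nat -> R) (r : R) : Prop :=
  0 < r /\ exists M, forall n, `|c n| * r ^+ n <= M.

Definition pser E (c : nat -> R) (A : bop E E) : bop E E :=
  lim (series (fun n => c n *: A ^+ n) @ \oo).

Lemma op_expE E (A : bop E E) : op_exp A = pser (fun n => (n`!%:R)^-1) A.
Proof. by []. Qed.

Section Bounds.
Variables (c : nat -> R) (r : R).
Hypothesis cr : coef_bound c r.

(** Comparison with a geometric series of ratio [rho / r]. The bound [M] is chosen before the space
    [E], so one constant also serves operators on products and on operator spaces. *)
Lemma pser_bounded (rho : R) : rho < r -> exists2 M, 0 <= M &
  forall E (A : bop E E), `|A| <= rho ->
    cvgn (series (fun n => c n *: A ^+ n)) /\ `|pser c A| <= M.
Proof.
move=> rho_r; have [r0 [M cM]] := cr.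
have M0 : 0 <= M by apply: le_trans (cM 0%N); rewrite mulr_ge0// exprn_ge0// ltW.
have [rho0|rho0] := ltP rho 0.
  by exists 0 => // E A Ar; have := le_lt_trans (normr_ge0 A) (le_lt_trans Ar rho0);
    rewrite ltxx.
pose q := rho / r.
have q1 : `|q| < 1 by rewrite ger0_norm ?divr_ge0// ?ltW// ltr_pdivrMr// mul1r.
have cvq := is_cvg_geometric_series (a := M) q1.
have q0 : 0 <= q by rewrite divr_ge0// ltW.
exists (limn (series (geometric M q))) => [|E A Ar].
  apply: limr_ge => //; near=> n; rewrite /series/= sumr_ge0// => i _.
  by rewrite mulr_ge0// exprn_ge0.
have cA n : `|c n *: A ^+ n| <= geometric M q n.
  rewrite normrZ /=.
  have : `|A ^+ n| <= rho ^+ n.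
    by rewrite (le_trans (bop_normX _ _))// lerXn2r ?nnegrE.
  move=> /(ler_wpM2l (normr_ge0 (c n)))/le_trans; apply.
  rewrite /q expr_div_n mulrA ler_pdivlMr ?exprn_gt0// mulrAC.
  by rewrite ler_wpM2r// exprn_ge0.
have cvn : cvgn [normed series (fun n => c n *: A ^+ n)].
  by apply: series_le_cvg cvq => //= n; rewrite mulr_ge0// exprn_ge0.
split; first exact: normed_cvg.
rewrite (le_trans (lim_series_norm cvn))//.
exact: lim_series_le.
Unshelve. all: by end_near. Qed.

Lemma pser_cvg E (A : bop E E) : `|A| < r ->
  series (fun n => c n *: A ^+ n) @ \oo --> pser c A.
Proof. by move=> Ar; have [M _ /(_ E A (lexx _))[]] := pser_bounded Ar. Qed.

Lemma pser_app_cvg E (A : bop E E) x : `|A| < r ->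
  (fun n => \sum_(0 <= i < n) c i *: (A ^+ i) x) @ \oo --> pser c A x.
Proof.
(* Evaluation at [x] is a bounded operator: the flip of the identity. *)
move=> Ar; pose ev := flip_op (1 : bop (bop E E) (bop E E)) x.
have -> : (fun n => \sum_(0 <= i < n) c i *: (A ^+ i) x) =
    ev \o series (fun n => c n *: A ^+ n).
  apply/funext => n; rewrite /= /series /= linear_sum; apply: eq_bigr => i _.
  by rewrite linearZ /= /ev flip_opE.
have -> : pser c A x = ev (pser c A) by rewrite /ev flip_opE.
by apply: continuous_cvg; [exact: bop_continuous|exact: pser_cvg].
Qed.

Arguments pser_app_cvg {E A} x.

(** The relation passes to powers by induction and to the limit by continuity of [J]. It yields both
    commutation and the divided difference formula. *)
Lemma pser_intertwine E F (J : bop E F) (A : bop E E) (B : bop F F) :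
  `|A| < r -> `|B| < r -> (forall x, B (J x) = J (A x)) ->
  forall x, pser c B (J x) = J (pser c A x).
Proof.
move=> Ar Br BJ x; apply: (normed_cvg_unique (pser_app_cvg (J x) Br)).
have -> : (fun n => \sum_(0 <= i < n) c i *: (B ^+ i) (J x)) =
    J \o (fun n => \sum_(0 <= i < n) c i *: (A ^+ i) x).
  apply/funext => n; rewrite /= linear_sum; apply: eq_bigr => i _ /=.
  rewrite bop_appZ; congr (_ *: _).
  elim: i x => // i IH x; rewrite !exprSr !opME BJ IH //.
by apply: continuous_cvg; [exact: bop_continuous|exact: pser_app_cvg].
Qed.

End Bounds.

Arguments pser_app_cvg {c r} cr {E A} x.

Lemma coef_boundS c r : coef_bound c r -> coef_bound (c \o S) r.
Proof.
move=> [r0 [M cM]]; split=> //; exists (M / r) => n.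
by rewrite ler_pdivlMr// -mulrA -exprSr; exact: cM.
Qed.

Lemma pserS c r E (A : bop E E) : coef_bound c r -> `|A| < r ->
  pser c A = c 0%N *: (1 : bop E E) + (pser (c \o S) A * A : bop E E).
Proof.
move=> cr Ar; apply: bop_eqP => x.
rewrite bopDE bopZE opME.
have := pser_app_cvg cr x Ar; rewrite -cvg_shiftS.
have := cvgD (cvg_cst (c 0%N *: x))
  (pser_app_cvg (coef_boundS cr) (A x) Ar).
move=> h1 h2; apply: (normed_cvg_unique h2).
set u := (X in X @ _ --> _) in h1; suff <- : u = [sequence \sum_(0 <= i < n.+1)
    c i *: (A ^+ i) x]_n by exact: h1.
apply/funext => n; rewrite /u /= big_nat_recl// expr0 op1E; congr (_ + _).
by apply: eq_bigr => i _ /=; rewrite exprSr opME.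
Qed.

Lemma pser_comm c r E (A B : bop E E) : coef_bound c r -> `|A| < r ->
  B * A = A * B -> pser c A * B = B * pser c A.
Proof.
move=> cr Ar BA; apply: bop_eqP => x; rewrite !opME.
by rewrite (pser_intertwine cr Ar Ar) // => y; rewrite -!opME BA.
Qed.

Lemma pser0 c r E : coef_bound c r ->
  pser c (0 : bop E E) = c 0%N *: (1 : bop E E).
Proof.
by move=> cr; rewrite (pserS cr) ?mulr0 ?addr0// normr0; case: cr.
Qed.

End PowerSeries.

(** * Divided differences and smoothness of power series *)

Section PowerSeriesSmooth.
Context {R : realType}.
Implicit Types E F : completeNormedModType R.

Lemma pser_morph (c : nat -> R) r E F (L : bop (bop E E) (bop F F)) A :
  coef_bound c r -> `|A| < r -> `|L A| < r ->
  (forall n, L (A ^+ n) = L A ^+ n) -> pser c (L A) = L (pser c A).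
Proof.
move=> cr Ar LAr LX; apply: (normed_cvg_unique (pser_cvg cr LAr)).
have -> : series (fun n => c n *: L A ^+ n) =
    L \o series (fun n => c n *: A ^+ n).
  apply/funext => n; rewrite /= /series /= linear_sum; apply: eq_bigr => i _.
  by rewrite linearZ /= LX.
by apply: continuous_cvg; [exact: bop_continuous|exact: (pser_cvg cr)].
Qed.

Definition lmul_op E : bop (bop E E) (bop (bop E E) (bop E E)) := comp_op E E E.
Definition rmul_op E : bop (bop E E) (bop (bop E E) (bop E E)) :=
  flip_op (comp_op E E E).

Lemma lmul_opE E (A B : bop E E) : lmul_op E A B = A * B.
Proof. by rewrite /lmul_op comp_opE; exact: bop_eqP. Qed.

Lemma rmul_opE E (A B : bop E E) : rmul_op E A B = B * A.
Proof. by rewrite /rmul_op flip_opE comp_opE; exact: bop_eqP. Qed.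

Lemma lmul_op_norm E (A : bop E E) : `|lmul_op E A| <= `|A|.
Proof. by apply: bop_lub => // B; rewrite lmul_opE bopM_ler. Qed.

Lemma rmul_op_norm E (A : bop E E) : `|rmul_op E A| <= `|A|.
Proof. by apply: bop_lub => // B; rewrite rmul_opE mulrC bopM_ler. Qed.

Lemma rmul_opX E (A : bop E E) n : rmul_op E (A ^+ n) = rmul_op E A ^+ n.
Proof.
elim: n => [|n IH]; first by apply: bop_eqP => B; rewrite rmul_opE !expr0 mulr1.
by apply: bop_eqP => B; rewrite exprSr exprS opME -IH !rmul_opE mulrA.
Qed.

Lemma lmul_opX E (A : bop E E) n : lmul_op E (A ^+ n) = lmul_op E A ^+ n.
Proof.
elim: n => [|n IH]; first by apply: bop_eqP => B; rewrite lmul_opE !expr0 mul1r.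
by apply: bop_eqP => B; rewrite !exprS opME -IH !lmul_opE mulrA.
Qed.

Fact fst_op_subproof (E F : normedModType R) : (fst : E * F -> E) \in bounded_op.
Proof.
apply: (@bounded_opP _ _ _ _ 1) => [k p q //|p].
by rewrite mul1r prod_normE le_max lexx.
Qed.
Definition fst_op (E F : normedModType R) : bop (E * F)%type E :=
  Bop (fst_op_subproof E F).

Fact snd_op_subproof (E F : normedModType R) : (snd : E * F -> F) \in bounded_op.
Proof.
apply: (@bounded_opP _ _ _ _ 1) => [k p q //|p].
by rewrite mul1r prod_normE le_max lexx orbT.
Qed.
Definition snd_op (E F : normedModType R) : bop (E * F)%type F :=
  Bop (snd_op_subproof E F).

Lemma pair_op_subproof (E F G : normedModType R) (f : bop E F) (g : bop E G) :
  (fun x => (f x, g x)) \in bounded_op.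
Proof.
apply: (@bounded_opP _ _ _ _ (`|f| + `|g|)) => [k x y|x].
  by rewrite !bop_app.
rewrite prod_normE ge_max mulrDl /=.
apply/andP; split; apply: (le_trans (bop_ler _ _)).
  by rewrite lerDl mulr_ge0.
by rewrite lerDr mulr_ge0.
Qed.
Definition pair_op (E F G : normedModType R) (f : bop E F) (g : bop E G) :
  bop E (F * G)%type := Bop (pair_op_subproof f g).

(* The upper triangular operator with diagonal (left multiplication by [A],
   right multiplication by [C]) and off-diagonal entry [d]. The off-diagonal
   block of a power series at this operator is [d] times the divided
   difference of that power series at [A] and [C]. *)
Definition tri_op E (d : R) (A C : bop E E) :
    bop (bop E E * bop E E)%type (bop E E * bop E E)%type :=
  pair_op (ocomp (lmul_op E A) (fst_op _ _) + d *: snd_op _ _)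
          (ocomp (rmul_op E C) (snd_op _ _)).

Lemma tri_opE E d (A C u v : bop E E) :
  tri_op d A C (u, v) = (A * u + d *: v, v * C).
Proof.
rewrite -[LHS]/(lmul_op E A u + d *: v, rmul_op E C v).
by rewrite lmul_opE rmul_opE.
Qed.

(** The reason for the factor [d]: an off-diagonal entry 1 would raise this bound by 1 and leave the
    disc of convergence of the logarithm. *)
Lemma tri_op_norm E (d a : R) (A C : bop E E) : 0 <= d ->
  `|A| <= a -> `|C| <= a -> `|tri_op d A C| <= a + d.
Proof.
move=> d0 Aa Ca; have a0 := le_trans (normr_ge0 A) Aa.
apply: bop_lub => [|[u v]]; first exact: addr_ge0.
have uM : `|u| <= `|(u, v)| by rewrite prod_normE le_max lexx.
have vM : `|v| <= `|(u, v)| by rewrite prod_normE le_max lexx orbT.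
rewrite tri_opE prod_normE ge_max /=; apply/andP; split.
  rewrite (le_trans (ler_normD _ _))// mulrDl lerD//.
    by rewrite (le_trans (bopM_ler _ _))// ler_pM.
  by rewrite normrZ ger0_norm// ler_wpM2l.
rewrite (le_trans (bopM_ler _ _))// mulrC mulrDl.
by rewrite (le_trans (ler_pM _ _ Ca vM))// lerDl mulr_ge0.
Qed.

Lemma tri_opB E (d : R) (A C C' : bop E E) :
  `|tri_op d A C' - tri_op d A C| <= `|C' - C|.
Proof.
apply: bop_lub => // -[u v]; rewrite bopBE !tri_opE.
have -> : (A * u + d *: v, v * C') - (A * u + d *: v, v * C) =
    (0, v * (C' - C)) :> (bop E E * bop E E)%type.
  by rewrite mulrBr; congr pair; rewrite /= subrr.
rewrite prod_normE ge_max normr0 mulr_ge0//= mulrC.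
by rewrite (le_trans (bopM_ler _ _))// ler_wpM2r// prod_normE le_max lexx orbT.
Qed.

Lemma tri_op_affine E d : exists L : bop (bop E E)
    (bop (bop E E * bop E E)%type (bop E E * bop E E)%type),
  forall A, tri_op d A A = tri_op d 0 0 + L A.
Proof.
have [L LE] : exists L : bop (bop E E)
    (bop (bop E E * bop E E)%type (bop E E * bop E E)%type),
    forall A p, L A p = (A * p.1, p.2 * A).
  apply: (@bop2P _ _ _ _ _ 1) => [p k A B|A k p q|A p].
  - by rewrite mulrDl mulrDr -bop_scalerAl -bop_scalerAr.
  - by rewrite mulrDl mulrDr -bop_scalerAl -bop_scalerAr.
  rewrite mul1r prod_normE ge_max /=; apply/andP; split.
    rewrite (le_trans (bopM_ler _ _))// ler_wpM2l//.
    by rewrite prod_normE le_max lexx.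
  rewrite mulrC (le_trans (bopM_ler _ _))// ler_wpM2r//.
  by rewrite prod_normE le_max lexx orbT.
exists L => A; apply: bop_eqP => -[u v].
rewrite bopDE !tri_opE LE mul0r mulr0 add0r.
by apply: injective_projections; rewrite /= ?add0r// addrC.
Qed.

(** The off-diagonal entry, with [d^-1] undoing the factor in [tri_op]. It is assembled from bounded
    operators so as to be linear and continuous in the operator that it reads. *)
Definition corner_op E (d : R) :
    bop (bop (bop E E * bop E E)%type (bop E E * bop E E)%type)
        (bop (bop E E) (bop E E)) :=
  d^-1 *: ocomp (comp_op _ _ _ (fst_op _ _))
                (flip_op (comp_op _ _ _) (pair_op 0 1)).

Lemma corner_opE E d (T : bop (bop E E * bop E E)%type (bop E E * bop E E)%type)
  (B : bop E E) : corner_op E d T B = d^-1 *: (T (0, B)).1.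
Proof.
rewrite -[LHS]/(d^-1 *: (comp_op _ _ _ (fst_op _ _)
  (flip_op (comp_op _ _ _) (pair_op 0 1) T) B)).
by rewrite comp_opE flip_opE comp_opE.
Qed.

Section Fixed.
Variables (c : nat -> R) (r : R).
Hypothesis cr : coef_bound c r.

(** With [T = tri_op d A C], the map [w |-> (w, d^-1 (w C - A w))] intertwines right multiplication
    by [C] with [T], and [w |-> (w, 0)] intertwines left multiplication by [A] with [T]. Their
    values at 1 differ by [d^-1 (0, C - A)]; first components give the formula. *)
Lemma pser_divided_difference E (d a : R) (A C : bop E E) : 0 < d ->
  `|A| <= a -> `|C| <= a -> a + d < r ->
  pser c C - pser c A = corner_op E d (pser c (tri_op d A C)) (C - A).
Proof.
move=> d0 Aa Ca adr.
have ar : a < r by rewrite (lt_trans _ adr)// ltrDl.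
have Tr : `|tri_op d A C| < r := le_lt_trans (tri_op_norm (ltW d0) Aa Ca) adr.
have rC : `|rmul_op E C| < r.
  by rewrite (le_lt_trans (rmul_op_norm _))// (le_lt_trans Ca).
have lA : `|lmul_op E A| < r.
  by rewrite (le_lt_trans (lmul_op_norm _))// (le_lt_trans Aa).
pose J : bop (bop E E) (bop E E * bop E E)%type :=
  pair_op 1 (d^-1 *: (rmul_op E C - lmul_op E A)).
have JE w : J w = (w, d^-1 *: (w * C - A * w)).
  by rewrite -[LHS]/(w, d^-1 *: (rmul_op E C w - lmul_op E A w)) lmul_opE rmul_opE.
have H1 : pser c (tri_op d A C) (J 1) = J (pser c C).
  rewrite (pser_intertwine cr rC Tr) => [|w].
    rewrite (pser_morph cr (le_lt_trans Ca ar) rC); last exact: rmul_opX.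
    by rewrite rmul_opE mul1r.
  rewrite !JE rmul_opE tri_opE scalerA divff ?gt_eqF// scale1r; congr pair.
    by rewrite addrC subrK.
  by rewrite -bop_scalerAl mulrBl mulrA.
pose J0 : bop (bop E E) (bop E E * bop E E)%type := pair_op 1 0.
have H2 : pser c (tri_op d A C) (J0 1) = J0 (pser c A).
  rewrite (pser_intertwine cr lA Tr) => [|w].
    rewrite (pser_morph cr (le_lt_trans Aa ar) lA); last exact: lmul_opX.
    by rewrite lmul_opE mulr1.
  rewrite -[J0 w]/(w, 0) tri_opE scaler0 addr0 mul0r.
  by rewrite -[RHS]/(lmul_op E A w, 0) lmul_opE.
have H3 : J 1 = J0 1 + d^-1 *: (0, C - A).
  rewrite JE mul1r mulr1; apply: injective_projections => /=.
    by rewrite scaler0 addr0.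
  by rewrite add0r.
move: H1; rewrite corner_opE H3 bop_appD bop_appZ H2 JE.
by move=> /(congr1 fst) /= <-; rewrite addrC addrA addNr add0r.
Qed.

Lemma corner_op_norm E d (T : bop (bop E E * bop E E)%type (bop E E * bop E E)%type) :
  0 < d -> `|corner_op E d T| <= d^-1 * `|T|.
Proof.
move=> d0; apply: bop_lub => [|B]; first by rewrite mulr_ge0// invr_ge0 ltW.
rewrite corner_opE normrZ gtr0_norm ?invr_gt0// -mulrA.
rewrite ler_wpM2l ?invr_ge0 ?(ltW d0)//.
have : `|(T (0, B)).1| <= `|T (0, B)| by rewrite [leRHS]prod_normE le_max lexx.
move/le_trans; apply; rewrite (le_trans (bop_ler _ _))// ler_wpM2l//.
by rewrite prod_normE ge_max /= normr0 normr_ge0 lexx.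
Qed.

Lemma pser_lipschitz (a : R) : a < r -> exists2 K, 0 <= K &
  forall E (A C : bop E E), `|A| <= a -> `|C| <= a ->
    `|pser c C - pser c A| <= K * `|C - A|.
Proof.
move=> ar; pose d := (r - a) / 2.
have d0 : 0 < d by rewrite divr_gt0// subr_gt0.
have adr : a + d < r by rewrite /d; lra.
have [M M0 cM] := pser_bounded cr adr.
exists (d^-1 * M) => [|E A C Aa Ca]; first by rewrite mulr_ge0// invr_ge0 ltW.
rewrite (pser_divided_difference d0 Aa Ca adr).
rewrite (le_trans (bop_ler _ _))// ler_wpM2r//.
rewrite (le_trans (corner_op_norm _ d0))// ler_wpM2l ?invr_ge0 ?(ltW d0)//.
by have [] := cM _ _ (tri_op_norm (ltW d0) Aa Ca).
Qed.

(** The remainder at [h] is the change of the divided difference from [(A, A)] to [(A, A + h)],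
    applied to [h]; the Lipschitz bound on the product space makes it quadratic in [h]. *)
Lemma pser_is_diff E (d rho : R) (A : bop E E) : 0 < d -> `|A| < rho ->
  rho + d < r ->
  is_diff A (pser c) (corner_op E d (pser c (tri_op d A A))).
Proof.
move=> d0 Ar rdr; apply/is_diff_bopP => e e0.
have [K K0 cK] := pser_lipschitz rdr.
have e0' : 0 < e / (d^-1 * K + 1).
  by rewrite divr_gt0// ltr_wpDl// mulr_ge0// invr_ge0 ltW.
have Ah0 : 0 < rho - `|A| by rewrite subr_gt0.
near=> h.
have he : `|h| <= e / (d^-1 * K + 1) by near: h; exact: (near0_norm_le (bop E E) e0').
have Ahr : `|A + h| <= rho.
  rewrite (le_trans (ler_normD _ _))// -lerBrDl.
  by near: h; exact: (near0_norm_le (bop E E) Ah0).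
rewrite (pser_divided_difference d0 (ltW Ar) Ahr rdr) addrAC subrr add0r.
rewrite -bopBE -bop_appB (le_trans (bop_ler _ _))// ler_wpM2r//.
rewrite (le_trans (corner_op_norm _ d0))//.
have := cK _ _ _ (tri_op_norm (ltW d0) (ltW Ar) (ltW Ar))
  (tri_op_norm (ltW d0) (ltW Ar) Ahr).
move=> /(ler_wpM2l _)-/(_ d^-1); rewrite invr_ge0 ltW// => /(_ isT)/le_trans; apply.
rewrite mulrA.
have := tri_opB d A A (A + h); rewrite addrAC subrr add0r.
move=> /le_trans/(_ he)/(ler_wpM2l _)-/(_ (d^-1 * K)).
rewrite mulr_ge0 ?invr_ge0 ?(ltW d0)// => /(_ isT)/le_trans; apply.
rewrite mulrCA ger_pMr// ler_pdivrMr ?mul1r ?lerDl//.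
by rewrite ltr_wpDl// mulr_ge0// invr_ge0 ltW.
Unshelve. all: by end_near. Qed.

(** The derivative is the same series on a larger space, preceded by an affine map and followed by a
    bounded linear one; hence the induction varies [E] and [rho]. *)
Lemma pser_Cn n E (rho : R) : rho < r ->
  Cn_on n [set A : bop E E | `|A| < rho] (pser c).
Proof.
elim: n E rho => [|n IH] E rho rho_r; pose d := (r - rho) / 2.
  all: have d0 : 0 < d by rewrite divr_gt0// subr_gt0.
  all: have rdr : rho + d < r by rewrite /d; lra.
  move=> A /= Ar; exact: is_diff_bop_continuous (pser_is_diff d0 Ar rdr).
exists (fun A => corner_op E d (pser c (tri_op d A A))); split.
  by move=> A /= Ar; exact: (pser_is_diff d0 Ar rdr).
apply: Cn_on_lin.
apply: (@Cn_on_comp _ _ _ _ _ _ [set T | `|T| < rho + d]); last exact: IH.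
  move=> A /= Ar; rewrite (le_lt_trans (tri_op_norm (ltW d0) (lexx _) (lexx _)))//.
  by rewrite ltrD2r.
have [L LE] := tri_op_affine E d.
have -> : (fun A => tri_op d A A) = (fun A => tri_op d 0 0 + L A).
  exact/funext.
by apply: Cn_onD; [exact: Cn_on_cst|exact: Cn_on_bop].
Qed.

Lemma pser_commuting_derivative (c' : nat -> R) E (d : R) (A B : bop E E) :
  coef_bound c' r -> (forall n, c' n = c n.+1 * n.+1%:R) -> 0 < d ->
  `|A| + d < r -> A * B = B * A ->
  corner_op E d (pser c (tri_op d A A)) B = pser c' A * B.
Proof.
move=> c'r c'E d0 Adr AB.
have Tr := le_lt_trans (tri_op_norm (ltW d0) (lexx `|A|) (lexx _)) Adr.
have Ar : `|A| < r by rewrite (lt_trans _ Adr)// ltrDl.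
have AnB n : A ^+ n * B = B * A ^+ n.
  elim: n => [|n IH]; first by rewrite expr0 mul1r mulr1.
  by rewrite exprSr -mulrA AB mulrA IH mulrA.
(* For commuting [A] and [B] the corner of the power [n+1] collects [n+1] equal terms [A^n B]. *)
have TX n : (tri_op d A A ^+ n.+1) (0, B) =
    (d *: (n.+1%:R *: (A ^+ n * B)), A ^+ n.+1 * B).
  elim: n => [|n IH].
    by rewrite expr1 tri_opE mulr0 add0r expr0 mul1r scale1r AnB.
  rewrite exprS opME IH tri_opE; congr pair; last first.
    by rewrite -mulrA -AB mulrA -exprSr.
  rewrite -!bop_scalerAr mulrA -exprS -scalerDr; congr (_ *: _).
  by rewrite -[X in _ + X]scale1r -scalerDl natr1.
rewrite corner_opE.
have h1 : (fun n => d^-1 *: (\sum_(0 <= i < n) c i *: (tri_op d A A ^+ i) (0, B)).1)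
    @ \oo --> d^-1 *: (pser c (tri_op d A A) (0, B)).1.
  pose L := d^-1 *: fst_op (bop E E) (bop E E).
  apply: (@continuous_cvg _ _ _ _ _ _ L); first exact: bop_continuous.
  exact: (pser_app_cvg cr).
have h2 : (fun n => \sum_(0 <= i < n) c' i *: (A ^+ i * B)) @ \oo --> pser c' A * B.
  have -> : pser c' A * B = rmul_op E B (pser c' A) by rewrite rmul_opE.
  have -> : (fun n => \sum_(0 <= i < n) c' i *: (A ^+ i * B)) =
      rmul_op E B \o series (fun n => c' n *: A ^+ n).
    apply/funext => n; rewrite /= /series /= linear_sum; apply: eq_bigr => i _.
    by rewrite linearZ /= rmul_opE.
  by apply: continuous_cvg; [exact: bop_continuous|exact: (pser_cvg c'r)].
apply: (normed_cvg_unique _ h2); move: h1; rewrite -cvg_shiftS.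
set u := (X in X @ _ --> _); set v := (X in _ -> X @ _ --> _).
suff -> : u = v by [].
apply/funext => n; rewrite /u /v /= big_nat_recl// expr0 op1E.
rewrite -[fst _]/(fst_op _ _ _) bop_appD bop_appZ [fst_op _ _ _]/= scaler0 add0r.
rewrite linear_sum /= scaler_sumr; apply: eq_bigr => i _.
rewrite TX /= !scalerA c'E; congr (_ *: _).
by rewrite [_^-1 * _]mulrC -[_ * d]mulrA mulVf ?gt_eqF// mulr1.
Qed.

End Fixed.
End PowerSeriesSmooth.

(** * Inversion *)

Section Inverse.
Context {R : realType} {E : completeNormedModType R}.
Implicit Types g h : bop E E.

Lemma op_invP g : GL E g -> g * op_inv g = 1 /\ op_inv g * g = 1.
Proof. by move=> [h gh]; exact: (@getPex _ [set h | g * h = 1 /\ h * g = 1] (ex_intro _ h gh)). Qed.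

Lemma mulVop g : GL E g -> op_inv g * g = 1. Proof. by case/op_invP. Qed.

Lemma mulopV g : GL E g -> g * op_inv g = 1. Proof. by case/op_invP. Qed.

Lemma op_invK g x : GL E g -> op_inv g (g x) = x.
Proof. by move=> gG; rewrite -opME mulVop. Qed.

Lemma op_invKV g x : GL E g -> g (op_inv g x) = x.
Proof. by move=> gG; rewrite -opME mulopV. Qed.

Lemma op_inv_unique g h : g * h = 1 -> h * g = 1 -> op_inv g = h.
Proof.
move=> gh hg; have gG : GL E g by exists h.
by rewrite -[LHS]mulr1 -gh mulrA mulVop// mul1r.
Qed.

Lemma GL1 : GL E 1. Proof. by exists 1; rewrite mulr1. Qed.

Lemma GL_mul g h : GL E g -> GL E h -> GL E (g * h).
Proof.
move=> [g' [gg' g'g]] [h' [hh' h'h]]; exists (h' * g'); split.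
  by rewrite mulrA -(mulrA g) hh' mulr1.
by rewrite mulrA -(mulrA h') g'g mulr1.
Qed.

Lemma GL_inv g : GL E g -> GL E (op_inv g).
Proof. by move=> /op_invP[? ?]; exists g. Qed.

Lemma op_inv_inv g : GL E g -> op_inv (op_inv g) = g.
Proof. by move=> /op_invP[? ?]; exact: op_inv_unique. Qed.

Lemma op_inv1 : op_inv (1 : bop E E) = 1.
Proof. by apply: op_inv_unique; rewrite mulr1. Qed.

Lemma op_invM g h : GL E g -> GL E h -> op_inv (g * h) = op_inv h * op_inv g.
Proof.
move=> /op_invP[a b] /op_invP[c d]; apply: op_inv_unique.
  by rewrite mulrA -(mulrA g) c mulr1.
by rewrite mulrA -(mulrA (op_inv h)) b mulr1.
Qed.

Lemma GL_commute g h : GL E g -> g * h = h * g -> op_inv g * h = h * op_inv g.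
Proof.
move=> gG gh; rewrite -[LHS]mulr1 -(mulopV gG) mulrA -(mulrA _ h) -gh.
by rewrite (mulrA _ g) mulVop// mul1r.
Qed.

Lemma coef_bound_geometric : coef_bound (fun=> 1 : R) 1.
Proof. by split=> //; exists 1 => n; rewrite expr1n normr1 mulr1. Qed.

Lemma GL_near1 g : `|1 - g| < 1 -> GL E g.
Proof.
move=> g1; have cb := coef_bound_geometric.
pose G := pser (fun=> 1 : R) (1 - g).
have GE : G = 1 + G * (1 - g).
  by rewrite {1}/G (pserS cb g1) scale1r.
have Gg : G * g = 1.
  by rewrite -[g in LHS](subKr 1) mulrBr mulr1 {1}GE addrK.
exists G; split=> //; rewrite -[RHS]Gg -[in LHS](subKr 1 g) -[in RHS](subKr 1 g).
rewrite mulrBl mulrBr mul1r mulr1; congr (_ - _).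
by rewrite /G (pser_comm cb g1).
Qed.

Lemma GL_ball g h : GL E g -> `|h - g| * `|op_inv g| < 1 -> GL E h.
Proof.
move=> gG hg; have -> : h = g * (op_inv g * h) by rewrite mulrA mulopV// mul1r.
apply: (GL_mul gG); apply: GL_near1.
rewrite -(mulVop gG) -mulrBr (le_lt_trans (bopM_ler _ _))//.
by rewrite mulrC distrC.
Qed.

Lemma open_GL : open (GL E).
Proof.
rewrite openE => g gG /=.
have e0 : 0 < (`|op_inv g| + 1)^-1 by rewrite invr_gt0 ltr_wpDl.
have := @nbhsx_ballx _ (bop E E) g _ e0; apply: filterS => h.
rewrite -ball_normE /= distrC => hg; apply: (GL_ball gG).
rewrite (@le_lt_trans _ _ (`|h - g| * (`|op_inv g| + 1)))//.
  by rewrite ler_wpM2l// lerDl.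
by rewrite -ltr_pdivlMr ?ltr_wpDl// div1r.
Qed.

(** From [h^-1 = g^-1 - g^-1 (h - g) h^-1], whose last term is at most half of [|h^-1|]. *)
Lemma op_inv_norm_near g h : GL E g -> GL E h ->
  `|h - g| * `|op_inv g| <= 2^-1 -> `|op_inv h| <= 2 * `|op_inv g|.
Proof.
move=> gG hG hg.
have hE : op_inv h = op_inv g - op_inv g * (h - g) * op_inv h.
  rewrite mulrBr mulrBl mulVop// mul1r -mulrA mulopV// mulr1.
  by rewrite opprB addrC subrK.
have : `|op_inv h| <= `|op_inv g| + 2^-1 * `|op_inv h|.
  rewrite {1}hE (le_trans (ler_normB _ _))// lerD2l.
  rewrite (le_trans (bopM_ler _ _))// ler_wpM2r//.
  by rewrite (le_trans (bopM_ler _ _))// mulrC.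
lra.
Qed.

Definition inv_diff g : bop (bop E E) (bop E E) :=
  - comp_op _ _ _ (lmul_op E (op_inv g)) (rmul_op E (op_inv g)).

Lemma inv_diffE g B : inv_diff g B = - (op_inv g * B * op_inv g).
Proof.
by rewrite /inv_diff comp_opE -[LHS]/(- (lmul_op E (op_inv g)
  (rmul_op E (op_inv g) B))) lmul_opE rmul_opE mulrA.
Qed.

Lemma is_diff_op_inv g : GL E g -> is_diff g op_inv (inv_diff g).
Proof.
move=> gG; apply/is_diff_bopP => e e0; set n := `|op_inv g|.
have n0 : 0 <= n by exact: normr_ge0.
have d0 : 0 < 2^-1 / (n + 1) by rewrite divr_gt0// ltr_wpDl.
(* The remainder will be [g^-1 k g^-1 k (g + k)^-1], of norm at most [2 n^3 |k|^2]. *)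
have e0' : 0 < e / (2 * n ^+ 3 + 1).
  by rewrite divr_gt0// ltr_wpDl// mulr_ge0// exprn_ge0.
near=> k.
have kd : `|k| * n <= 2^-1.
  have : `|k| <= 2^-1 / (n + 1).
    by near: k; exact: (near0_norm_le (bop E E) d0).
  rewrite ler_pdivlMr ?ltr_wpDl// => /(le_trans _); apply.
  by rewrite ler_wpM2l// lerDl.
have ke : `|k| <= e / (2 * n ^+ 3 + 1).
  by near: k; exact: (near0_norm_le (bop E E) e0').
have hG : GL E (g + k).
  by apply: (GL_ball gG); rewrite addrAC subrr add0r (le_lt_trans kd)//; lra.
have hn : `|op_inv (g + k)| <= 2 * n.
  by apply: op_inv_norm_near => //; rewrite addrAC subrr add0r.
have -> : op_inv (g + k) - op_inv g - inv_diff g k =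
    op_inv g * k * (op_inv g * k * op_inv (g + k)).
  rewrite inv_diffE opprK.
  have dE : op_inv g - op_inv (g + k) = op_inv g * k * op_inv (g + k).
    have kE : k = (g + k) - g by rewrite addrAC subrr add0r.
    rewrite [X in _ * X * _]kE mulrBr mulrBl.
    by rewrite mulVop// mul1r -mulrA mulopV// mulr1.
  by rewrite -dE mulrBr -dE opprB addrC.
rewrite (le_trans (bopM_ler _ _))//.
rewrite (le_trans (ler_pM _ _ (bopM_ler _ _) (bopM_ler _ _)))//.
rewrite (le_trans (ler_wpM2l _ (ler_pM _ _ (bopM_ler _ _) hn)))//.
rewrite -/n mulrACA; rewrite (_ : _ * _ = `|k| * (2 * n ^+ 3) * `|k|); last by ring.
rewrite ler_wpM2r// (le_trans (ler_wpM2r _ ke))//.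
  by rewrite mulr_ge0// exprn_ge0.
rewrite mulrAC ler_pdivrMr ?ltr_wpDl ?mulr_ge0 ?exprn_ge0//.
by rewrite ler_wpM2l ?(ltW e0)// lerDl.
Unshelve. all: by end_near. Qed.

(** The derivative [B |-> - g^-1 B g^-1] is bilinear in [g^-1] itself, so each order of smoothness
    gives the next. *)
Lemma Cn_on_op_inv n : Cn_on n (GL E) (@op_inv R E).
Proof.
elim: n => [|n IH].
  by move=> g gG; exact: is_diff_bop_continuous (is_diff_op_inv gG).
exists inv_diff; split; first exact: is_diff_op_inv.
have -> : inv_diff = (fun g => (-1 : bop (bop (bop E E) (bop E E)) _)
    (comp_op _ _ _ (lmul_op E (op_inv g)) (rmul_op E (op_inv g)))).
  by apply/funext => g; rewrite /inv_diff bopNE op1E.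
by apply: Cn_on_lin; apply: Cn_on_bilin; exact: Cn_on_lin.
Qed.

Lemma op_inv_continuous g : GL E g -> {for g, continuous (@op_inv R E)}.
Proof. by move=> gG; exact: is_diff_bop_continuous (is_diff_op_inv gG). Qed.

End Inverse.

(** * Exponential and logarithm *)

Section Curves.
Context {R : realType}.

Fact ray_subproof (W : normedModType R) (w : W) :
  (fun t : R => t *: w) \in @bounded_op R R W.
Proof.
apply: (@bounded_opP _ _ _ _ `|w|) => [k x y|x].
  by rewrite scalerDl scalerA.
by rewrite normrZ mulrC.
Qed.

Definition ray (W : normedModType R) (w : W) : bop R W := Bop (ray_subproof w).

Lemma rayE (W : normedModType R) (w : W) t : ray w t = t *: w. Proof. by []. Qed.

(** The tool for uniqueness in differential equations. The scalar [|f t - f 0|] inherits the zero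
    derivative by the reverse triangle inequality, and the mean value theorem applies to it. *)
Lemma deriv0_const (W : normedModType R) (f : R -> W) :
  (forall t : R, 0 <= t <= 1 -> is_diff t f (ray (0 : W))) -> f 1 = f 0.
Proof.
move=> f0; pose phi (t : R) : R := `|f t - f 0|.
have phi0 (t : R) : 0 <= t <= 1 -> is_diff t phi (0 : bop R R).
  move=> /f0 /is_diff_bopP ft; apply/is_diff_bopP => e e0.
  apply: filterS (ft e e0) => h.
  rewrite rayE scaler0 bop0E !subr0; apply: le_trans.
  rewrite /phi (le_trans (ler_dist_dist _ _))//.
  by rewrite opprB addrA subrK.
have d0 (t : R) : t \in `]0, 1[ -> is_derive t 1 phi 0.
  rewrite in_itv /= => /andP[t0 t1].
  have [|dt dE] := phi0 t; first by rewrite !ltW.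
  split; first exact/derivable1_diffP.
  by rewrite deriveE// dE.
have cphi : {within `[0, 1], continuous phi}.
  apply: continuous_in_subspaceT => t; rewrite inE/= in_itv/= => t01.
  exact: is_diff_bop_continuous (phi0 t t01).
have [c _] := MVT_segment ler01 d0 cphi.
rewrite mul0r /phi subrr normr0 subr0 => /normr0_eq0/eqP.
by rewrite subr_eq0 => /eqP.
Qed.

Section Algebra.
Variable E : completeNormedModType R.
Implicit Types (A B H : bop E E) (f g : R -> bop E E).

Lemma curve_mul f g A B (t : R) : is_diff t f (ray A) -> is_diff t g (ray B) ->
  is_diff t (fun s => f s * g s) (ray (A * g t + f t * B)).
Proof.
move=> fA gB; have := is_diff_bilin (lmul_op E) fA gB.
have -> : (fun s => lmul_op E (f s) (g s)) = (fun s => f s * g s).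
  by apply/funext => s; rewrite lmul_opE.
suff -> : ocomp (flip_op (lmul_op E) (g t)) (ray A) + ocomp (lmul_op E (f t)) (ray B)
  = ray (A * g t + f t * B) by [].
apply: bop_eqP => s; rewrite -[LHS]/(flip_op (lmul_op E) (g t) (s *: A) +
  lmul_op E (f t) (s *: B)) flip_opE !lmul_opE rayE scalerDr.
by rewrite bop_scalerAl bop_scalerAr.
Qed.

Lemma curve_ray (W : normedModType R) (w : W) t : is_diff t (fun s : R => s *: w) (ray w).
Proof. exact: (is_diff_bop (ray w) t). Qed.

Lemma curve_cst (W : normedModType R) (w : W) (t : R) : is_diff t (fun=> w) (ray (0 : W)).
Proof.
apply/is_diff_bopP => e e0; near=> h.
by rewrite subrr sub0r normrN rayE scaler0 normr0 mulr_ge0// ltW.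
Unshelve. all: by end_near. Qed.

Lemma curve_comp (F G : normedModType R) (f : R -> F) (g : F -> G) (u : F)
    (dg : bop F G) (t : R) : is_diff t f (ray u) -> is_diff (f t) g dg ->
  is_diff t (fun s => g (f s)) (ray (dg u)).
Proof.
move=> fu gf; have := is_diff_ocomp fu gf.
suff -> : ocomp dg (ray u) = ray (dg u) by [].
by apply: bop_eqP => s; rewrite rayE -bop_appZ.
Qed.

Lemma curveD (W : normedModType R) (f g : R -> W) (u v : W) (t : R) :
  is_diff t f (ray u) -> is_diff t g (ray v) ->
  is_diff t (fun s => f s + g s) (ray (u + v)).
Proof.
move=> fu gv; have -> : ray (u + v) = ray u + ray v :> bop R W.
  by apply: bop_eqP => s; rewrite bopDE !rayE scalerDr.
exact: is_diffD fu gv.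
Qed.

Lemma curve_lin (F G : normedModType R) (f : R -> F) (L : bop F G) (u : F) (t : R) :
  is_diff t f (ray u) -> is_diff t (fun s => L (f s)) (ray (L u)).
Proof. by move=> fu; apply: curve_comp fu _; exact: is_diff_bop. Qed.

Lemma coef_bound_exp r : 0 < r -> coef_bound (fun n => (n`!%:R)^-1 : R) r.
Proof.
move=> r0; split=> //; have /cvg_series_bounded := is_cvg_series_exp_coeff r.
move=> /pinfty_ex_gt0[M M0 hM]; exists M => n.
have := hM n I; rewrite /exp_coeff /= ger0_norm ?divr_ge0 ?exprn_ge0 ?(ltW r0)// => h.
by rewrite ger0_norm ?invr_ge0// mulrC.
Qed.

(** The derivative has its classical form in directions commuting with [A]; the curves exponentiated
    below move only in such directions. *)
Lemma op_exp_diff A : exists2 D : bop (bop E E) (bop E E),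
  is_diff A (@op_exp R E) D & forall B, A * B = B * A -> D B = op_exp A * B.
Proof.
have r0 : 0 < `|A| + 3 by rewrite ltr_wpDl.
have cb := coef_bound_exp r0.
exists (corner_op E 1 (pser (fun n => (n`!%:R)^-1) (tri_op 1 A A))).
  apply: (pser_is_diff cb (rho := `|A| + 1)) => //; first by rewrite ltrDl.
  by rewrite -addrA ltrD2l; lra.
move=> B AB; rewrite op_expE.
apply: (pser_commuting_derivative cb cb) => //; last by rewrite ltrD2l; lra.
move=> n; rewrite factS natrM invfM mulrC mulrA mulfV; first by rewrite mul1r.
by rewrite pnatr_eq0.
Qed.

Lemma op_exp_Cn n (rho : R) : Cn_on n [set A : bop E E | `|A| < rho] (@op_exp R E).
Proof.
have [rho0|rho0] := leP rho 0.
  apply: (@Cn_on_subset _ _ _ _ set0); last first.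
    have := @Cn_on_cst R n (bop E E) (bop E E) set0 0.
    by apply: Cn_on_ext; [exact: open0|move=> x; rewrite inE].
  by move=> A /= /lt_le_trans/(_ rho0); rewrite normr_lt0.
by apply: (pser_Cn (r := rho + 1)); [apply: coef_bound_exp; lra|lra].
Qed.

Lemma op_exp0 : op_exp (0 : bop E E) = 1.
Proof.
by rewrite op_expE (pser0 _ (coef_bound_exp ltr01)) fact0 invr1 scale1r.
Qed.

Lemma op_exp_comm A B : A * B = B * A -> op_exp A * B = B * op_exp A.
Proof.
move=> AB; have r0 : 0 < `|A| + 1 by rewrite ltr_wpDl.
by apply: (pser_comm (coef_bound_exp r0)); rewrite ?ltrDl.
Qed.

Lemma curve_exp f B t : is_diff t f (ray B) -> f t * B = B * f t ->
  is_diff t (fun s => op_exp (f s)) (ray (op_exp (f t) * B)).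
Proof.
move=> fB fBc; have [D fD DE] := op_exp_diff (f t).
by rewrite -(DE _ fBc); exact: curve_comp fB fD.
Qed.

Lemma curve_expZ H t : is_diff t (fun s : R => op_exp (s *: H)) (ray (op_exp (t *: H) * H)).
Proof.
apply: (curve_exp (curve_ray H t)).
by rewrite -bop_scalerAl -bop_scalerAr.
Qed.

Lemma op_expNl H : op_exp (- H) * op_exp H = 1.
Proof.
have /deriv0_const : forall t : R, 0 <= t <= 1 ->
    is_diff t (fun s : R => op_exp (s *: - H) * op_exp (s *: H)) (ray (0 : bop E E)).
  move=> t _; have := curve_mul (curve_expZ (- H) t) (curve_expZ H t).
  suff -> : op_exp (t *: - H) * (- H) * op_exp (t *: H) +
    op_exp (t *: - H) * (op_exp (t *: H) * H) = 0 by [].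
  rewrite -mulrA -mulrDr mulNr -(op_exp_comm (A := t *: H) (B := H)) ?addNr ?mulr0//.
  by rewrite -bop_scalerAl -bop_scalerAr.
by rewrite !scale1r !scale0r op_exp0 mul1r.
Qed.

Lemma op_expNr H : op_exp H * op_exp (- H) = 1.
Proof. by rewrite -{1}(opprK H) op_expNl. Qed.

Lemma GL_exp H : GL E (op_exp H).
Proof. by exists (op_exp (- H)); rewrite op_expNr op_expNl. Qed.

(** Since [0^-1 = 0], the constant term vanishes; the others are the coefficients of
    [log (1 + x)]. *)
Definition log_coef (n : nat) : R := (-1) ^+ n.-1 / n%:R.

Definition op_log A : bop E E := pser log_coef (A - 1).

Lemma coef_bound_log : coef_bound log_coef 1.
Proof.
split=> //; exists 1 => -[|n]; rewrite expr1n mulr1 /log_coef.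
  by rewrite invr0 mulr0 normr0 ler01.
rewrite normrM normrX normrN1 expr1n mul1r ger0_norm ?invr_ge0//.
by rewrite invf_le1 ?ler1n// ltr0n.
Qed.

Lemma coef_bound_alt : coef_bound (fun n => (-1) ^+ n : R) 1.
Proof.
by split=> //; exists 1 => n; rewrite normrX normrN1 !expr1n mulr1.
Qed.

Lemma pser_alt A : `|A| < 1 -> (1 + A) * pser (fun n => (-1) ^+ n : R) A = 1.
Proof.
move=> A1; set P := pser _ A.
have PA : P * A = A * P by apply: (pser_comm coef_bound_alt A1).
have : P = 1 - P * A.
  rewrite {1}/P (pserS coef_bound_alt A1) expr0 scale1r; congr (_ + _).
  rewrite -mulNr; congr (_ * _).
  apply: (normed_cvg_unique (pser_cvg (coef_boundS coef_bound_alt) A1)).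
  have -> : series (fun n => ((fun n => (-1) ^+ n : R) \o S) n *: A ^+ n) =
      - series (fun n => (-1) ^+ n *: A ^+ n).
    rewrite -seriesN; congr series; apply/funext => n.
    by rewrite /= exprS mulN1r scaleNr.
  by apply: cvgN; exact: (pser_cvg coef_bound_alt A1).
move=> PE; rewrite mulrDl mul1r {1}PE PA.
by rewrite subrK.
Qed.

Lemma op_log_diff A : `|A - 1| < 1 -> exists2 D : bop (bop E E) (bop E E),
  is_diff A op_log D & forall B, A * B = B * A -> A * D B = B.
Proof.
(* A quarter of the gap: the radius [|A - 1| + d] plus the off-diagonal entry [d] must stay below
   1. *)
move=> A1; pose d := (1 - `|A - 1|) / 4.
have d0 : 0 < d by rewrite divr_gt0// subr_gt0.
exists (corner_op E d (pser log_coef (tri_op d (A - 1) (A - 1)))).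
  have sh : is_diff A (fun B : bop E E => B - 1) (1 : bop (bop E E) (bop E E)).
    apply/is_diff_bopP => e e0; near=> h.
    rewrite op1E (_ : _ - _ = 0) ?normr0 ?mulr_ge0 ?(ltW e0)//.
    by lmod_ring.
  have := is_diff_ocomp sh (pser_is_diff coef_bound_log (d := d) (rho := `|A - 1| + d) d0 _ _).
  set D := corner_op _ _ _.
  have -> : ocomp D 1 = D by exact: bop_eqP.
  by apply; rewrite ?ltrDl// /d; lra.
move=> B AB.
have c' n : (-1) ^+ n = log_coef n.+1 * n.+1%:R :> R.
  by rewrite /log_coef /= mulfVK// pnatr_eq0.
rewrite (pser_commuting_derivative coef_bound_log coef_bound_alt c' d0).
- by rewrite mulrA -{1}(subrK 1 A) [_ - 1 + 1]addrC pser_alt// mul1r.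
- by rewrite /d; lra.
- by rewrite mulrBl mulrBr AB mul1r mulr1.
Unshelve. all: by end_near. Qed.

Lemma op_logC A B : `|A - 1| < 1 -> A * B = B * A -> op_log A * B = B * op_log A.
Proof.
move=> A1 AB; apply: (pser_comm coef_bound_log A1).
by rewrite mulrBl mulrBr AB mul1r mulr1.
Qed.

Lemma op_log1 : op_log 1 = 0.
Proof.
by rewrite /op_log subrr (pser0 _ coef_bound_log) /log_coef invr0 mulr0 scale0r.
Qed.

Lemma op_log_Cn n (rho : R) : rho < 1 ->
  Cn_on n [set A : bop E E | `|A - 1| < rho] op_log.
Proof.
move=> rho1; apply: (@Cn_on_comp _ _ _ _ _ _ [set T : bop E E | `|T| < rho]
  (fun A => A - 1)) => //; last exact: (pser_Cn coef_bound_log).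
by apply: Cn_onD; [exact: Cn_on_id|exact: Cn_on_cst].
Qed.

(** Along the segment [c] from 1 to [A], the product [exp (- log c) c] has zero derivative, because
    [c' = A - 1] commutes with [c] and [(log c)' = c^-1 c']. *)
Lemma op_logK A : `|A - 1| < 1 -> op_exp (op_log A) = A.
Proof.
move=> A1; pose c (t : R) : bop E E := 1 + t *: (A - 1).
have c1 t : 0 <= t <= 1 -> `|c t - 1| < 1.
  move=> /andP[t0 t1]; rewrite /c addrAC subrr add0r normrZ ger0_norm//.
  by rewrite (le_lt_trans _ A1)// ler_piMl.
have cd (t : R) : is_diff t c (ray (A - 1)).
  by have := curveD (curve_cst (1 : bop E E) t) (curve_ray (A - 1) t); rewrite add0r.
have cA t : c t * (A - 1) = (A - 1) * c t.
  rewrite /c; move: (A - 1) => X.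
  by rewrite mulrDl mulrDr mul1r mulr1 -bop_scalerAl -bop_scalerAr.
suff : op_exp (- op_log A) * A = 1.
  by move=> h; rewrite -[LHS]mulr1 -h mulrA op_expNr mul1r.
have /deriv0_const : forall t : R, 0 <= t <= 1 ->
    is_diff t (fun s : R => op_exp (- op_log (c s)) * c s) (ray (0 : bop E E)).
  move=> t t01; have [D cD DE] := op_log_diff (c1 t t01).
  pose X := A - 1; pose L := D X.
  have cL : c t * L = X by rewrite /L DE.
  have cG : GL E (c t) by apply: GL_near1; rewrite distrC c1.
  have LE : L = op_inv (c t) * X by rewrite -cL mulrA mulVop// mul1r.
  have Lc : c t * L = L * c t.
    by rewrite LE (GL_commute cG (cA t)) mulrA cA -!mulrA mulopV// mulVop// mulr1.
  have dlog : is_diff t (fun s => - op_log (c s)) (ray (- L)).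
    have := curve_lin (-1 : bop (bop E E) (bop E E)) (curve_comp (cd t) cD).
    by rewrite bopNE op1E; apply.
  have lc : - op_log (c t) * - L = - L * - op_log (c t).
    by rewrite !mulNr !mulrN !opprK (op_logC (c1 t t01)).
  have := curve_mul (curve_exp dlog lc) (cd t).
  suff -> : op_exp (- op_log (c t)) * - L * c t + op_exp (- op_log (c t)) * (A - 1) = 0.
    exact.
  by rewrite -mulrA mulNr -Lc cL -mulrDr addNr mulr0.
rewrite /c scale1r scale0r addr0 addrCA subrr addr0 op_log1 oppr0 op_exp0 mulr1.
exact.
Qed.

(** The difference [log (exp (t H)) - t H] has zero derivative; for this the whole segment, not only
    its endpoint, must stay in the disc of the logarithm. *)
Lemma op_expK H : (forall t : R, 0 <= t <= 1 -> `|op_exp (t *: H) - 1| < 1) ->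
  op_log (op_exp H) = H.
Proof.
move=> H1.
have /deriv0_const : forall t : R, 0 <= t <= 1 ->
    is_diff t (fun s : R => op_log (op_exp (s *: H)) + s *: - H) (ray (0 : bop E E)).
  move=> t t01; have [D cD DE] := op_log_diff (H1 t t01).
  have HtH : t *: H * H = H * (t *: H) by rewrite -bop_scalerAl -bop_scalerAr.
  have := curveD (curve_comp (curve_expZ H t) cD) (curve_ray (- H) t).
  suff -> : D (op_exp (t *: H) * H) = H by rewrite subrr.
  have comm : op_exp (t *: H) * (op_exp (t *: H) * H) =
      op_exp (t *: H) * H * op_exp (t *: H).
    by rewrite -[RHS]mulrA -(op_exp_comm HtH).
  rewrite -[LHS]mul1r -(op_expNl (t *: H)) -[LHS]mulrA (DE _ comm) mulrA.
  by rewrite op_expNl mul1r.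
rewrite (scale1r H) (scale1r (- H)) (scale0r H) (scale0r (- H)).
rewrite op_exp0.
rewrite op_log1.
rewrite addr0 => /eqP.
by rewrite subr_eq0 => /eqP.
Qed.

End Algebra.
End Curves.

(** * Exponentials of linear actions on operator spaces *)

Section ExpRepresentation.
Context {R : realType}.

Lemma curve_bilin (F G W : normedModType R) (B : bop F (bop G W)) (f : R -> F)
    (g : R -> G) (u : F) (v : G) (t : R) :
  is_diff t f (ray u) -> is_diff t g (ray v) ->
  is_diff t (fun s => B (f s) (g s)) (ray (B u (g t) + B (f t) v)).
Proof.
move=> fu gv; have := is_diff_bilin B fu gv.
suff -> : ocomp (flip_op B (g t)) (ray u) + ocomp (B (f t)) (ray v)
  = ray (B u (g t) + B (f t) v) by [].
apply: bop_eqP => s; rewrite -[LHS]/(flip_op B (g t) (s *: u) + B (f t) (s *: v)).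
by rewrite flip_opE rayE scalerDr !bop_app.
Qed.

Section Sandwich.
Variables X Y : completeNormedModType R.
Implicit Types (A : bop X X) (C : bop Y Y) (P : bop Y X).

Definition sandwich A C : bop (bop Y X) (bop Y X) :=
  comp_op Y X X A + flip_op (comp_op Y Y X) C.

Lemma sandwichE A C P : sandwich A C P = ocomp A P + ocomp P C.
Proof. by rewrite /sandwich bopDE flip_opE !comp_opE. Qed.

Lemma sandwich_norm A C : `|sandwich A C| <= `|A| + `|C|.
Proof.
apply: bop_lub => [|P]; first exact: addr_ge0.
rewrite sandwichE (le_trans (ler_normD _ _))// mulrDl lerD// ?ocomp_ler//.
by rewrite [leRHS]mulrC ocomp_ler.
Qed.

(** For [t A] and [t C] both sides solve [Q' = S Q] with the same initial value: [exp (- t S) (Q t)]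
    is constant. *)
Lemma exp_sandwich A C P :
  op_exp (sandwich A C) P = ocomp (op_exp A) (ocomp P (op_exp C)).
Proof.
pose S := sandwich A C.
pose Q (t : R) : bop Y X :=
  comp_op Y X X (op_exp (t *: A)) (comp_op Y Y X P (op_exp (t *: C))).
have QE t : Q t = ocomp (op_exp (t *: A)) (ocomp P (op_exp (t *: C))).
  by rewrite /Q !comp_opE.
have tcomm (E : completeNormedModType R) (B : bop E E) (t : R) :
    op_exp (t *: B) * B = B * op_exp (t *: B).
  by apply: op_exp_comm; rewrite -bop_scalerAl -bop_scalerAr.
have Q' (t : R) : is_diff t Q (ray (S (Q t))).
  have := curve_bilin (comp_op Y X X) (curve_expZ A t)
    (curve_lin (comp_op Y Y X P) (curve_expZ C t)).
  suff -> : comp_op Y X X (op_exp (t *: A) * A) (comp_op Y Y X P (op_exp (t *: C))) +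
    comp_op Y X X (op_exp (t *: A)) (comp_op Y Y X P (op_exp (t *: C) * C)) = S (Q t).
    by [].
  rewrite !comp_opE /S sandwichE QE !tcomm; congr (_ + _).
    exact: bop_eqP.
  by rewrite -tcomm; exact: bop_eqP.
have /deriv0_const : forall t : R, 0 <= t <= 1 ->
    is_diff t (fun s : R => op_exp (s *: - S) (Q s)) (ray (0 : bop Y X)).
  move=> t _.
  have := curve_bilin (1 : bop (bop (bop Y X) (bop Y X)) (bop (bop Y X) (bop Y X)))
    (curve_expZ (- S) t) (Q' t).
  suff -> : (1 : bop (bop (bop Y X) (bop Y X)) _) (op_exp (t *: - S) * - S) (Q t) +
    (1 : bop (bop (bop Y X) (bop Y X)) _) (op_exp (t *: - S)) (S (Q t)) = 0 by exact.
  by rewrite !op1E mulrN bopNE opME addNr.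
rewrite !QE (scale1r (- S)) (scale1r A) (scale1r C) (scale0r (- S)) (scale0r A).
rewrite (scale0r C) !op_exp0 op1E.
have -> : ocomp 1 (ocomp P 1) = P by exact: bop_eqP.
by move=> eP; rewrite -[in LHS]eP -opME -/S op_expNr op1E.
Qed.

End Sandwich.

(* [e^T - 1] is [T] times a power series with constant term [1], hence
   invertible for small [T]. *)
Lemma exp_fixed_small : exists2 e : R, 0 < e &
  forall (E : completeNormedModType R) (T : bop E E) (u : E),
    `|T| < e -> op_exp T u = u -> T u = 0.
Proof.
pose c n : R := (n`!%:R)^-1.
have cb : coef_bound c 2 by exact: coef_bound_exp.
have [K K0 cK] := pser_lipschitz (coef_boundS cb) (ltr1n R 2).
(* [K] is a Lipschitz constant on the unit ball for the series [(e^T - 1) / T]; this radius keeps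
   its value within distance 1 of the identity. *)
have e0 : 0 < (K + 1)^-1 by rewrite invr_gt0 ltr_wpDl.
have e1 : (K + 1)^-1 <= 1 by rewrite invf_le1 ?ltr_wpDl// lerDr.
exists (K + 1)^-1 => // E T u Te eTu.
have T1 : `|T| <= 1 by rewrite (le_trans (ltW Te)).
have T2 : `|T| < 2 by rewrite (le_lt_trans T1) ?ltr1n.
pose phi := pser (c \o S) T.
have phi1 : `|1 - phi| < 1.
  have := cK E T 0 T1; rewrite normr0 ler01 => /(_ isT).
  have c1 : (c \o S) 0%N = 1 by rewrite /c /= invr1.
  rewrite (pser0 _ (coef_boundS cb)) c1 scale1r sub0r normrN.
  move=> /le_lt_trans; apply; rewrite (@le_lt_trans _ _ (`|T| * (K + 1)))//.
    by rewrite mulrC ler_wpM2l// lerDl.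
  by rewrite -ltr_pdivlMr ?ltr_wpDl// div1r.
have phiG : GL E phi := GL_near1 phi1.
have : phi (T u) = 0.
  move: eTu; rewrite op_expE (pserS cb T2) bopDE opME -/phi.
  rewrite {1}/c fact0 invr1 scale1r op1E => uE.
  by apply: (addrI u); rewrite uE addr0.
by move=> pTu; rewrite -(op_invK (T u) phiG) pTu bop_app0.
Qed.

Lemma op_exp_near1 : exists2 K : R, 0 <= K &
  forall (E : completeNormedModType R) (H : bop E E), `|H| <= 1 ->
    `|op_exp H - 1| <= K * `|H|.
Proof.
have [K K0 cK] := pser_lipschitz (coef_bound_exp (ltr0n R 2)) (ltr1n R 2).
exists K => // E H H1; have := cK E 0 H.
by rewrite normr0 -!op_expE op_exp0 subr0; apply.
Qed.

Lemma op_log_near1 : exists2 K : R, 0 <= K &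
  forall (E : completeNormedModType R) (A : bop E E), `|A - 1| <= 2^-1 ->
    `|op_log A| <= K * `|A - 1|.
Proof.
have h : (2^-1 : R) < 1 by rewrite invf_lt1 ?ltr1n.
have [K K0 cK] := pser_lipschitz (coef_bound_log (R := R)) h.
exists K => // E A A1; have := cK E 0 (A - 1).
rewrite normr0 subr0 (pser0 _ (coef_bound_log (R := R))) /log_coef invr0 mulr0.
by rewrite scale0r subr0; apply.
Qed.

End ExpRepresentation.

(** * Smooth maps between submanifolds *)

Section SmoothBetween.
Context {R : realType}.

Lemma open_setI_preimage (X Y : normedModType R) (A : set X) (B : set Y) (f : X -> Y) :
  open A -> open B -> (forall x, A x -> {for x, continuous f}) ->
  open (A `&` f @^-1` B).
Proof.
move=> oA oB fA; rewrite openE => x [Ax Bfx].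
have nA : nbhs x A by exact: open_nbhs_nbhs.
have nB : nbhs x (f @^-1` B) by apply: (fA x Ax); exact: open_nbhs_nbhs.
exact: filterI.
Qed.

Section Embedding.
Context {M : completeNormedModType R} {X : normedModType R}.
Variables (i : bop M X) (c : R).
Hypotheses (c0 : 0 < c) (ic : forall u, c * `|u| <= `|i u|).

Lemma embedding_norm u : `|u| <= c^-1 * `|i u|.
Proof. by rewrite ler_pdivlMl. Qed.

Lemma embedding_inj : injective i.
Proof.
move=> u v uv; apply/eqP; rewrite -subr_eq0 -normr_le0.
by rewrite (le_trans (embedding_norm _))// bop_appB uv subrr normr0 mulr0.
Qed.

(** The lower bound makes the preimages of a convergent sequence Cauchy, and the model space is
    complete. *)
Lemma closed_range_embedding : closed (range i).
Proof.
move=> y cy.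
have ex n : exists u, `|y - i u| < n.+1%:R^-1.
  have n0 : 0 < n.+1%:R^-1 :> R by rewrite invr_gt0.
  have [_ [[u _ <-]]] := cy _ (nbhsx_ballx y _ n0).
  by rewrite -ball_normE /=; exists u.
pose u n := projT1 (cid (ex n)).
have uP n : `|y - i (u n)| < n.+1%:R^-1 := projT2 (cid (ex n)).
have cu : cvgn u.
  apply: cauchy_cvg; apply/cauchy_exP => d d0.
  have cd0 : 0 < c * d / 2 by rewrite divr_gt0// mulr_gt0.
  have [N NN] : exists N : nat, N.+1%:R^-1 < c * d / 2.
    exists (Num.bound (c * d / 2)^-1).
    rewrite -[ltRHS]invrK ltf_pV2 ?posrE ?invr_gt0//.
    rewrite (lt_trans (archi_boundP _))// ?ltr_nat// invr_ge0 ltW//.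
  exists (u N); change (\forall n \near \oo, ball (u N) d (u n)).
  near=> n; rewrite -ball_normE /=.
  rewrite (le_lt_trans (embedding_norm _))// ltr_pdivrMl// bop_appB.
  have -> : i (u N) - i (u n) = (y - i (u n)) - (y - i (u N)) by lmod_ring.
  rewrite (le_lt_trans (ler_normB _ _))// (splitr (c * d)) ltrD//.
    rewrite (lt_trans (uP n))// (le_lt_trans _ NN)//.
    rewrite lef_pV2 ?posrE// ler_nat ltnS.
    by near: n; exists N.
  exact: lt_trans (uP N) NN.
exists (limn u) => //.
have h1 : (fun n => i (u n)) @ \oo --> i (limn u).
  by apply: continuous_cvg; [exact: bop_continuous|exact: cu].
have h2 : (fun n => i (u n)) @ \oo --> y.
  apply/cvgrPdist_lt => d d0; have /cvgrPdist_lt/(_ d d0) := @cvg_harmonic R.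
  apply: filterS => n; rewrite sub0r normrN ger0_norm ?invr_ge0// => /(lt_trans _).
  by apply; exact: uP.
exact: normed_cvg_unique h1 h2.
Unshelve. all: by end_near. Qed.

(** Difference quotients lie in the range, which is closed. *)
Lemma derivative_in_range (Y : normedModType R) (D : set Y) (h : Y -> X) (dh : bop Y X)
    x v : open D -> D x -> (forall y, D y -> range i (h y)) ->
  is_diff x h dh -> range i (dh v).
Proof.
move=> oD Dx hi /is_diff_bopP hx; apply: closed_range_embedding => B.
rewrite -nbhs_ballE => -[d /= d0 dB].
have v0 : 0 < `|v| + 1 by rewrite ltr_wpDl.
have e0 : 0 < d / (`|v| + 1) / 2 by rewrite !divr_gt0.
have Dnear : \forall k \near (0 : Y), D (x + k).
  have cx : {for (0 : Y), continuous (fun k => x + k)}.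
    by apply: cvgD; [exact: cvg_cst|exact: cvg_id].
  by apply: cx; rewrite addr0; exact: open_nbhs_nbhs.
have /nbhs_ballP[r /= r0 rB] : \forall k \near (0 : Y), D (x + k) /\
    `|h (x + k) - h x - dh k| <= d / (`|v| + 1) / 2 * `|k|.
  by near=> k; split; near: k; [exact: Dnear|exact: hx].
pose t := r / 2 / (`|v| + 1); have t0 : 0 < t by rewrite !divr_gt0.
have tv : `|t *: v| < r.
  rewrite normrZ gtr0_norm// /t mulrAC ltr_pdivrMr//.
  have := normr_ge0 v; nra.
have [Dt ht] : D (x + t *: v) /\
    `|h (x + t *: v) - h x - dh (t *: v)| <= d / (`|v| + 1) / 2 * `|t *: v|.
  by apply: rB; rewrite -ball_normE /= sub0r normrN.
exists (t^-1 *: (h (x + t *: v) - h x)); split.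
  have [a _ <-] := hi _ Dt; have [b _ <-] := hi _ Dx.
  by exists (t^-1 *: (a - b)); rewrite // bop_appZ bop_appB.
apply: dB; rewrite -ball_normE /= distrC.
have -> : t^-1 *: (h (x + t *: v) - h x) - dh v =
    t^-1 *: (h (x + t *: v) - h x - dh (t *: v)).
  by rewrite bop_appZ; lmod_ring; rewrite gt_eqF.
rewrite normrZ gtr0_norm ?invr_gt0// ltr_pdivrMl//.
apply: le_lt_trans ht _; rewrite normrZ gtr0_norm//.
have -> : d / (`|v| + 1) / 2 * (t * `|v|) = t * (d * (`|v| / 2 / (`|v| + 1))).
  by field; rewrite gt_eqF.
rewrite ltr_pM2l//.
rewrite gtr_pMr// ltr_pdivrMr// mul1r; have := normr_ge0 v; lra.
Unshelve. all: by end_near. Qed.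

Lemma bop_lift (Y : normedModType R) (f : bop Y X) :
  (forall v, range i (f v)) -> exists T : bop Y M, ocomp i T = f.
Proof.
move=> fi; have ex v : exists u, i u = f v by have [u _ <-] := fi v; exists u.
pose T v := projT1 (cid (ex v)).
have iT v : i (T v) = f v := projT2 (cid (ex v)).
have lT : linear T.
  by move=> k u v; apply: embedding_inj; rewrite iT !bop_app !iT.
have bT v : `|T v| <= c^-1 * `|f| * `|v|.
  rewrite (le_trans (embedding_norm _))// iT -mulrA ler_wpM2l ?invr_ge0 ?(ltW c0)//.
  exact: bop_ler.
by exists (Bop (bounded_opP lT bT)); apply: bop_eqP => v; exact: iT.
Qed.

End Embedding.

(** The range need not be complemented, so there may be no bounded left inverse of [i] to compose
    with. Derivatives are lifted one order at a time; composition with [i] is again an embedding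
    with the same constant, which drives the induction. *)
Lemma Cn_on_lift n (Y : normedModType R) (M : completeNormedModType R)
    (X : normedModType R) (i : bop M X) (c : R) (D : set Y) (h : Y -> X) (h' : Y -> M) :
  0 < c -> (forall u, c * `|u| <= `|i u|) -> open D ->
  (forall y, D y -> i (h' y) = h y) -> Cn_on n D h -> Cn_on n D h'.
Proof.
elim: n M X i h h' => [|n IH] M X i h h' c0 ic oD ih.
  move=> hD x Dx; apply/cvgrPdist_lt => d d0.
  have cd0 : 0 < c * d by rewrite mulr_gt0.
  have /cvgrPdist_lt/(_ _ cd0) := hD x Dx.
  apply: filterS2 (open_nbhs_nbhs (conj oD Dx)) => y Dy hxy.
  rewrite (le_lt_trans (embedding_norm c0 ic _))// ltr_pdivrMl// bop_appB.
  by rewrite !ih.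
move=> [dh [hD dhD]].
pose dh' y := get [set T | ocomp i T = dh y].
have dh'P y : D y -> ocomp i (dh' y) = dh y.
  move=> Dy; have hr v : range i (dh y v).
    apply: (@derivative_in_range _ _ _ _ c0 ic Y D h (dh y) y v oD Dy _ (hD y Dy)) => z Dz.
    by rewrite -ih//; exists (h' z).
  have [T iT] := bop_lift c0 ic hr.
  exact: (@getPex _ [set T | ocomp i T = dh y] (ex_intro _ T iT)).
exists dh'; split; last first.
  apply: (IH _ _ (comp_op Y M X i) dh) => // [T|y Dy]; last by rewrite comp_opE dh'P.
  rewrite comp_opE -ler_pdivlMl//; apply: bop_lub => [|v].
    by rewrite mulr_ge0// invr_ge0 ltW.
  rewrite (le_trans (embedding_norm c0 ic _))// -mulrA ler_wpM2l ?invr_ge0 ?(ltW c0)//.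
  exact: (bop_ler (ocomp i T) v).
move=> x Dx; apply/is_diff_bopP => d d0.
have cd0 : 0 < c * d by rewrite mulr_gt0.
have /is_diff_bopP/(_ _ cd0) := hD x Dx.
have Dnear : \forall k \near (0 : Y), D (x + k).
  have cx : {for (0 : Y), continuous (fun k => x + k)}.
    by apply: cvgD; [exact: cvg_cst|exact: cvg_id].
  by apply: cx; rewrite addr0; exact: open_nbhs_nbhs.
apply: filterS2 Dnear => k Dxk hk.
rewrite (le_trans (embedding_norm c0 ic _))// ler_pdivrMl// mulrA !bop_appB.
by rewrite !ih// -[i (dh' x k)]/(ocomp i (dh' x) k) dh'P.
Qed.

Lemma smooth_between_of_smooth (X Y : normedModType R) (M : set X) (N : set Y)
    (O : set X) (f : X -> Y) :
  open O -> M `<=` O -> smooth_on O f -> (forall x, M x -> N (f x)) ->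
  smooth_between M N f.
Proof.
move=> oO MO fO fMN c d n.
set D := [set u | _].
pose p u := chart_inv c (chart_incl c u).
pose A := chart_incl c @^-1` chart_cod c.
have oA : open A.
  have := @open_setI_preimage _ _ setT (chart_cod c) (chart_incl c) openT
    (open_chart_cod c) (fun x _ => bop_continuous (x := x)).
  by rewrite setTI.
have pA m : Cn_on m A p.
  apply: (@Cn_on_comp _ _ _ _ _ _ (chart_cod c) (chart_incl c)) => //.
    exact: Cn_on_bop.
  exact: smooth_chart_inv.
have pM u : A u -> M (p u).
  move=> Au; have [du mu] := chart_invP Au.
  by apply/(chart_flat du); rewrite mu; exists u.
have fpA m : Cn_on m A (fun u => f (p u)).
  by apply: Cn_on_comp (pA m) (fO m) => u /pM/MO.
have DE : D = A `&` (fun u => f (p u)) @^-1` chart_dom d by [].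
have oD : open D.
  rewrite DE; apply: open_setI_preimage => //; first exact: open_chart_dom.
  by move=> x Ax; exact: (Cn_on_continuous (fpA 0%N)).
have [k k0 ik] := chart_incl_embedding d.
apply: (@Cn_on_lift n _ _ _ (chart_incl d) k D (fun u => chart_map d (f (p u)))) => //.
  move=> u; rewrite DE => -[Au du].
  have /(chart_flat du)[w _ wE] := fMN _ (pM u Au).
  by rewrite /local_coord -[local_param u]/(p u) -wE chart_inclK.
apply: (@Cn_on_comp _ _ _ _ _ _ (chart_dom d) (fun u => f (p u))).
- by move=> u; rewrite DE => -[].
- by apply: Cn_on_subset (fpA n) => u; rewrite DE => -[].
- exact: smooth_chart_map.
Qed.

End SmoothBetween.

(** * Jordan identities *)

Section JordanIdentities.
Context {R : realType} {V : jbAlgebraType R}.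
Implicit Types a b c u v w x y z : V.

Local Notation "x ** y" := (jmul x y) (at level 40, left associativity).
Local Notation L := (@Lop R V).
Local Notation U := (@Uop R V).
Local Notation e := (@jone R V).

Lemma jmulDr x y z : x ** (y + z) = x ** y + x ** z.
Proof. exact: (bop_appD (L x)). Qed.

Lemma jmulZr k x y : x ** (k *: y) = k *: (x ** y).
Proof. exact: (bop_appZ (L x)). Qed.

Lemma jmulNr x y : x ** - y = - (x ** y).
Proof. exact: (bop_appN (L x)). Qed.

Lemma jmul0r x : x ** 0 = 0.
Proof. exact: (bop_app0 (L x)). Qed.

Lemma jmulDl x y z : (y + z) ** x = y ** x + z ** x.
Proof. by rewrite jmulC jmulDr !(jmulC x). Qed.

Lemma jmulZl k x y : (k *: y) ** x = k *: (y ** x).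
Proof. by rewrite jmulC jmulZr (jmulC x). Qed.

Lemma jmulNl x y : (- y) ** x = - (y ** x).
Proof. by rewrite jmulC jmulNr (jmulC x). Qed.

Lemma jmul0l x : 0 ** x = 0.
Proof. by rewrite jmulC jmul0r. Qed.

Lemma jmul1r x : x ** e = x.
Proof. by rewrite jmulC jmul1l. Qed.

Definition jmulE := (jmulDl, jmulDr, jmulNl, jmulNr, jmulZl, jmulZr).

Lemma LopE x y : L x y = x ** y. Proof. by []. Qed.

Lemma LopD x y : L (x + y) = L x + L y.
Proof. by apply: bop_eqP => z; rewrite bopDE !LopE jmulDl. Qed.

Lemma LopN x : L (- x) = - L x.
Proof. by apply: bop_eqP => z; rewrite bopNE !LopE jmulNl. Qed.

Lemma LopZ k x : L (k *: x) = k *: L x.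
Proof. by apply: bop_eqP => z; rewrite bopZE !LopE jmulZl. Qed.

Lemma Lop_norm x : `|L x| <= `|x|.
Proof. by apply: bop_lub => // y; rewrite LopE jnormM. Qed.

Fact Lop_op_subproof : L \in bounded_op.
Proof.
apply: (@bounded_opP _ _ _ _ 1) => [k x y|x]; first by rewrite LopD LopZ.
by rewrite mul1r Lop_norm.
Qed.

Definition Lop_op : bop V (bop V V) := Bop Lop_op_subproof.

Lemma Lop1 : L e = 1.
Proof. by apply: bop_eqP => z; rewrite LopE jmul1l. Qed.

Lemma jordan_LopC x : L (x ** x) * L x = L x * L (x ** x).
Proof. by apply: bop_eqP => y; rewrite !opME !LopE jordan_identity. Qed.

Let K u v : bop V V := L u * L v - L v * L u.

Let KD u v w : K (u + v) w = K u w + K v w.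
Proof. by rewrite /K !LopD mulrDl mulrDr; lmod_ring. Qed.

Let KDr u v w : K w (u + v) = K w u + K w v.
Proof. by rewrite /K !LopD mulrDl mulrDr; lmod_ring. Qed.

Let Ksq x : K (x ** x) x = 0.
Proof. by rewrite /K jordan_LopC subrr. Qed.

(** Full polarisation of the cubic identity [[L (x^2), L x] = 0], by inclusion-exclusion over
    [a + b + c] and the pairwise sums. *)
Lemma jordan_linearized a b c :
  (L (a ** b) * L c - L c * L (a ** b)) + (L (b ** c) * L a - L a * L (b ** c)) +
  (L (c ** a) * L b - L b * L (c ** a)) = 0.
Proof.
rewrite -/(K (a ** b) c) -/(K (b ** c) a) -/(K (c ** a) b).
have := Ksq (a + b + c); have := Ksq (a + b); have := Ksq (b + c).
have := Ksq (a + c); rewrite !jmulE !KD !KDr !Ksq.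
rewrite (jmulC b a) (jmulC c b) (jmulC a c).
move=> e1 e2 e3 e4.
apply: (eq_lincomb (k1 := 2^-1) (k2 := - 2^-1) (k3 := - 2^-1) (k4 := - 2^-1)
  e4 e3 e2 e1).
by lmod_ring.
Qed.

(** The linearized identity for [u], [v], [c], evaluated at [w] and read as an operator identity in
    [c]. *)
Lemma jordan_LopM u v w : L ((u ** v) ** w) = L (u ** v) * L w +
  L (u ** w) * L v + L (v ** w) * L u - L u * L w * L v - L v * L w * L u.
Proof.
apply: bop_eqP => c; rewrite !(bopDE, bopNE, opME) !LopE.
have /(congr1 (fun f : bop V V => f w)) := jordan_linearized u v c.
rewrite !(bopDE, bopNE, opME, bop0E) !LopE.
rewrite (jmulC c u) (jmulC c w) (jmulC (v ** c) (u ** w)).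
rewrite (jmulC (u ** c) (v ** w)) (jmulC c ((u ** v) ** w)).
rewrite (jmulC (v ** c) w) (jmulC (u ** c) w) => h.
by apply: (eq_lincomb (k1 := -1) (k2 := 0) (k3 := 0) (k4 := 0) h h h h); lmod_ring.
Qed.

(** The commutator [[L y, L a]] is a derivation of the algebra; the argument of [L] on the left is
    its value at [b]. *)
Lemma jordan_derivation a b y : L (y ** (a ** b) - a ** (y ** b)) =
  (L y * L a - L a * L y) * L b - L b * (L y * L a - L a * L y).
Proof.
rewrite LopD LopN (jmulC y (a ** b)) jordan_LopM (jmulC a (y ** b)) (jmulC y b).
rewrite jordan_LopM (jmulC b y) (jmulC b a) (jmulC y a) !mulrBl !mulrBr !mulrA.
by lmod_ring.
Qed.

(** The Jordan triple product, whose diagonal [triple x y x] is [U x y]. *)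
Definition triple x y z := (x ** y) ** z + x ** (y ** z) - y ** (x ** z).

Lemma tripleC x y z : triple x y z = triple z y x.
Proof.
rewrite /triple (jmulC (x ** y) z) (jmulC x (y ** z)) (jmulC x z) (jmulC x y).
by rewrite (jmulC z y); lmod_ring.
Qed.

Definition tripleL x y : bop V V := L (x ** y) + (L x * L y - L y * L x).

Lemma tripleLE x y z : tripleL x y z = triple x y z.
Proof. by rewrite /tripleL !(bopDE, bopNE, opME) !LopE /triple; lmod_ring. Qed.

Lemma UopE x y : U x y = 2 *: (x ** (x ** y)) - (x ** x) ** y.
Proof. by []. Qed.

Lemma Uop_triple x y : U x y = triple x y x.
Proof.
rewrite UopE /triple (jmulC _ x) (jmulC y x) (jmulC y (x ** x)).
by lmod_ring.
Qed.

Lemma Uop2E x y z : Uop2 x y z = triple x z y.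
Proof.
rewrite /Uop2 /Uop !(bopDE, bopNE, bopZE, opME) !LopE /triple !jmulE.
rewrite (jmulC y x) (jmulC z y) (jmulC (x ** z) y) (jmulC z (x ** y)).
by lmod_ring.
Qed.

(** [tripleL x y] is [L (x y)] plus the derivation [d = [L x, L y]]. The derivation acts by Leibniz,
    the multiplication through the linearized identity, and the sign change of [d] in [triple y x v]
    lets both parts combine. *)
Lemma triple_comm x y u v :
  tripleL x y * tripleL u v - tripleL u v * tripleL x y =
  tripleL (triple x y u) v - tripleL u (triple y x v).
Proof.
have Lpart a : L a * tripleL u v - tripleL u v * L a =
    tripleL (a ** u) v - tripleL u (a ** v).
  rewrite /tripleL !(mulrDr, mulrDl, mulrN, mulNr) !mulrA.
  have h1 := jordan_linearized a u v.
  have := jordan_derivation v a u; rewrite LopD LopN.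
  rewrite (jmulC v (u ** a)) (jmulC u a) (jmulC v a) !mulrBl !mulrBr !mulrA => h2.
  move: h1; rewrite (jmulC v a) => h1.
  by apply: (eq_lincomb (k1 := -1) (k2 := 1) (k3 := 0) (k4 := 0) h1 h2 h1 h1);
    lmod_ring.
have dpart (d : bop V V) : (forall w, d * L w - L w * d = L (d w)) ->
    (forall a b, d (a ** b) = d a ** b + a ** d b) ->
    d * tripleL u v - tripleL u v * d = tripleL (d u) v + tripleL u (d v).
  move=> dL dM.
  have := dL (u ** v); rewrite dM LopD => h1.
  have h2 := dL u; have h3 := dL v.
  rewrite /tripleL -h2 -h3.
  rewrite !(mulrDr, mulrDl, mulrN, mulNr) !mulrA.
  by apply: (eq_lincomb (k1 := 1) (k2 := 0) (k3 := 0) (k4 := 0) h1 h1 h1 h1);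
    lmod_ring.
pose d : bop V V := L x * L y - L y * L x.
have dL w : d * L w - L w * d = L (d w).
  by rewrite /d -jordan_derivation.
have dM a b : d (a ** b) = d a ** b + a ** d b.
  have := congr1 (fun f : bop V V => f b) (dL a).
  rewrite !(bopDE, bopNE, opME) !LopE => h.
  by apply: (eq_lincomb (k1 := 1) (k2 := 0) (k3 := 0) (k4 := 0) h h h h); lmod_ring.
have DE a b : tripleL a b = L (a ** b) + (L a * L b - L b * L a) by [].
have tE : triple x y u = (x ** y) ** u + d u by rewrite -tripleLE DE bopDE.
have tE' : triple y x v = (x ** y) ** v - d v.
  by rewrite -tripleLE DE bopDE (jmulC y x) -opprB -/d bopNE.
have tLD a b w : tripleL (a + b) w = tripleL a w + tripleL b w.
  by rewrite !DE !jmulE !LopD mulrDl mulrDr; lmod_ring.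
have tRD a b w : tripleL w (a - b) = tripleL w a - tripleL w b.
  by rewrite !DE !jmulE !LopD !LopN mulrBl mulrBr; lmod_ring.
rewrite tE tE' tLD tRD [tripleL x y]DE -/d.
have := Lpart (x ** y); have := dpart d dL dM.
move: (tripleL u v) => T h2 h1; rewrite mulrDl mulrDr.
by apply: (eq_lincomb (k1 := 1) (k2 := 1) (k3 := 0) (k4 := 0) h1 h2 h1 h1);
  lmod_ring.
Qed.

Lemma triple_main x y u v z : triple x y (triple u v z) =
  triple (triple x y u) v z - triple u (triple y x v) z + triple u v (triple x y z).
Proof.
have := congr1 (fun f : bop V V => f z) (triple_comm x y u v).
rewrite -[LHS]/(tripleL x y (tripleL u v z) - tripleL u v (tripleL x y z)).
rewrite -[RHS]/(tripleL (triple x y u) v z - tripleL u (triple y x v) z).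
rewrite !tripleLE => h.
by apply: (eq_lincomb (k1 := 1) (k2 := 0) (k3 := 0) (k4 := 0) h h h h); lmod_ring.
Qed.

(** Two instances of [triple_main] are combined to eliminate [triple x v (triple x y x)]; this gives
    the weights 1/3 and 2/3. *)
Lemma triple_JP1 x y v : triple x y (triple x v x) = triple x (triple y x v) x.
Proof.
have A := triple_main x y x v x; have B := triple_main x v x y x.
move: A B; rewrite (tripleC (triple x y x)) (tripleC (triple x v x)).
rewrite (tripleC v x y) => A B.
by apply: (eq_lincomb (k1 := - 3^-1) (k2 := - (2 / 3)) (k3 := 0) (k4 := 0) A B A A);
  lmod_ring.
Qed.

Lemma triple_JP2 x y z : triple (triple x y x) y z = triple x (triple y x y) z.
Proof.
have A := triple_main x y x y z.
by apply: (eq_lincomb (k1 := -1) (k2 := 0) (k3 := 0) (k4 := 0) A A A A); lmod_ring.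
Qed.

(** With [a = triple x y x], the preceding identities turn [triple a z a] into [U x] of a single
    expression, which [h6] recognises as [U y (U x z)]. *)
Lemma triple_fundamental x y z :
  triple (triple x y x) z (triple x y x) = triple x (triple y (triple x z x) y) x.
Proof.
set a := triple x y x.
have h1 := triple_main a z x y x.
have h2 : triple a z x = triple x (triple z x y) x.
  by rewrite tripleC triple_JP1.
have h3 : triple x y (triple a z x) = triple x (triple y x (triple y x z)) x.
  by rewrite h2 triple_JP1 (tripleC z x y).
have h4 : triple z a y = triple (triple y x y) x z.
  by rewrite tripleC -triple_JP2.
have h5 := triple_main z x y x y.
have tD p q : triple x (p - q) x = triple x p x - triple x q x.
  by rewrite -!Uop_triple bop_appB.
have tZ p : triple x (2 *: p) x = 2 *: triple x p x.
  by rewrite -!Uop_triple bop_appZ.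
have h6 : triple y (triple x z x) y = 2 *: triple y x (triple y x z) -
    triple (triple y x y) x z.
  move: h5; rewrite (tripleC z x (triple y x y)) (tripleC (triple z x y) x y).
  rewrite (tripleC z x y) => h5.
  by apply: (eq_lincomb (k1 := 1) (k2 := 0) (k3 := 0) (k4 := 0) h5 h5 h5 h5);
    lmod_ring.
rewrite h6 tD tZ -h3 -h4.
move: h1; rewrite -/a (tripleC (triple a z x) y x) => h1.
by apply: (eq_lincomb (k1 := 1) (k2 := 0) (k3 := 0) (k4 := 0) h1 h1 h1 h1);
  lmod_ring.
Qed.

Lemma Uop_fundamental x y : U (U x y) = U x * U y * U x.
Proof.
apply: bop_eqP => z; rewrite !opME !Uop_triple; exact: triple_fundamental.
Qed.

Lemma Uop1 : U e = 1.
Proof.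
by apply: bop_eqP => y; rewrite UopE !jmul1l op1E; lmod_ring.
Qed.

Lemma Uop_one x : U x e = x ** x.
Proof. by rewrite UopE !jmul1r; lmod_ring. Qed.

Lemma Uop_sqr x : U (x ** x) = U x * U x.
Proof. by rewrite -Uop_one Uop_fundamental Uop1 mulr1. Qed.

Fixpoint jpow x (n : nat) : V := if n is m.+1 then x ** jpow x m else e.

Lemma jpow1 x : jpow x 1 = x. Proof. by rewrite /= jmul1r. Qed.

(** By [jordan_LopM], [L (x^(n+2))] is a polynomial in [L x], [L (x^2)], [L (x^n)] and
    [L (x^(n+1))]; hence the two-step induction. *)
Lemma jpow_comm_op x (T : bop V V) n : T * L x = L x * T ->
  T * L (x ** x) = L (x ** x) * T -> T * L (jpow x n) = L (jpow x n) * T.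
Proof.
move=> T1 T2; suff [] : T * L (jpow x n) = L (jpow x n) * T /\
  T * L (jpow x n.+1) = L (jpow x n.+1) * T by [].
elim: n => [|n [IH1 IH2]]; first by rewrite jpow1 /= Lop1 mulr1 mul1r.
split=> //; rewrite [jpow x n.+2]/= (jmulC x (x ** _)).
have C u v : T * L u = L u * T -> T * L v = L v * T ->
    T * (L u * L v) = (L u * L v) * T.
  by move=> Tu Tv; rewrite mulrA Tu -mulrA Tv mulrA.
have C3 u v w : T * L u = L u * T -> T * L v = L v * T -> T * L w = L w * T ->
    T * (L u * L v * L w) = (L u * L v * L w) * T.
  by move=> Tu Tv Tw; rewrite mulrA C// -mulrA Tw mulrA.
rewrite jordan_LopM (jmulC (jpow x n) x) !mulrBr !mulrDr !mulrBl !mulrDl.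
by rewrite !C ?C3.
Qed.

Lemma jpow_comm x m n : L (jpow x m) * L (jpow x n) = L (jpow x n) * L (jpow x m).
Proof.
have h1 k : L x * L (jpow x k) = L (jpow x k) * L x.
  by apply: jpow_comm_op => //; rewrite jordan_LopC.
apply: jpow_comm_op; first by rewrite h1.
by apply/esym/jpow_comm_op => //; rewrite jordan_LopC.
Qed.

Lemma jpowD x m n : jpow x (m + n) = jpow x m ** jpow x n.
Proof.
elim: m => [|m IH]; first by rewrite jmul1l.
have := congr1 (fun f : bop V V => f (jpow x n)) (jpow_comm x 1 m).
rewrite jpow1 !opME !LopE -IH => xm; rewrite addSn -[LHS]/(x ** jpow x (m + n)) xm.
have := congr1 (fun f : bop V V => f x) (jpow_comm x m n).
rewrite !opME !LopE (jmulC _ x) => ->.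
by rewrite [RHS]jmulC (jmulC _ x).
Qed.

End JordanIdentities.

(** * The associative subalgebra generated by an element *)

Section JordanSubalgebra.
Context {R : realType} {V : jbAlgebraType R}.
Implicit Types (a b u v w x y z : V) (A P : set V).

Local Notation "x ** y" := (jmul x y) (at level 40, left associativity).
Local Notation L := (@Lop R V).
Local Notation U := (@Uop R V).
Local Notation e := (@jone R V).

Inductive power_span a : V -> Prop :=
| span0 : power_span a 0
| span_pow n : power_span a (jpow a n)
| spanD x y : power_span a x -> power_span a y -> power_span a (x + y)
| spanZ k x : power_span a x -> power_span a (k *: x).

Definition power_algebra a : set V := closure (power_span a).

Lemma closure_min (T : topologicalType) (A B : set T) :
  closed B -> A `<=` B -> closure A `<=` B.
Proof. by move=> /closure_id {2}->; exact: closureS. Qed.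

Lemma power_algebra_ind a P : closed P -> P 0 ->
  (forall x y, P x -> P y -> P (x + y)) -> (forall k x, P x -> P (k *: x)) ->
  (forall n, P (jpow a n)) -> power_algebra a `<=` P.
Proof.
move=> cP P0 PD PZ Pn; apply: closure_min => // x.
by elim=> // [? ? _ ? _ ?|? ? _ ?]; [exact: PD|exact: PZ].
Qed.

Lemma closed_preimage_bop (f : bop V V) P : closed P -> closed (f @^-1` P).
Proof. by move=> cP; apply: preimage_closed => // x _; exact: bop_continuous. Qed.

Lemma closed_eq_bop (f g : bop V V) : closed [set x | f x = g x].
Proof.
have -> : [set x | f x = g x] = (f - g) @^-1` [set 0].
  apply/seteqP; split=> x fgx.
    by change ((f - g) x = 0); rewrite bopBE fgx subrr.
  change (f x = g x); apply/eqP; rewrite -subr_eq0; apply/eqP.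
  exact: fgx.
apply: closed_preimage_bop; apply: accessible_closed_set1.
exact: hausdorff_accessible (@norm_hausdorff _ V).
Qed.

Lemma closed_power_algebra a : closed (power_algebra a).
Proof. exact: closed_closure. Qed.

Lemma power_algebra_pow a n : power_algebra a (jpow a n).
Proof. by apply: subset_closure; exact: span_pow. Qed.

Lemma power_algebra_id a : power_algebra a a.
Proof. by rewrite -{2}(jpow1 a); exact: power_algebra_pow. Qed.

Lemma power_algebra1 a : power_algebra a e.
Proof. exact: (@power_algebra_pow a 0%N). Qed.

Lemma power_algebra0 a : power_algebra a 0.
Proof. by apply: subset_closure; exact: span0. Qed.

Lemma closed_preimage_continuous (f : V -> V) P :
  continuous f -> closed P -> closed (f @^-1` P).
Proof. by move=> cf cP; apply: preimage_closed => // x _; exact: cf. Qed.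

Lemma power_algebraZ a k x : power_algebra a x -> power_algebra a (k *: x).
Proof.
suff H : power_algebra a `<=` ( *:%R k) @^-1` power_algebra a by exact: H.
apply: closure_min => [|y ay].
  apply: closed_preimage_continuous => [z|]; last exact: closed_power_algebra.
  by apply: cvgZl_tmp; exact: cvg_id.
by apply: subset_closure; exact: spanZ.
Qed.

Lemma power_algebraD a x y : power_algebra a x -> power_algebra a y ->
  power_algebra a (x + y).
Proof.
have cf z : continuous (fun t : V => t + z).
  by move=> t; apply: cvgD; [exact: cvg_id|exact: cvg_cst].
have H1 z : power_span a z ->
    power_algebra a `<=` (fun t => t + z) @^-1` power_algebra a.
  move=> az; apply: closure_min => [|t at_].
    by apply: closed_preimage_continuous => //; exact: closed_power_algebra.
  by apply: subset_closure; exact: spanD.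
move=> ax; suff H2 : power_algebra a `<=` (fun t => t + x) @^-1` power_algebra a.
  by move=> /H2 /=; rewrite addrC.
apply: closure_min => [|z az].
  by apply: closed_preimage_continuous => //; exact: closed_power_algebra.
by rewrite /= addrC; exact: (H1 z az x ax).
Qed.

Lemma power_algebraB a x y : power_algebra a x -> power_algebra a y ->
  power_algebra a (x - y).
Proof.
by move=> ax ay; apply: power_algebraD => //; rewrite -scaleN1r; exact: power_algebraZ.
Qed.

Lemma power_algebraM a x y : power_algebra a x -> power_algebra a y ->
  power_algebra a (x ** y).
Proof.
move=> ax; move: y.
apply: (@power_algebra_ind a (L x @^-1` power_algebra a)).
- by apply: closed_preimage_bop; exact: closed_power_algebra.
- by rewrite /= jmul0r; exact: power_algebra0.
- by move=> u v /= au av; rewrite jmulDr; exact: power_algebraD.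
- by move=> k u /= au; rewrite jmulZr; exact: power_algebraZ.
move=> n /=; rewrite jmulC; move: x ax.
apply: (@power_algebra_ind a (L (jpow a n) @^-1` power_algebra a)).
- by apply: closed_preimage_bop; exact: closed_power_algebra.
- by rewrite /= jmul0r; exact: power_algebra0.
- by move=> u v /= au av; rewrite jmulDr; exact: power_algebraD.
- by move=> k u /= au; rewrite jmulZr; exact: power_algebraZ.
by move=> m /=; rewrite -jpowD; exact: power_algebra_pow.
Qed.

(** Each factor in turn is reduced, by linearity and continuity, to a power of [a], where [jpowD]
    decides. *)
Lemma power_algebraA a x y z : power_algebra a x -> power_algebra a y ->
  power_algebra a z -> x ** (y ** z) = (x ** y) ** z.
Proof.
move=> ax ay; move: z; apply: (@power_algebra_ind a
    [set z | (L x * L y : bop V V) z = L (x ** y) z]).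
- exact: closed_eq_bop.
- by rewrite /= !jmul0r.
- by move=> u v /= au av; rewrite !jmulDr au av.
- by move=> k u /= au; rewrite !jmulZr au.
move=> n /=; rewrite (jmulC (x ** y)) (jmulC y); move: y ay.
apply: (@power_algebra_ind a
    [set y | (L x * L (jpow a n) : bop V V) y = (L (jpow a n) * L x : bop V V) y]).
- exact: closed_eq_bop.
- by rewrite /= !jmul0r.
- by move=> u v /= au av; rewrite !jmulDr au av.
- by move=> k u /= au; rewrite !jmulZr au.
move=> m /=; rewrite -jpowD jmulC (jmulC x (jpow a m)); move: x ax.
apply: (@power_algebra_ind a [set x | L (jpow a (n + m)) x =
    (L (jpow a n) * L (jpow a m) : bop V V) x]).
- exact: closed_eq_bop.
- by rewrite /= !jmul0r.
- by move=> u v /= au av; rewrite !jmulDr au av.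
- by move=> k u /= au; rewrite !jmulZr au.
by move=> k /=; rewrite -!jpowD addnA.
Qed.

Lemma power_algebraCA a x y z : power_algebra a x -> power_algebra a y ->
  power_algebra a z -> x ** (y ** z) = y ** (x ** z).
Proof. by move=> ax ay az; rewrite !(@power_algebraA a)// (jmulC x). Qed.

(* [s] is the sum of the coefficients. *)
Inductive pos_comb w : R -> V -> Prop :=
| pos_comb_pow n : pos_comb w 1 (jpow w n)
| pos_comb0 : pos_comb w 0 0
| pos_combD s t x y : pos_comb w s x -> pos_comb w t y ->
    pos_comb w (s + t) (x + y)
| pos_combZ k s x : 0 <= k -> pos_comb w s x -> pos_comb w (k * s) (k *: x).

Lemma pos_combM w s t x y : pos_comb w s x -> pos_comb w t y ->
  pos_comb w (s * t) (x ** y).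
Proof.
move=> ws wt; elim: ws => {s x} [n||s s' x x' _ IH _ IH'|k s x k0 _ IH].
- rewrite mul1r; elim: wt => {t y} [m||t t' y y' _ IH _ IH'|k t y k0 _ IH].
  + by rewrite -jpowD; exact: pos_comb_pow.
  + by rewrite jmul0r; exact: pos_comb0.
  + by rewrite jmulDr; exact: pos_combD.
  + by rewrite jmulZr; exact: pos_combZ.
- by rewrite mul0r jmul0l; exact: pos_comb0.
- by rewrite mulrDl jmulDl; exact: pos_combD.
- by rewrite -mulrA jmulZl; exact: pos_combZ.
Qed.

Lemma jone_norm : `|e| <= 1.
Proof.
have := jnorm_sqr e; rewrite jmul1l => /eqP.
rewrite expr2 -[X in X == _]mulr1 -subr_eq0 -mulrBr mulf_eq0 subr_eq0.
by case/orP => [/eqP ->|/eqP <-]; rewrite ?ler01.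
Qed.

Lemma jpow_norm w n : `|jpow w n| <= `|w| ^+ n * `|e|.
Proof.
elim: n => [|n IH] /=; first by rewrite expr0 mul1r.
by rewrite (le_trans (jnormM _ _))// exprS -mulrA ler_wpM2l.
Qed.

Lemma pos_comb_norm w s x : `|w| <= 1 -> pos_comb w s x -> `|x| <= s.
Proof.
move=> w1; elim=> {s x} [n||s t x y _ IHx _ IHy|k s x k0 _ IH].
- by rewrite (le_trans (jpow_norm _ _))// mulr_ile1// ?jone_norm// ?exprn_ge0// exprn_ile1.
- by rewrite normr0.
- by rewrite (le_trans (ler_normD _ _))// lerD.
- by rewrite normrZ ger0_norm// ler_wpM2l.
Qed.

Lemma pos_comb_id w : pos_comb w 1 w.
Proof. by rewrite -{2}(jpow1 w); exact: pos_comb_pow. Qed.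

(** A fixed point satisfies [2 y = w + y^2], that is [(e - y)^2 = e - w]. *)
Fixpoint sqrt_iter w n : V :=
  if n is m.+1 then 2^-1 *: (w + sqrt_iter w m ** sqrt_iter w m) else 0.

(** The same iteration at the scalar 1, hence the sum of the coefficients of [sqrt_iter]. *)
Fixpoint sqrt_bound n : R :=
  if n is m.+1 then 2^-1 * (1 + sqrt_bound m * sqrt_bound m) else 0.

Lemma sqrt_iterS w n :
  sqrt_iter w n.+1 = 2^-1 *: (w + sqrt_iter w n ** sqrt_iter w n).
Proof. by []. Qed.

Lemma sqrt_boundS n : sqrt_bound n.+1 = 2^-1 * (1 + sqrt_bound n * sqrt_bound n).
Proof. by []. Qed.

Lemma sqrt_iter_comb w n : pos_comb w (sqrt_bound n) (sqrt_iter w n).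
Proof.
elim: n => [|n IH] /=; first exact: pos_comb0.
apply: pos_combZ; first by rewrite invr_ge0.
by apply: pos_combD; [exact: pos_comb_id|exact: pos_combM].
Qed.

(** A difference of positive combinations need not be positive; here each increment is half the
    product of the previous increment with a sum of iterates. *)
Lemma sqrt_iter_diff_comb w n :
  pos_comb w (sqrt_bound n.+1 - sqrt_bound n) (sqrt_iter w n.+1 - sqrt_iter w n).
Proof.
elim: n => [|n IH].
  rewrite /= !jmul0r !addr0 !subr0 mulr0 addr0.
  by apply: pos_combZ; [rewrite invr_ge0|exact: pos_comb_id].
have -> : sqrt_bound n.+2 - sqrt_bound n.+1 = 2^-1 *
    ((sqrt_bound n.+1 - sqrt_bound n) * (sqrt_bound n.+1 + sqrt_bound n)).
  rewrite (sqrt_boundS n.+1); have := sqrt_boundS n.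
  move: (sqrt_bound n.+1) (sqrt_bound n) => t s tE.
  by rewrite {3}tE; ring.
have -> : sqrt_iter w n.+2 - sqrt_iter w n.+1 = 2^-1 *:
    ((sqrt_iter w n.+1 - sqrt_iter w n) ** (sqrt_iter w n.+1 + sqrt_iter w n)).
  rewrite (sqrt_iterS w n.+1); have := sqrt_iterS w n.
  move: (sqrt_iter w n.+1) (sqrt_iter w n) => t s tE.
  by rewrite {3}tE !jmulE (jmulC s t); lmod_ring.
apply: pos_combZ; first by rewrite invr_ge0.
apply: pos_combM => //; apply: pos_combD; exact: sqrt_iter_comb.
Qed.

Lemma sqrt_bound_le n : 0 <= sqrt_bound n <= 1.
Proof.
elim: n => [|n /andP[h0 h1]]; first by rewrite lexx ler01.
rewrite [sqrt_bound _]/=; move: (sqrt_bound n) h0 h1 => s h0 h1.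
by apply/andP; split; nra.
Qed.

Lemma sqrt_iter_is_cvg w : `|w| <= 1 -> cvgn (sqrt_iter w).
Proof.
move=> w1; pose u n := sqrt_iter w n.+1 - sqrt_iter w n.
pose v n := sqrt_bound n.+1 - sqrt_bound n.
have uE : series u = sqrt_iter w.
  by apply/funext => n; rewrite /series /= /u telescope_sumr// subr0.
have vE : series v = sqrt_bound.
  by apply/funext => n; rewrite /series /= /v telescope_sumr// subr0.
have uv n : `|u n| <= v n.
  exact: pos_comb_norm w1 (sqrt_iter_diff_comb w n).
have v0 n : 0 <= v n := le_trans (normr_ge0 _) (uv n).
rewrite -uE; apply: normed_cvg; apply: (@series_le_cvg _ _ v) => //=.
rewrite vE; apply: nondecreasing_is_cvgn.
  by apply/nondecreasing_seqP => n; rewrite -subr_ge0; exact: v0.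
by exists 1 => _ [n _ <-]; have /andP[] := sqrt_bound_le n.
Qed.

End JordanSubalgebra.

(** * The cone of squares *)

Section PositiveCone.
Context {R : realType} {V : jbAlgebraType R}.
Implicit Types (a b u v w x y z : V).

Local Notation "x ** y" := (jmul x y) (at level 40, left associativity).
Local Notation L := (@Lop R V).
Local Notation U := (@Uop R V).
Local Notation e := (@jone R V).

Definition jsquare : set V := [set x | exists y, y ** y = x].

Lemma jsq_is_diff x : exists D : bop V V, is_diff x (fun y : V => y ** y) D.
Proof.
have xd := is_diff_bop (1 : bop V V) x.
by eexists; exact: (is_diff_bilin (@Lop_op R V) xd xd).
Qed.

Lemma jsq_continuous : continuous (fun x : V => x ** x).
Proof. by move=> x; have [D] := jsq_is_diff x; exact: is_diff_bop_continuous. Qed.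

Lemma sqrt_fixpoint a w : power_algebra a w -> `|w| <= 1 ->
  exists2 y, power_algebra a y & `|y| <= 1 /\ (e - y) ** (e - y) = e - w.
Proof.
move=> aw w1; have yw := sqrt_iter_is_cvg w1; set y := limn (sqrt_iter w) in yw.
have ay n : power_algebra a (sqrt_iter w n).
  elim: n => [|n IH] /=; first exact: power_algebra0.
  by apply/power_algebraZ/power_algebraD => //; exact: power_algebraM.
exists y.
  apply: (@closed_cvg _ _ \oo _ (sqrt_iter w) (power_algebra a)) => //.
    exact: closed_power_algebra.
  by near=> n; exact: ay.
split.
  have h : (fun n => `|sqrt_iter w n|) @ \oo --> `|y| by exact: cvg_norm.
  rewrite -(cvg_lim _ h)//; apply: limr_le; first exact: cvgP h.
  near=> n; have /andP[_] := @sqrt_bound_le R n; apply: le_trans.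
  exact: pos_comb_norm w1 (sqrt_iter_comb w n).
have yE : y = 2^-1 *: (w + y ** y).
  have h1 : (fun n => sqrt_iter w n.+1) @ \oo --> y.
    by move: yw; rewrite -cvg_shiftS.
  have h2 : (fun n => sqrt_iter w n.+1) @ \oo --> 2^-1 *: (w + y ** y).
    apply: cvgZl_tmp; apply: cvgD; first exact: cvg_cst.
    apply: (@continuous_cvg _ _ _ _ _ (sqrt_iter w) (fun x : V => x ** x)) => //.
    exact: jsq_continuous.
  exact: normed_cvg_unique h1 h2.
rewrite !jmulE !jmul1l jmul1r.
by apply: (eq_lincomb (k1 := -2) (k2 := 0) (k3 := 0) (k4 := 0) yE yE yE yE); lmod_ring.
Unshelve. all: by end_near. Qed.

Lemma jsqrt_near1 a x : power_algebra a x -> `|e - x| <= 1 ->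
  exists2 r, power_algebra a r & `|e - r| <= 1 /\ r ** r = x.
Proof.
move=> ax x1; have aw : power_algebra a (e - x).
  by apply: power_algebraB => //; exact: power_algebra1.
have [y ay [y1 yE]] := sqrt_fixpoint aw x1.
exists (e - y); first by apply: power_algebraB => //; exact: power_algebra1.
by rewrite yE !subKr.
Qed.

Lemma jsquare_near1 x : `|e - x| <= 1 -> jsquare x.
Proof.
move=> x1; have [r _ [_ rx]] := jsqrt_near1 (@power_algebra_id _ _ x) x1.
by exists r.
Qed.

Lemma jsquare_normD x y : jsquare x -> jsquare y -> `|x| <= `|x + y|.
Proof. by move=> [u <-] [v <-]; exact: jnorm_sqrD. Qed.

(** [e - x] is a square too, so monotonicity of the norm compares it with [(e - x) + x = e]. *)
Lemma jsquare_dist1 x : jsquare x -> `|x| <= 1 -> `|e - x| <= 1.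
Proof.
move=> Sx x1; have Sy : jsquare (e - x) by apply: jsquare_near1; rewrite subKr.
by rewrite (le_trans (jsquare_normD Sy Sx))// subrK jone_norm.
Qed.

Lemma jsquareZ k x : 0 <= k -> jsquare x -> jsquare (k *: x).
Proof.
move=> k0 [y <-]; exists (Num.sqrt k *: y).
by rewrite jmulZl jmulZr scalerA -expr2 sqr_sqrtr.
Qed.

Lemma jsquare0 : jsquare 0. Proof. by exists 0; rewrite jmul0r. Qed.

Lemma jsquare_dist x t : jsquare x -> `|x| <= t -> `|t *: e - x| <= t.
Proof.
move=> Sx xt; have t0 : 0 <= t := le_trans (normr_ge0 x) xt.
have [t00|tn0] := eqVneq t 0.
  by move: xt; rewrite t00 scale0r sub0r normrN.
have tp : 0 < t by rewrite lt_def tn0.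
have -> : t *: e - x = t *: (e - t^-1 *: x).
  by rewrite scalerBr scalerA divff// scale1r.
rewrite normrZ (ger0_norm t0) ler_piMr//; apply: jsquare_dist1.
  by apply: jsquareZ => //; rewrite invr_ge0.
by rewrite normrZ ger0_norm ?invr_ge0// ler_pdivrMl// mulr1.
Qed.

Lemma jsqrt_of_dist a x t : power_algebra a x -> `|t *: e - x| <= t ->
  exists2 r, power_algebra a r & jsquare r /\ r ** r = x.
Proof.
move=> ax xt; have t0 : 0 <= t := le_trans (normr_ge0 _) xt.
have [t00|tn0] := eqVneq t 0.
  exists 0; first exact: power_algebra0.
  split; first exact: jsquare0.
  move: xt; rewrite t00 scale0r sub0r normrN normr_le0 => /eqP ->.
  by rewrite jmul0r.
have tp : 0 < t by rewrite lt_def tn0.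
have h : `|e - t^-1 *: x| <= 1.
  have -> : e - t^-1 *: x = t^-1 *: (t *: e - x).
    by rewrite scalerBr scalerA mulVf// scale1r.
  by rewrite normrZ ger0_norm ?invr_ge0// ler_pdivrMl// mulr1.
have [r ar [r1 rE]] := jsqrt_near1 (@power_algebraZ _ _ a t^-1 x ax) h.
exists (Num.sqrt t *: r); first exact: power_algebraZ.
split; first by apply: jsquareZ; [exact: sqrtr_ge0|exact: jsquare_near1].
by rewrite jmulZl jmulZr scalerA -expr2 sqr_sqrtr// rE scalerA divff// scale1r.
Qed.

Lemma jsquare_of_dist x t : `|t *: e - x| <= t -> jsquare x.
Proof.
move=> xt; have [r _ [_ rx]] := jsqrt_of_dist (@power_algebra_id _ _ x) xt.
by exists r.
Qed.

Lemma jsqrt a x : power_algebra a x -> jsquare x ->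
  exists2 r, power_algebra a r & jsquare r /\ r ** r = x.
Proof. by move=> ax Sx; apply: jsqrt_of_dist ax (jsquare_dist Sx (lexx _)). Qed.

Lemma jsquareD x y : jsquare x -> jsquare y -> jsquare (x + y).
Proof.
move=> Sx Sy; apply: (@jsquare_of_dist _ (`|x| + `|y|)).
rewrite scalerDl opprD addrACA (le_trans (ler_normD _ _))//.
by rewrite lerD// jsquare_dist.
Qed.

Lemma jsquare_eq0 x : jsquare x -> jsquare (- x) -> x = 0.
Proof.
move=> Sx Sy; apply/normr0_eq0/eqP; rewrite eq_le normr_ge0 andbT.
by rewrite (le_trans (jsquare_normD Sx Sy))// subrr normr0.
Qed.

(** The square roots stay in the associative algebra of [a], where [(r s)^2 = r^2 s^2]. *)
Lemma jsquareM a x y : power_algebra a x -> power_algebra a y ->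
  jsquare x -> jsquare y -> jsquare (x ** y).
Proof.
move=> ax ay Sx Sy; have [r ar [_ <-]] := jsqrt ax Sx.
have [s as_ [_ <-]] := jsqrt ay Sy; exists (r ** s).
have ars := power_algebraM ar as_.
rewrite -(power_algebraA ar as_ ars) (power_algebraCA as_ ar as_).
by rewrite -(power_algebraA ar ar) //; exact: power_algebraM.
Qed.

Lemma jsquare_one : jsquare e. Proof. by exists e; rewrite jmul1l. Qed.

Lemma jsquare_norm x t : `|x| <= t -> jsquare (t *: e + x).
Proof. by move=> xt; apply: (@jsquare_of_dist _ t); rewrite opprD addrA subrr sub0r normrN. Qed.

Lemma closed_jsquare : closed jsquare.
Proof.
move=> x cx; apply: (@jsquare_of_dist _ (`|x| + 1)).
apply/ler_addgt0Pr => d d0.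
have d1 : 0 < Num.min 1 d by rewrite lt_min ltr01.
have [y [Sy]] := cx _ (nbhsx_ballx x _ d1).
rewrite -ball_normE /= lt_min => /andP[xy1 xyd].
have yx : `|y| <= `|x| + 1.
  by rewrite -lerBlDl (le_trans (lerB_dist _ _))// distrC ltW.
rewrite -[X in `|X|](subrKA y) addrC.
rewrite (le_trans (ler_normD _ _))// addrC lerD ?(jsquare_dist Sy yx)//.
by rewrite distrC (ltW xyd).
Qed.

(** The working form of the cone: squares that stay squares after subtracting a multiple of the
    unit. [jconeE] identifies it with the spectral definition. *)
Definition jpos : set V := [set x | exists2 d : R, 0 < d & jsquare (x - d *: e)].

Lemma jpos_square x : jpos x -> jsquare x.
Proof.
move=> [d d0 Sx]; rewrite -(subrK (d *: e) x); apply: jsquareD => //.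
by apply: jsquareZ jsquare_one; exact: ltW.
Qed.

Lemma jposD x d : jsquare x -> 0 < d -> jpos (x + d *: e).
Proof. by move=> Sx d0; exists d; rewrite ?addrK. Qed.

Lemma jpos1 : jpos e.
Proof. by rewrite -[e]add0r -[X in _ + X]scale1r; exact: (jposD jsquare0 ltr01). Qed.

Lemma open_jpos : open jpos.
Proof.
rewrite openE => x [d d0 Sx] /=; have d20 : 0 < d / 2 by rewrite divr_gt0.
have := nbhsx_ballx x _ d20; apply: filterS => y.
rewrite -ball_normE /= distrC => yx; exists (d / 2) => //.
have -> : y - (d / 2) *: e = (x - d *: e) + ((d / 2) *: e + (y - x)).
  by lmod_ring.
by apply: jsquareD => //; apply: jsquare_norm; exact: ltW.
Qed.

End PositiveCone.

(** * Interior of the cone, invertible squares and the spectrum *)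

Section ConeInvertible.
Context {R : realType} {V : jbAlgebraType R}.
Implicit Types (a b u v w x y z : V).

Local Notation "x ** y" := (jmul x y) (at level 40, left associativity).
Local Notation L := (@Lop R V).
Local Notation U := (@Uop R V).
Local Notation e := (@jone R V).

Lemma GL_scale (g : bop V V) k : k != 0 -> GL V g -> GL V (k *: g).
Proof.
move=> k0 [h [gh hg]]; exists (k^-1 *: h).
rewrite -!bop_scalerAl -!bop_scalerAr gh hg !scalerA.
by rewrite mulfV// mulVf// !scale1r.
Qed.

(** The fundamental formula gives [U y * U u * U y = 1], which exhibits a left and a right inverse
    of [U y] at once. *)
Lemma Uop_inv_of_onto y u : U y u = e -> GL V (U y).
Proof.
move=> yu; have := Uop_fundamental y u; rewrite yu Uop1 => h.
have left_ : U y * (U u * U y) = 1 by rewrite mulrA.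
have right_ : (U y * U u) * U y = 1 by [].
have same : U u * U y = U y * U u.
  by rewrite -[LHS]mul1r -{1}right_ -mulrA left_ mulr1.
by exists (U u * U y); split=> //; rewrite same.
Qed.

Lemma jpos_invertible y : jpos y -> jinvertible y.
Proof.
move=> [d d0 Sy]; pose s := `|y - d *: e|; pose t := s + d.
have s0 : 0 <= s by exact: normr_ge0.
have t0 : 0 < t by rewrite ltr_wpDl.
have yt : `|e - t^-1 *: y| < 1.
  have -> : e - t^-1 *: y = t^-1 *: (t *: e - y).
    by rewrite scalerBr scalerA mulVf ?gt_eqF// scale1r.
  rewrite normrZ ger0_norm ?invr_ge0 ?(ltW t0)// ltr_pdivrMl// mulr1.
  have -> : t *: e - y = s *: e - (y - d *: e) by rewrite /t; lmod_ring.
  by rewrite (le_lt_trans (jsquare_dist Sy (lexx _)))// ltrDl.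
have GLy : GL V (L y).
  have -> : y = t *: (t^-1 *: y) by rewrite scalerA divff ?gt_eqF// scale1r.
  rewrite LopZ; apply: GL_scale; first by rewrite gt_eqF.
  apply: GL_near1; rewrite -Lop1 -LopN -LopD.
  exact: le_lt_trans (Lop_norm _) yt.
(* [M] stands for division by [y], and [u] for [y^-2]. *)
pose M := op_inv (L y); pose u := M (M e).
have yM x : y ** M x = x by rewrite -LopE op_invKV.
have My x : M (y ** x) = x by rewrite -[y ** x]/(L y x) /M op_invK.
have sqM : M (M (y ** y)) = e by rewrite My -[X in M X]jmul1r My.
have MC : M * L (y ** y) = L (y ** y) * M.
  by apply: GL_commute => //; rewrite jordan_LopC.
apply: (@Uop_inv_of_onto y u); rewrite UopE /u !yM.
have -> : (y ** y) ** M (M e) = M (M ((y ** y) ** e)).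
  have MCx x : (y ** y) ** M x = M ((y ** y) ** x).
    by have := congr1 (fun f : bop V V => f x) MC; rewrite !opME !LopE.
  by rewrite !MCx.
by rewrite jmul1r sqM; lmod_ring.
Qed.

Lemma power_algebra_Uop a z x : power_algebra a z -> power_algebra a x ->
  U z x = (z ** z) ** x.
Proof.
by move=> az ax; rewrite UopE (power_algebraA az az ax); lmod_ring.
Qed.

Lemma jpow_double_norm v k : `|v| = 1 -> `|jpow v (2 ^ k)| = 1.
Proof.
move=> v1; elim: k => [|k IH]; first by rewrite expn0 jpow1.
by rewrite expnS mul2n -addnn jpowD jnorm_sqr IH expr1n.
Qed.

(** The scalar estimate [n v^n (1 - v) <= 1 - v^n <= 1]. In [SC] the slack grows at each step by the
    positive term [(k + 1) v^k (1 - v)^2]. *)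
Lemma jpow_onem_norm v n : jsquare v -> jsquare (e - v) ->
  n%:R * `|jpow v n ** (e - v)| <= 1.
Proof.
move=> Sv Sz; set z := e - v in Sz *.
have av := @power_algebra_id _ _ v.
have ap k := @power_algebra_pow _ _ v k.
have az : power_algebra v z by apply: power_algebraB => //; exact: power_algebra1.
have Sp k : jsquare (jpow v k).
  elim: k => [|k IH]; first exact: jsquare_one.
  exact: (@jsquareM _ _ v).
have Spz k : jsquare (jpow v k ** z) by exact: (@jsquareM _ _ v).
have Spzz k : jsquare (jpow v k ** z ** z).
  by apply: (@jsquareM _ _ v) => //; exact: power_algebraM.
have SC k : jsquare (e - jpow v k - k%:R *: (jpow v k ** z)).
  elim: k => [|k IH].
    by rewrite /= scale0r subrr subr0; exact: jsquare0.
  have -> : e - jpow v k.+1 - k.+1%:R *: (jpow v k.+1 ** z) =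
      (e - jpow v k - k%:R *: (jpow v k ** z)) + k.+1%:R *: (jpow v k ** z ** z).
    have pS : jpow v k.+1 = jpow v k ** v by rewrite -{3}(jpow1 v) -jpowD addn1.
    have -> : jpow v k.+1 ** z = jpow v k ** z - jpow v k ** z ** z.
      rewrite pS -(power_algebraA (ap k) av az) -(power_algebraA (ap k) az az).
      by rewrite /z !jmulE !jmul1l !jmul1r ?jmul1l; lmod_ring.
    rewrite pS -natr1 /z !jmulE !jmul1r; lmod_ring.
  by apply: jsquareD => //; apply: jsquareZ.
have Sn : jsquare (n%:R *: (jpow v n ** z)) by apply: jsquareZ.
have := jsquare_normD Sn (jsquareD (SC n) (Sp n)).
rewrite normrZ normr_nat => /le_trans; apply.
have -> : n%:R *: (jpow v n ** z) +
    (e - jpow v n - n%:R *: (jpow v n ** z) + jpow v n) = e by lmod_ring.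
exact: jone_norm.
Qed.

(** If [v = e - y / s] had norm 1, then [w = v^(2n)] with [n = 2^k] would have norm 1 while
    [U y w = s^2 (v^n (e - v))^2] tends to 0, against the boundedness of the inverse of [U y]. So
    [|v| < 1], which bounds [y] from below. *)
Lemma jsquare_invertible_pos y : jsquare y -> jinvertible y -> jpos y.
Proof.
move=> Sy yG; pose s := `|y| + 1; have s0 : 0 < s by rewrite ltr_wpDl.
pose z := s^-1 *: y; pose v := e - z.
have yE : y = s *: z by rewrite /z scalerA divff ?gt_eqF// scale1r.
have Sz : jsquare z by apply: jsquareZ => //; rewrite invr_ge0 ltW.
have z1 : `|z| <= 1.
  rewrite /z normrZ ger0_norm ?invr_ge0 ?(ltW s0)// ler_pdivrMl// mulr1.
  by rewrite lerDl.
have v1 : `|v| <= 1 by exact: jsquare_dist1.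
have [vlt|vge] := ltP `|v| 1.
  have pz : jsquare (z - (1 - `|v|) *: e).
    apply: (@jsquare_of_dist _ _ _ `|v|).
    have -> // : `|v| *: e - (z - (1 - `|v|) *: e) = v by rewrite /v; lmod_ring.
  exists (s * (1 - `|v|)); first by rewrite mulr_gt0// subr_gt0.
  rewrite yE -scalerA -scalerBr; apply: jsquareZ => //; exact: ltW.
have ve : `|v| = 1 by apply/eqP; rewrite eq_le v1.
have Sv : jsquare v.
  by apply: jsquare_near1; rewrite /v subKr.
have zE : e - v = z by rewrite /v subKr.
pose C := `|op_inv (U y)| * s ^+ 2.
have key k : 1 <= C * (((2 ^ k)%:R : R)^-1) ^+ 2.
  set n := (2 ^ k)%N; have n0 : (0 < n)%N by rewrite expn_gt0.
  have nr : 0 < n%:R :> R by rewrite ltr0n.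
  pose w := jpow v n ** jpow v n.
  have w1 : `|w| = 1 by rewrite /w jnorm_sqr jpow_double_norm// expr1n.
  have av := @power_algebra_id _ _ v.
  have ap k' := @power_algebra_pow _ _ v k'.
  have az : power_algebra v z.
    by rewrite -zE; apply: power_algebraB => //; exact: power_algebra1.
  have Uw : U y w = (s ^+ 2) *: ((jpow v n ** z) ** (jpow v n ** z)).
    rewrite (power_algebra_Uop (a := v)); last first.
    - exact: power_algebraM.
    - by rewrite yE; exact: power_algebraZ.
    rewrite yE jmulZl jmulZr scalerA -expr2 jmulZl; congr (_ *: _).
    have apz := power_algebraM (ap n) az.
    rewrite -(power_algebraA (ap n) az apz) (power_algebraCA az (ap n) az).
    have azz := power_algebraM az az.
    rewrite (jmulC (z ** z)) /w -(power_algebraA (ap n) (ap n) azz).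
    by [].
  rewrite -[leLHS]w1 -[w in leLHS](op_invK w yG) (le_trans (bop_ler _ _))//.
  rewrite /C -mulrA ler_wpM2l// Uw normrZ ger0_norm ?sqr_ge0// ler_wpM2l ?sqr_ge0// jnorm_sqr.
  rewrite lerXn2r ?nnegrE ?invr_ge0//.
  have := jpow_onem_norm n Sv; rewrite zE => /(_ Sz).
  by rewrite -ler_pdivlMl// mulr1.
exfalso.
have [k kC] : exists k : nat, C < k%:R.
  exists (Num.bound C); apply: archi_boundP.
  by rewrite mulr_ge0// sqr_ge0.
have := key k; rewrite leNgt => /negP; apply.
have kn : k%:R <= (2 ^ k)%:R :> R by rewrite ler_nat ltnW// ltn_expl.
have n1 : 1 <= (2 ^ k)%:R :> R by rewrite ler1n expn_gt0.
have n0 : 0 < (2 ^ k)%:R :> R by rewrite (lt_le_trans ltr01).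
rewrite exprVn ltr_pdivrMr ?exprn_gt0// mul1r.
rewrite (lt_le_trans kC)// (le_trans kn)// expr2 ler_peMr// ltW//.
Qed.

(** Adding a large [t e] moves [x] into the squares. At the infimum of such [t >= 0] the sum is an
    invertible square, hence interior, so [t] could be lowered unless it is 0. *)
Lemma jconeE : @jcone R V = jpos.
Proof.
apply/seteqP; split=> x.
  move=> xO; have inv t : 0 <= t -> jinvertible (x + t *: e).
    move=> t0; apply: contrapT => nG; have : jspectrum x (- t).
      by rewrite /jspectrum /= scaleNr opprK.
    by move=> /xO /=; rewrite in_itv /= andbT oppr_gt0 ltNge t0.
  pose T := [set t : R | 0 <= t /\ jsquare (x + t *: e)].
  have T0 : T `|x|.
    by split=> //; rewrite addrC; exact: jsquare_norm.
  have lbT : has_inf T by split; [by exists (`|x|)|by exists 0 => t []].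
  pose t := inf T; have t0 : 0 <= t.
    by apply: lb_le_inf; [exists (`|x|)|move=> s []].
  have St : jsquare (x + t *: e).
    apply: closed_jsquare => B; rewrite -nbhs_ballE => -[d /= d0 dB].
    have d0' : 0 < d / (`|e| + 1) by rewrite divr_gt0// ltr_wpDl.
    have [s [s0 Ss] st] := inf_adherent d0' lbT.
    exists (x + s *: e); split=> //; apply: dB; rewrite -ball_normE /=.
    have -> : x + t *: e - (x + s *: e) = (t - s) *: e by lmod_ring.
    have ts : t <= s by apply: inf_lbound => //; exact: lbT.2.
    rewrite normrZ distrC ger0_norm ?subr_ge0//.
    have : s - t < d / (`|e| + 1) by rewrite ltrBlDl.
    rewrite ltr_pdivlMr ?ltr_wpDl//; apply: le_lt_trans.
    by rewrite ler_wpM2l ?subr_ge0// lerDl.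
  have [d d0 Sd] := jsquare_invertible_pos St (inv t t0).
  have [tz|tn0] := eqVneq t 0.
    by exists d => //; move: Sd; rewrite tz scale0r addr0.
  have tp : 0 < t by rewrite lt_def tn0.
  have m0 : 0 < Num.min d t by rewrite lt_min d0.
  have : T (t - Num.min d t).
    split; first by rewrite subr_ge0 ge_min lexx orbT.
    have -> : x + (t - Num.min d t) *: e =
        (x + t *: e - d *: e) + (d - Num.min d t) *: e by lmod_ring.
    apply: jsquareD => //; apply: jsquareZ jsquare_one.
    by rewrite subr_ge0 ge_min lexx.
  move=> /(inf_lbound lbT.2); rewrite -/t leNgt ltrBlDr ltrDl m0 //.
move=> [d d0 Sx] l /= lx; rewrite in_itv /= andbT ltNge; apply/negP => l0.
apply: lx; apply: jpos_invertible; exists d => //.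
have -> : x - l *: e - d *: e = (x - d *: e) + (- l) *: e by lmod_ring.
by apply: jsquareD => //; apply: jsquareZ jsquare_one; rewrite oppr_ge0.
Qed.

End ConeInvertible.

(** * The structure group *)

Section StructureGroup.
Context {R : realType} {V : jbAlgebraType R}.
Implicit Types (a b c x y z : V) (g h k : bop V V).

Local Notation "x ** y" := (jmul x y) (at level 40, left associativity).
Local Notation L := (@Lop R V).
Local Notation U := (@Uop R V).
Local Notation e := (@jone R V).

Lemma Str_GL g : Str V g -> GL V g. Proof. by case. Qed.

Lemma Str1 : Str V 1.
Proof.
split; first exact: GL1.
by exists 1; split=> [|x]; [exact: GL1|rewrite op1E mul1r mulr1].
Qed.

Lemma Str_mul g h : Str V g -> Str V h -> Str V (g * h).
Proof.
move=> [gG [gs [gsG gU]]] [hG [hs [hsG hU]]]; split; first exact: GL_mul.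
exists (hs * gs); split=> [|x]; first exact: GL_mul.
by rewrite opME gU hU !mulrA.
Qed.

Lemma Str_inv g : Str V g -> Str V (op_inv g).
Proof.
move=> [gG [gs [gsG gU]]]; split; first exact: GL_inv.
exists (op_inv gs); split=> [|x]; first exact: GL_inv.
rewrite -{2}(op_invKV x gG) gU !mulrA mulVop// mul1r.
by rewrite -mulrA mulopV// mulr1.
Qed.

Lemma Str_invertible g x : Str V g -> jinvertible x -> jinvertible (g x).
Proof.
by move=> [gG [gs [gsG gU]]] xG; rewrite /jinvertible gU; apply: GL_mul => //; exact: GL_mul.
Qed.

Lemma continuous_op_app x : continuous (fun g : bop V V => g x).
Proof.
have -> : (fun g : bop V V => g x) = flip_op (1 : bop (bop V V) (bop V V)) x.
  by apply/funext => g; rewrite flip_opE op1E.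
exact: bop_continuous.
Qed.

Lemma connected_jpos (D : set V) x : connected D -> D `<=` @jinvertible R V ->
  D x -> jpos x -> D `<=` jpos.
Proof.
move=> cD Dinv Dx px; suff <- : D `&` jpos = D by move=> y [].
apply: cD; first by exists x.
  by exists jpos => //; exact: open_jpos.
exists (@jsquare R V); first exact: closed_jsquare.
apply/seteqP; split=> y [Dy yy]; split=> //; first exact: jpos_square.
by apply: jsquare_invertible_pos => //; exact: Dinv.
Qed.

Lemma Str0_Str g : Str0 V g -> Str V g.
Proof. exact: connected_component_sub. Qed.

Lemma Str0_1 : Str0 V (1 : bop V V).
Proof. exact/connected_component_refl/Str1. Qed.

Lemma connected_Str0 (C : set (bop V V)) g : connected C -> C `<=` Str V ->
  C g -> Str0 V g -> C `<=` Str0 V.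
Proof.
move=> cC CS Cg g0; rewrite /Str0 (same_connected_component g0).
exact: connected_component_max.
Qed.

Lemma Str0_mul g h : Str0 V g -> Str0 V h -> Str0 V (g * h).
Proof.
move=> g0 h0.
apply: (@connected_Str0 [set g * h' | h' in Str0 V] g) => //; last by exists h.
- apply: connected_continuous_connected; first exact: component_connected.
  apply: continuous_subspaceT => h'.
  have -> : (fun h' => g * h') = lmul_op V g.
    by apply/funext => h''; rewrite lmul_opE.
  exact: bop_continuous.
- by move=> _ [h' h'0 <-]; apply: Str_mul; exact: Str0_Str.
- by exists 1; rewrite ?mulr1//; exact: Str0_1.
Qed.

Lemma Str0_inv g : Str0 V g -> Str0 V (op_inv g).
Proof.
move=> g0; apply: (@connected_Str0 (@op_inv R V @` Str0 V) 1).
- apply: connected_continuous_connected; first exact: component_connected.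
  apply: continuous_in_subspaceT => h; rewrite inE => /Str0_Str/Str_GL.
  exact: op_inv_continuous.
- by move=> _ [h h0 <-]; apply/Str_inv/Str0_Str.
- by exists 1; [exact: Str0_1|exact: op_inv1].
- exact: Str0_1.
- by exists g.
Qed.

Lemma Str0_jpos g x : Str0 V g -> jpos x -> jpos (g x).
Proof.
move=> g0 px.
have H : [set h x | h in Str0 V] `<=` jpos.
  apply: (@connected_jpos _ x) => //.
  - apply: connected_continuous_connected; first exact: component_connected.
    exact/continuous_subspaceT/continuous_op_app.
  - move=> _ [h h0 <-]; apply: Str_invertible; first exact: Str0_Str.
    exact: jpos_invertible.
  - by exists 1; [exact: Str0_1|rewrite op1E].
by apply: H; exists g.
Qed.

(** Every square is a limit of interior elements [x + t e], and the squares form a closed set. *)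
Lemma jsquare_of_jpos (f : bop V V) : (forall x, jpos x -> jsquare (f x)) ->
  forall x, jsquare x -> jsquare (f x).
Proof.
move=> fpos x Sx; apply: closed_jsquare => B; rewrite -nbhs_ballE => -[d /= d0 dB].
have n0 : 0 < `|f e| + 1 by rewrite ltr_wpDl.
have t0 : 0 < d / (`|f e| + 1) / 2 by rewrite !divr_gt0.
exists (f (x + (d / (`|f e| + 1) / 2) *: e)); split.
  by apply: fpos; exact: jposD.
apply: dB; rewrite -ball_normE /= bop_appD bop_appZ opprD addrA subrr sub0r.
rewrite normrN normrZ gtr0_norm//.
have -> : d / (`|f e| + 1) / 2 * `|f e| = d * (`|f e| / 2 / (`|f e| + 1)).
  by field; rewrite gt_eqF.
rewrite gtr_pMr// ltr_pdivrMr// mul1r; have := normr_ge0 (f e); lra.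
Qed.

Lemma Str0_jsquare g x : Str0 V g -> jsquare x -> jsquare (g x).
Proof.
by move=> g0; apply: jsquare_of_jpos => y py; exact/jpos_square/Str0_jpos.
Qed.

Lemma Uop_continuous : continuous U.
Proof.
move=> x.
pose B := @Lop_op R V.
have -> : U = fun y => 2 *: lmul_op V (B y) (B y) + - B (y ** y).
  by apply/funext => y; rewrite lmul_opE.
have cB := is_diff_bop B x; have [D xD] := jsq_is_diff x.
have c1 := is_diff_bop_continuous (is_diff_bilin (lmul_op V) cB cB).
have c2 := is_diff_bop_continuous (is_diff_ocomp xD (is_diff_bop B _)).
by apply: cvgD; [apply: cvgZl_tmp; exact: c1|apply: cvgN; exact: c2].
Qed.

Lemma Uop_Str d : jpos d -> Str V (U d).
Proof.
move=> pd; have dG := jpos_invertible pd; split=> //.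
by exists (U d); split=> // x; exact: Uop_fundamental.
Qed.

Lemma jpos_segment d (t : R) : jpos d -> 0 <= t <= 1 -> jpos ((1 - t) *: e + t *: d).
Proof.
move=> pd /andP[t0 t1]; have [->|tn0] := eqVneq t 0.
  by rewrite subr0 scale1r scale0r addr0; exact: jpos1.
have tp : 0 < t by rewrite lt_def tn0.
case: pd => s s0 Ss; exists (t * s); first exact: mulr_gt0.
have -> : (1 - t) *: e + t *: d - (t * s) *: e = (1 - t) *: e + t *: (d - s *: e).
  by lmod_ring.
by apply: jsquareD; apply: jsquareZ => //; [rewrite subr_ge0|exact: jsquare_one].
Qed.

(** The segment from [e] to [d] stays in the cone and is carried to a path in [Str] from 1 to
    [U d]. *)
Lemma Uop_Str0 d : jpos d -> Str0 V (U d).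
Proof.
move=> pd.
pose c (t : R) := (1 - t) *: e + t *: d.
have cc : continuous c.
  move=> t; apply: cvgD.
    apply: (@is_diff_bop_continuous _ _ _ (fun t : R => (1 - t) *: e) (ray (- e))).
    apply/is_diff_bopP => d' d'0; near=> h.
    rewrite rayE (_ : _ - _ = 0) ?normr0 ?mulr_ge0 ?(ltW d'0)//.
    by lmod_ring.
  exact: is_diff_bop_continuous (curve_ray d t).
apply: (@connected_Str0 [set U (c t) | t in `[0, 1]%classic] 1).
- apply: connected_continuous_connected; first exact: segment_connected.
  apply: continuous_subspaceT => t.
  by apply: (@continuous_comp _ _ _ c U); [exact: cc|exact: Uop_continuous].
- by move=> _ [t /= t01 <-]; apply/Uop_Str/jpos_segment => //; move: t01; rewrite in_itv.
- exists 0; first by rewrite /= in_itv /= lexx ler01.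
  by rewrite /c subr0 scale1r scale0r addr0 Uop1.
- exact: Str0_1.
- exists 1; first by rewrite /= in_itv /= lexx ler01.
  by rewrite /c subrr scale1r scale0r add0r.
Unshelve. all: by end_near. Qed.

Lemma jpos_sqrt x : jpos x -> exists2 d, jpos d & d ** d = x.
Proof.
move=> px; have [d _ [Sd dx]] := jsqrt (@power_algebra_id _ _ x) (jpos_square px).
exists d => //; apply: jsquare_invertible_pos => //.
(* The square of [U d] is the invertible operator [U x], so [U d] is invertible. *)
have := jpos_invertible px; rewrite /jinvertible -dx Uop_sqr => -[h [hr hl]].
have E : U d * h = h * U d.
  by rewrite -[LHS]mul1r -hl -!mulrA [U d * (U d * h)]mulrA hr mulr1.
by exists (U d * h); split; rewrite ?mulrA// E -mulrA.
Qed.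

(* Conjugating by [U d], where [b = d ** d], turns [U c b] into the square of
   [U d c]. *)
Lemma Uop_jsquare c b : jsquare b -> jsquare (U c b).
Proof.
move: b; apply: jsquare_of_jpos => b /jpos_sqrt[d pd <-].
have h : U d (U c (d ** d)) = U d c ** U d c.
  by rewrite -(Uop_one (U d c)) -(Uop_one d) Uop_fundamental !opME.
rewrite -(op_invK (U c (d ** d)) (jpos_invertible pd)) h.
apply: Str0_jsquare; first exact/Str0_inv/Uop_Str0.
by exists (U d c).
Qed.

End StructureGroup.

(** * The group of the cone *)

Section ConeGroup.
Context {R : realType} {V : jbAlgebraType R}.
Implicit Types (a b c x y z : V) (g h k : bop V V).

Local Notation "x ** y" := (jmul x y) (at level 40, left associativity).
Local Notation L := (@Lop R V).
Local Notation U := (@Uop R V).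
Local Notation e := (@jone R V).

Lemma cone_groupP g : cone_group V g <-> [/\ GL V g,
  forall x, jpos x -> jpos (g x) & forall x, jpos x -> jpos (op_inv g x)].
Proof.
rewrite /cone_group /= jconeE; split.
  move=> [gG gO]; split=> // x px; first by rewrite -gO; exists x.
  have : [set g x | x in jpos] x by rewrite gO.
  by move=> [y py <-]; rewrite op_invK.
move=> [gG gp gip]; split=> //; apply/seteqP; split=> [_ [x px <-]|x px].
  exact: gp.
by exists (op_inv g x); [exact: gip|rewrite op_invKV].
Qed.

Lemma subgroup_cone_group : subgroup_GL (cone_group V).
Proof.
split=> [g [] //||g h /cone_groupP[gG g1 g2] /cone_groupP[hG h1 h2]|
    g /cone_groupP[gG g1 g2]].
- by apply/cone_groupP; split=> [|x|x]; rewrite ?op_inv1 ?op1E//; exact: GL1.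
- apply/cone_groupP; split=> [|x px|x px]; first exact: GL_mul.
    by rewrite opME; exact/g1/h1.
  by rewrite op_invM// opME; exact/h2/g2.
- apply/cone_groupP; split=> [|x px|x px]; [exact: GL_inv|exact: g2|].
  by rewrite op_inv_inv//; exact: g1.
Qed.

Lemma Str0_cone_group g : Str0 V g -> cone_group V g.
Proof.
move=> g0; apply/cone_groupP; split.
- exact/Str_GL/Str0_Str.
- by move=> x; exact: Str0_jpos.
- by move=> x; apply/Str0_jpos/Str0_inv.
Qed.

Lemma jaut_inv k : jaut V k -> jaut V (op_inv k).
Proof.
move=> [kG kM]; split=> [|a b]; first exact: GL_inv.
by rewrite -{1}(op_invKV a kG) -{1}(op_invKV b kG) -kM op_invK.
Qed.

Lemma jaut_one k : jaut V k -> k e = e.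
Proof.
move=> [kG kM]; rewrite -[LHS]jmul1r -{2}(op_invKV e kG) -kM jmul1l.
by rewrite op_invKV.
Qed.

Lemma jaut_Str k : jaut V k -> Str V k.
Proof.
move=> kA; have [kG kM] := kA; split=> //; exists (op_inv k).
split=> [|x]; first exact: GL_inv.
apply: bop_eqP => y; rewrite !opME !UopE -{1 2}(op_invKV y kG) -!kM.
by rewrite bop_appB bop_appZ.
Qed.

Lemma jaut_jsquare k x : jaut V k -> jsquare x -> jsquare (k x).
Proof. by move=> [_ kM] [y <-]; exists (k y); rewrite kM. Qed.

Lemma jaut_jpos k x : jaut V k -> jpos x -> jpos (k x).
Proof.
move=> kA [d d0 Sx]; exists d => //.
by rewrite -(jaut_one kA) -bop_appZ -bop_appB; exact: jaut_jsquare.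
Qed.

Lemma jaut_cone_group k : jaut V k -> cone_group V k.
Proof.
move=> kA; apply/cone_groupP; split=> [|x|x]; first by case: kA.
  exact: jaut_jpos.
exact/jaut_jpos/jaut_inv.
Qed.

(* Iterated splitting [f = (1 - a) f + a f], the second piece moving the label
   by one: a Jordan-algebraic version of the Bernstein partition of unity. *)
Lemma bernstein_partition a n : jsquare a -> jsquare (e - a) ->
  exists s : seq (R * V),
  [/\ forall p, p \in s -> power_algebra a p.2 /\ jsquare p.2,
      \sum_(p <- s) p.2 = e,
      \sum_(p <- s) p.1 *: p.2 = n%:R *: a
    & \sum_(p <- s) p.1 ^+ 2 *: p.2 =
        n%:R *: a + (n%:R * (n%:R - 1)) *: (a ** a)].
Proof.
move=> Sa Sb; have aa := @power_algebra_id _ _ a.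
have ab : power_algebra a (e - a) by apply: power_algebraB => //; exact: power_algebra1.
elim: n => [|n [s [sP s0 s1 s2]]].
  exists [:: (0, e)]; split=> [p||| ]; rewrite ?big_seq1 /=.
  - rewrite inE => /eqP -> /=; split; first exact: power_algebra1.
    exact: jsquare_one.
  - by [].
  - by rewrite !scale0r.
  - by rewrite expr0n /= mul0r !scale0r addr0.
(* The list holds products of factors [a] and [e - a], labelled by the number of factors [a], with
   equal labels left unmerged. The three sums are the moments of order 0, 1 and 2 of the binomial
   law. *)
exists ([seq (p.1, (e - a) ** p.2) | p <- s] ++ [seq (p.1 + 1, a ** p.2) | p <- s]).
have sumM (f : R -> R) c : \sum_(p <- s) f p.1 *: (c ** p.2) =
    c ** (\sum_(p <- s) f p.1 *: p.2).
  rewrite -LopE linear_sum; apply: eq_bigr => p _.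
  by rewrite /= jmulZr.
have sumM1 c : \sum_(p <- s) c ** p.2 = c ** e.
  by rewrite -s0 -[c ** _]LopE linear_sum.
split=> [p|||]; rewrite ?big_cat ?big_map /=.
- rewrite mem_cat => /orP[] /mapP[q qs ->] /=; have [aq Sq] := sP q qs.
    by split; [exact: power_algebraM|exact: (jsquareM ab aq)].
  by split; [exact: power_algebraM|exact: (jsquareM aa aq)].
- by rewrite !sumM1 !jmul1r subrK.
- rewrite (sumM id) s1.
  under [X in _ + X]eq_bigr do rewrite scalerDl scale1r.
  rewrite big_split /= (sumM id) s1 sumM1 jmul1r !jmulE !jmul1l -[n.+1%:R]natr1.
  by lmod_ring.
- rewrite (sumM (fun t : R => t ^+ 2)) s2.
  have sq (p : R * V) : (p.1 + 1) ^+ 2 *: (a ** p.2) = p.1 ^+ 2 *: (a ** p.2) +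
      (2 *: (p.1 *: (a ** p.2)) + a ** p.2) by lmod_ring.
  under [X in _ + X]eq_bigr do rewrite sq.
  rewrite !big_split /= -scaler_sumr (sumM (fun t : R => t ^+ 2)) s2 (sumM id) s1.
  rewrite sumM1 jmul1r !jmulE !jmul1l -[n.+1%:R]natr1.
  by lmod_ring.
Qed.

Lemma jsquare_lim x y : (forall n : nat, jsquare (x + n.+1%:R^-1 *: y)) -> jsquare x.
Proof.
move=> Sn; have h : (fun n => x + n.+1%:R^-1 *: y) @ \oo --> x.
  rewrite -[X in _ --> X]addr0 -[X in _ --> _ + X](scale0r y).
  apply: cvgD; first exact: cvg_cst.
  by apply: cvgZr_tmp; exact: cvg_harmonic.
apply: (@closed_cvg _ _ \oo _ (fun n => x + n.+1%:R^-1 *: y) jsquare) => //.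
  exact: closed_jsquare.
by near=> n; exact: Sn.
Unshelve. all: by end_near. Qed.

(** * The Kadison inequality for unital positive maps *)

Section Kadison.
Variable k : bop V V.
Hypothesis ke : k e = e.
Hypothesis kS : forall x, jsquare x -> jsquare (k x).

(** The sum of [U ((j/N) e - k a) (k q)] over labels [j] and weights [q] of the partition is a
    square by [Uop_jsquare]. The binomial moments evaluate it as
    [k (a^2) - (k a)^2 + (k a - k (a^2)) / N]; then [N] tends to infinity. *)
Lemma kadison_unit_interval a : jsquare a -> jsquare (e - a) ->
  jsquare (k (a ** a) - k a ** k a).
Proof.
move=> Sa Sb; apply: (@jsquare_lim _ (k a - k (a ** a))) => n; pose N : R := n.+1%:R.
have N0 : N != 0 by rewrite /N pnatr_eq0.
have [s [sP s0 s1 s2]] := bernstein_partition n.+1 Sa Sb.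
have : jsquare (\sum_(p <- s) U ((p.1 / N) *: e - k a) (k p.2)).
  rewrite big_seq; elim/big_ind : _ => [|x y|p ps]; first exact: jsquare0.
    exact: jsquareD.
  by apply/Uop_jsquare/kS; have [] := sP p ps.
have [T TE] : exists T : bop V V, T = U (k a) by exists (U (k a)).
have UE (p : R * V) : U ((p.1 / N) *: e - k a) (k p.2) =
    (N ^- 2) *: k (p.1 ^+ 2 *: p.2) -
    (2 / N) *: (k a ** k (p.1 *: p.2)) + T (k p.2).
  rewrite TE !UopE !bop_appZ !jmulE !jmul1l !jmul1r ?jmulE.
  by lmod_ring.
under eq_bigr do rewrite UE.
rewrite !big_split /= sumrN -!scaler_sumr.
have -> : \sum_(p <- s) k (p.1 ^+ 2 *: p.2) =
    k (N *: a + (N * (N - 1)) *: (a ** a)) by rewrite -s2 linear_sum.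
have -> : \sum_(p <- s) k a ** k (p.1 *: p.2) = k a ** k (N *: a).
  by rewrite -s1 linear_sum -[RHS]LopE linear_sum.
have -> : \sum_(p <- s) T (k p.2) = T e.
  by rewrite -ke -s0 !linear_sum.
rewrite TE Uop_one !bop_app !jmulE -/N.
set x := (X in jsquare X -> _); set y := (X in _ -> jsquare X).
suff -> : x = y by [].
by rewrite /x /y; lmod_ring.
Qed.

(** Replacing [a] by [alpha e + beta a] multiplies the defect by [beta^2], which reduces to elements
    between 0 and [e]. *)
Lemma kadison a : jsquare (k (a ** a) - k a ** k a).
Proof.
pose s := `|a| + 1; have s0 : 0 < s by rewrite ltr_wpDl.
pose c := (2 * s)^-1 *: (s *: e + a).
have i0 : 0 <= (2 * s)^-1 by rewrite invr_ge0 mulr_ge0// ltW.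
have Sc : jsquare c.
  by apply: jsquareZ => //; apply: jsquare_norm; rewrite lerDl.
have Sc' : jsquare (e - c).
  have -> : e - c = (2 * s)^-1 *: (s *: e + - a).
    by rewrite /c; lmod_ring; rewrite gt_eqF.
  by apply: jsquareZ => //; apply: jsquare_norm; rewrite normrN lerDl.
have -> : k (a ** a) - k a ** k a = (2 * s) ^+ 2 *: (k (c ** c) - k c ** k c).
  rewrite /c !(jmulE, bop_app, jmul1l, jmul1r, ke).
  by lmod_ring; rewrite gt_eqF.
by apply: jsquareZ (kadison_unit_interval Sc Sc'); rewrite sqr_ge0.
Qed.

End Kadison.

Lemma cone_group_jsquare g x : cone_group V g -> jsquare x -> jsquare (g x).
Proof.
move=> /cone_groupP[_ gp _]; apply: jsquare_of_jpos => y py.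
exact/jpos_square/gp.
Qed.

Lemma cone_group_unital k : cone_group V k -> k e = e -> jaut V k.
Proof.
move=> kC ke; have [kG kp kip] := (cone_groupP k).1 kC.
have kC' : cone_group V (op_inv k) by have [_ _ _ h] := subgroup_cone_group; exact: h.
have ke' : op_inv k e = e by rewrite -{1}ke op_invK.
split=> //.
have sq a : k (a ** a) = k a ** k a.
  have h1 := kadison ke (fun x => cone_group_jsquare kC) a.
  have h2 := kadison ke' (fun x => cone_group_jsquare kC') (k a).
  (* Applying [k] to the inequality for its inverse gives the reverse of the inequality for [k]. *)
  have := cone_group_jsquare kC h2.
  rewrite bop_appB op_invKV// op_invK// -opprB => h3.
  by apply/eqP; rewrite -subr_eq0; apply/eqP/jsquare_eq0.
move=> a b; have := sq (a + b); rewrite !bop_app !jmulE !bop_app !sq.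
rewrite (jmulC b a) (jmulC (k b) (k a)) => h.
by apply: (eq_lincomb (k1 := 2^-1) (k2 := 0) (k3 := 0) (k4 := 0) h h h h); lmod_ring.
Qed.

(** [d] is a square root of [g e], so [U d e = g e] and the remaining factor is unital. *)
Lemma cone_group_polar g : cone_group V g ->
  exists2 d, jpos d & exists2 k, jaut V k & g = U d * k.
Proof.
move=> gC; have [gG gp _] := (cone_groupP g).1 gC.
have [d pd dg] := jpos_sqrt (gp e jpos1); exists d => //.
have Ud0 := Uop_Str0 pd; have UG := Str_GL (Str0_Str Ud0).
exists (op_inv (U d) * g); last by rewrite mulrA mulopV// mul1r.
apply: cone_group_unital.
  have [_ _ hM _] := subgroup_cone_group; apply: hM => //.
  exact/Str0_cone_group/Str0_inv.
by rewrite opME -dg -Uop_one op_invK.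
Qed.

Lemma cone_group_Str g : cone_group V g -> Str V g.
Proof.
move=> /cone_group_polar[d pd [k kA ->]].
by apply: Str_mul; [exact: Uop_Str|exact: jaut_Str].
Qed.

(** A limit [g] maps the interior a priori only into the closed cone. For invertible [g], apply this
    to [x - t g^-1 e], still interior for small [t]: then [g x - t e] is a square. *)
Lemma closed_cone_group : closed_in_GL (cone_group V).
Proof.
have H g : GL V g -> closure (cone_group V) g -> forall x, jpos x -> jpos (g x).
  move=> gG gc.
  have gS x : jpos x -> jsquare (g x).
    move=> px; apply: closed_jsquare => B Bgx.
    have [h [hC hB]] := gc _ (@continuous_op_app _ _ x g B Bgx).
    by exists (h x); split=> //; apply: cone_group_jsquare => //; exact: jpos_square.
  move=> x px.
  pose f := op_inv g e; have n0 : 0 < `|f| + 1 by rewrite ltr_wpDl.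
  have [d d0 Sx] := px.
  pose t := d / 2 / (`|f| + 1); have t0 : 0 < t by rewrite !divr_gt0.
  have pxt : jpos (x - t *: f).
    exists (d / 2); first by rewrite divr_gt0.
    have -> : x - t *: f - (d / 2) *: e = (x - d *: e) + ((d / 2) *: e + - (t *: f)).
      by lmod_ring.
    apply: jsquareD => //; apply: jsquare_norm; rewrite normrN normrZ gtr0_norm//.
    rewrite /t mulrAC ler_pdivrMr// ler_wpM2l ?lerDl//.
    by rewrite divr_ge0// ltW.
  exists t => //; have := gS _ pxt.
  by rewrite bop_appB bop_appZ /f op_invKV.
move=> g [gc gG]; apply/cone_groupP; split=> //; first exact: H.
apply: H; first exact: GL_inv.
move=> B Bg; have [h [hC hB]] := gc _ (op_inv_continuous gG Bg).
exists (op_inv h); split=> //; have [_ _ _ hI] := subgroup_cone_group.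
exact: hI.
Qed.

(** The indices are the cosets of [Str0] represented by automorphisms, with representatives by
    choice. If [ki] and [kj] share a component [C] of the automorphism group, [C kj^-1] is a
    connected subset of [Str] through 1, so [ki kj^-1] lies in [Str0] and the cosets agree. *)
Lemma cone_group_decomposition : exists (I : Type) (k : I -> bop V V),
  [/\ forall i, jaut V (k i),
      forall i j, i <> j ->
        connected_component (jaut V) (k i) <> connected_component (jaut V) (k j),
      cone_group V = \bigcup_i [set g * k i | g in Str0 V]
    & trivIset setT (fun i => [set g * k i | g in Str0 V])].
Proof.
pose coset k : set (bop V V) := [set g * k | g in Str0 V].
pose rep C : bop V V := get [set k | jaut V k /\ coset k = C].
pose I := {C : set (bop V V) | exists2 k, jaut V k & coset k = C}.
have repP (i : I) : jaut V (rep (sval i)) /\ coset (rep (sval i)) = sval i.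
  have [k kA kC] := svalP i.
  exact: (@getPex _ [set k | jaut V k /\ coset k = sval i] (ex_intro _ k (conj kA kC))).
have cosetS g k k' : jaut V k -> jaut V k' -> Str0 V g -> k' = g * k ->
    coset k' `<=` coset k.
  by move=> kA kA' g0 -> _ [h h0 <-]; exists (h * g); rewrite ?mulrA//; exact: Str0_mul.
have coset_eq g k k' : jaut V k -> jaut V k' -> Str0 V g -> k' = g * k ->
    coset k' = coset k.
  move=> kA kA' g0 kE; apply/seteqP; split; first exact: (cosetS g).
  apply: (cosetS (op_inv g)) => //; first exact: Str0_inv.
  by rewrite kE mulrA mulVop ?mul1r//; exact/Str_GL/Str0_Str.
have inj (i j : I) : sval i = sval j -> i = j.
  case: i j => [C p] [D q] /= E; case: _ / E q => q.
  by congr exist; exact: Prop_irrelevance.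
exists I, (fun i => rep (sval i)); split.
- by move=> i; have [] := repP i.
- move=> i j ij ijC; apply: ij; apply: inj.
  have [iA <-] := repP i; have [jA <-] := repP j.
  set ki := rep (sval i) in ijC iA *; set kj := rep (sval j) in ijC jA *.
  have iG : GL V ki by case: iA.
  apply: (@coset_eq (ki * op_inv kj)) => //; last first.
    by rewrite -mulrA mulVop ?mulr1//; case: jA.
  have C0 : [set h * op_inv kj | h in connected_component (jaut V) kj] `<=` Str0 V.
    apply: (@connected_Str0 _ _ _ 1).
    - apply: connected_continuous_connected; first exact: component_connected.
      apply: continuous_subspaceT => h.
      have -> : (fun h => h * op_inv kj) = rmul_op V (op_inv kj).
        by apply/funext => h'; rewrite rmul_opE.
      exact: bop_continuous.
    - move=> _ [h hj <-]; apply: Str_mul.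
        exact/jaut_Str/(connected_component_sub hj).
      exact/Str_inv/jaut_Str.
    - exists kj; first exact: connected_component_refl.
      by rewrite mulopV//; case: jA.
    - exact: Str0_1.
  apply: C0; exists ki => //; rewrite -ijC; exact: connected_component_refl.
- apply/seteqP; split=> g.
    move=> /cone_group_polar[d pd [k kA ->]].
    pose i : I := exist _ (coset k) (ex_intro2 _ _ k kA erefl).
    exists i => //; have [_ iE] := repP i.
    change (coset (rep (sval i)) (U d * k)); rewrite iE /=.
    by exists (U d) => //; exact: Uop_Str0.
  move=> [i _ [h h0 <-]]; have [iA _] := repP i.
  have [_ _ hM _] := subgroup_cone_group; apply: hM.
    exact: Str0_cone_group.
  exact: jaut_cone_group.
- move=> i j _ _ [_ [[g g0 <-] [h h0 ghE]]]; apply: inj.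
  have [iA <-] := repP i; have [jA <-] := repP j.
  apply: (@coset_eq (op_inv g * h)) => //.
    by apply: Str0_mul => //; exact: Str0_inv.
  by rewrite -mulrA ghE mulrA mulVop ?mul1r//; exact/Str_GL/Str0_Str.
Qed.

End ConeGroup.

(** * The Lie algebra of the structure group *)

Section StructureAlgebra.
Context {R : realType} {V : jbAlgebraType R}.
Implicit Types (a b c x y z : V) (g h H : bop V V).

Local Notation "x ** y" := (jmul x y) (at level 40, left associativity).
Local Notation L := (@Lop R V).
Local Notation U := (@Uop R V).
Local Notation e := (@jone R V).

Fact Uop2_op_key : exists B : bop V (bop V (bop V V)), forall x y, B x y = Uop2 x y.
Proof.
apply: (@bop2P _ _ _ _ _ 3) => [y k x x'|x k y y'|x y].
- apply: bop_eqP => z; rewrite Uop2E bopDE bopZE !Uop2E /triple !jmulE.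
  by lmod_ring.
- apply: bop_eqP => z; rewrite Uop2E bopDE bopZE !Uop2E /triple !jmulE.
  by lmod_ring.
apply: bop_lub => [|z]; first by rewrite !mulr_ge0.
rewrite Uop2E /triple (le_trans (ler_normB _ _))//.
have tri (u v w : V) : `|u ** (v ** w)| <= `|u| * (`|v| * `|w|).
  by rewrite (le_trans (jnormM _ _))// ler_wpM2l// jnormM.
have := le_trans (ler_normD (x ** z ** y) (x ** (z ** y)))
  (lerD (le_trans (jnormM (x ** z) y) (ler_wpM2r (normr_ge0 y) (jnormM x z)))
  (tri x z y)).
move=> /(lerD)/(_ (tri z x y))/le_trans; apply.
by rewrite le_eqVlt; apply/orP; left; apply/eqP; ring.
Qed.

Definition Uop2_op : bop V (bop V (bop V V)) := projT1 (cid Uop2_op_key).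

Lemma Uop2_opE x y : Uop2_op x y = Uop2 x y.
Proof. exact: (projT2 (cid Uop2_op_key)). Qed.

Lemma Uop2C x y : Uop2 x y = Uop2 y x.
Proof. by rewrite /Uop2 [x + y]addrC addrAC. Qed.

Lemma Uop2xx x : Uop2 x x = U x.
Proof. by apply: bop_eqP => z; rewrite Uop2E Uop_triple. Qed.

Lemma Uop2D x y z : Uop2 (x + y) z = Uop2 x z + Uop2 y z.
Proof. by rewrite -!Uop2_opE bop_appD bopDE. Qed.

Lemma Uop2Dr x y z : Uop2 z (x + y) = Uop2 z x + Uop2 z y.
Proof. by rewrite -!Uop2_opE bop_appD. Qed.

(* The derivation of the space of bilinear maps [V -> V -> B(V)] attached to
   [(H, K)]. It exponentiates to
   [B |-> (x, y |-> e^-H B (e^H x, e^H y) e^K)]. *)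
Definition str_op H (K : bop V V) :=
  sandwich (sandwich (sandwich (- H) K) H) H.

Lemma str_opE H K B x y : str_op H K B x y =
  - (H * B x y) + B x y * K + B x (H y) + B (H x) y.
Proof.
rewrite /str_op sandwichE bopDE [ocomp B H x]/=.
rewrite -[ocomp _ B x]/(sandwich (sandwich (- H) K) H (B x)).
rewrite sandwichE !bopDE -[ocomp _ (B x) y]/(sandwich (- H) K (B x y)).
rewrite sandwichE; congr (_ + _ + _ + _).
by rewrite -mulNr; exact: bop_eqP.
by exact: bop_eqP.
Qed.

Lemma str_op_norm H K : `|str_op H K| <= 3 * `|H| + `|K|.
Proof.
rewrite (le_trans (sandwich_norm _ _))//.
have := sandwich_norm (sandwich (- H) K) H.
have := sandwich_norm (- H) K; rewrite normrN; lra.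
Qed.

Lemma exp_str_op H K B x y : op_exp (str_op H K) B x y =
  op_exp (- H) * B (op_exp H x) (op_exp H y) * op_exp K.
Proof.
rewrite /str_op exp_sandwich.
rewrite -[ocomp _ _ x]/(op_exp (sandwich (sandwich (- H) K) H) (B (op_exp H x))).
rewrite exp_sandwich.
rewrite -[ocomp _ _ y]/(op_exp (sandwich (- H) K) (B (op_exp H x) (op_exp H y))).
by rewrite exp_sandwich -mulrA; exact: bop_eqP.
Qed.

(** [str] is a condition on the diagonal [x = y]; polarisation extends it to the whole bilinear
    map. *)
Lemma strP H K : str_op H K Uop2_op = 0 <->
  forall x, 2 *: Uop2 x (H x) = H * U x - U x * K.
Proof.
split=> [h x|h].
  have := congr1 (fun B : bop V (bop V (bop V V)) => B x x) h.
  rewrite str_opE !Uop2_opE !bop0E Uop2xx (Uop2C (H x)) => E.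
  by apply: (eq_lincomb (k1 := 1) (k2 := 0) (k3 := 0) (k4 := 0) E E E E); lmod_ring.
apply: bop_eqP => x; apply: bop_eqP => y; rewrite !bop0E.
rewrite str_opE !Uop2_opE.
have E1 := h (x + y); have E2 := h x; have E3 := h y.
have UD : U (x + y) = U x + U y + 2 *: Uop2 x y.
  by rewrite -!Uop2xx Uop2D !Uop2Dr (Uop2C y x); lmod_ring.
move: E1 E2 E3; rewrite UD !Uop2D bop_appD !Uop2Dr (Uop2C y (H x)) (Uop2C (H x) y).
move: (U x) (U y) (Uop2 x y) => Ux Uy Uxy; rewrite !mulrDr !mulrDl.
rewrite -bop_scalerAr -bop_scalerAl => E1 E2 E3.
by apply: (eq_lincomb (k1 := 2^-1) (k2 := - 2^-1) (k3 := - 2^-1) (k4 := 0) E1 E2 E3 E3);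
  lmod_ring.
Qed.

Lemma op_exp_fixed (E : completeNormedModType R) (T : bop E E) (u : E) :
  T u = 0 -> op_exp T u = u.
Proof.
move=> Tu; have r0 : 0 < `|T| + 1 by rewrite ltr_wpDl.
rewrite op_expE (pserS (coef_bound_exp r0)) ?ltrDl// bopDE opME Tu bop_app0.
by rewrite addr0 fact0 invr1 scale1r op1E.
Qed.

Lemma str_exp_Str H : str V H -> Str V (op_exp H).
Proof.
move=> [K /strP/op_exp_fixed EB]; split; first exact: GL_exp.
exists (op_exp (- K)); split=> [|x]; first exact: GL_exp.
have := congr1 (fun B : bop V (bop V (bop V V)) => B x x) EB.
rewrite exp_str_op !Uop2_opE !Uop2xx => <-.
rewrite !mulrA op_expNr mul1r -mulrA op_expNr mulr1 //.
Qed.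

Lemma strZ t H : str V H -> str V (t *: H).
Proof.
move=> [K HK]; exists (t *: K) => x.
rewrite bopZE -bop_scalerAl -bop_scalerAr -scalerBr -HK.
by rewrite -!Uop2_opE bop_appZ !scalerA mulrC.
Qed.

Lemma str_exp_cone_group H : str V H -> cone_group V (op_exp H).
Proof.
move=> sH; apply: Str0_cone_group.
apply: (@connected_Str0 _ _ [set op_exp (t *: H) | t in `[0, 1]%classic] 1).
- apply: connected_continuous_connected; first exact: segment_connected.
  apply: continuous_subspaceT => t.
  exact: is_diff_bop_continuous (curve_expZ H t).
- by move=> _ [t _ <-]; apply/str_exp_Str/strZ.
- exists 0; first by rewrite /= in_itv /= lexx ler01.
  by rewrite scale0r op_exp0.
- exact: Str0_1.
- exists 1; first by rewrite /= in_itv /= lexx ler01.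
  by rewrite scale1r.
Qed.

(** Setting [x = e] forces the adjoint of [g = exp H] to be [Phi g], which is close to 1 with [g].
    Minus its logarithm serves as [K]; then [exp (str_op H K)] fixes [Uop2_op], and a small operator
    annihilates what its exponential fixes. *)
Lemma exp_Str_str : exists2 d : R, 0 < d &
  forall H, `|H| < d -> Str V (op_exp H) -> str V H.
Proof.
have [r r0 rP] := @exp_fixed_small R.
have [K1 K10 K1P] := @op_exp_near1 R.
have [K2 K20 K2P] := @op_log_near1 R.
pose Phi g := op_inv g * U (g e).
have Phi1 : Phi 1 = 1 by rewrite /Phi op_inv1 op1E Uop1 mulr1.
have cPhi : {for (1 : bop V V), continuous Phi}.
  have -> : Phi = fun g => lmul_op V (op_inv g) (U (g e)).
    by apply/funext => g; rewrite lmul_opE.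
  apply: (@Cn_on_bilin R 0 _ _ _ _ (GL V)); last exact: GL1.
    exact: Cn_on_op_inv 0%N.
  move=> g _; apply: continuous_comp; first exact: continuous_op_app.
  exact: Uop_continuous.
pose m := Num.min 2^-1 (r / 2 / (K2 + 1)).
have m0 : 0 < m.
  by rewrite lt_min invr_gt0 ltr0n /= !divr_gt0// ltr_wpDl.
have [q q0 qP] : exists2 q, 0 < q & forall g, `|g - 1| < q -> `|Phi g - 1| < m.
  have /cvgrPdist_lt/(_ m m0) := cPhi; rewrite -nbhs_ballE => -[q /= q0 qB].
  exists q => // g gq; rewrite distrC -{1}Phi1; apply: qB.
  by rewrite -ball_normE /= distrC.
(* With [|H| < r / 6] and [|K| < r / 2], the bound [3 |H| + |K|] of [str_op_norm] stays below
   [r]. *)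
pose d := Num.min 1 (Num.min (r / 6) (q / (K1 + 1))).
exists d; first by rewrite !lt_min ltr01 !divr_gt0// ltr_wpDl.
move=> H; rewrite !lt_min => /and3P[H1 Hr Hq] [gG [gs [gsG gU]]].
have gsE : gs = Phi (op_exp H).
  by rewrite /Phi gU Uop1 mulr1 mulrA mulVop// mul1r.
have gs1 : `|gs - 1| < m.
  rewrite gsE; apply: qP; rewrite (le_lt_trans (K1P _ _ (ltW H1)))//.
  move: Hq; rewrite ltr_pdivlMr ?ltr_wpDl//; apply: le_lt_trans.
  by rewrite mulrC ler_wpM2l// lerDl.
move: (gs1); rewrite lt_min => /andP[gs2 gsr].
have gs11 : `|gs - 1| < 1 by rewrite (lt_trans gs2)// invf_lt1 ?ltr1n.
pose K := - op_log gs.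
have Kr : `|K| < r / 2.
  rewrite normrN (le_lt_trans (K2P _ _ (ltW gs2)))//.
  move: gsr; rewrite ltr_pdivlMr ?ltr_wpDl//; apply: le_lt_trans.
  by rewrite mulrC ler_wpM2l// lerDl.
exists K; apply/strP; apply: rP.
  by rewrite (le_lt_trans (str_op_norm _ _))//; lra.
apply: bop_eqP => x; apply: bop_eqP => y; rewrite exp_str_op !Uop2_opE.
have U2 : Uop2 (op_exp H x) (op_exp H y) = op_exp H * Uop2 x y * gs.
  rewrite /Uop2 -bop_appD !gU -!bop_scalerAr -!bop_scalerAl !mulrBr !mulrBl.
  by [].
have gK : gs * op_exp K = 1 by rewrite -{1}(op_logK gs11) op_expNr.
by rewrite U2 !mulrA op_expNl mul1r -mulrA gK mulr1.
Qed.

(** At [x = e] the defining equation of [str] forces [Hbar = H - 2 U_{e, H e}]. Substituting this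
    leaves, for each [x], one bounded linear equation in [H], so that [str] is a closed subspace. *)
Definition str_eq_op x : bop (bop V V) (bop V V) :=
  (2 : R) *: ocomp (Uop2_op x) (flip_op (1 : bop (bop V V) (bop V V)) x)
  - rmul_op V (U x) + ocomp (lmul_op V (U x))
      (1 - (2 : R) *: ocomp (Uop2_op e) (flip_op (1 : bop (bop V V) (bop V V)) e)).

Lemma str_eqP H : str V H <-> forall x, str_eq_op x H = 0.
Proof.
have E x : str_eq_op x H = 2 *: Uop2 x (H x) - H * U x +
    U x * (H - 2 *: Uop2 e (H e)).
  pose ev z := flip_op (1 : bop (bop V V) (bop V V)) z.
  have F z : ev z H = H z by rewrite /ev flip_opE op1E.
  rewrite -[LHS]/(2 *: Uop2_op x (ev x H) - rmul_op V (U x) H +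
    lmul_op V (U x) (H - 2 *: Uop2_op e (ev e H))).
  by rewrite !F rmul_opE lmul_opE !Uop2_opE.
split=> [[K HK] x|h].
  have := HK e; rewrite Uop1 mulr1 mul1r => he.
  by rewrite E he HK subKr; move: (U x * K) (H * U x) => A B; lmod_ring.
exists (H - 2 *: Uop2 e (H e)) => x; have := h x; rewrite E => hx.
by apply: (eq_lincomb (k1 := 1) (k2 := 0) (k3 := 0) (k4 := 0) hx hx hx hx); lmod_ring.
Qed.

Lemma str_submod : submod_closed (mem (str V) : {pred bop V V}).
Proof.
split; first by rewrite inE; apply/str_eqP => x; rewrite bop_app0.
move=> k g h; rewrite !inE => /str_eqP gs /str_eqP hs; apply/str_eqP => x.
by rewrite bop_appD bop_appZ gs hs scaler0 addr0.
Qed.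

Lemma closed_str : closed (str V).
Proof.
have -> : str V = \bigcap_x (str_eq_op x @^-1` [set 0]).
  by apply/seteqP; split=> [H /str_eqP h x _|H h]; [exact: h|apply/str_eqP => x; exact: h].
apply: closed_bigI => x _; apply: preimage_closed.
  by move=> y _; exact: bop_continuous.
apply: accessible_closed_set1.
exact: hausdorff_accessible (@norm_hausdorff _ _).
Qed.

End StructureAlgebra.

(** * Charts of the group of the cone *)

Section StrModel.
Context {R : realType} {V : jbAlgebraType R}.

Definition str_pred : {pred bop V V} := mem (str V).

(** [str V] as a Banach space of its own, complete because it is closed: the model space of the
    charts. *)
Record str_type := StrType { str_val :> bop V V ; str_valP : str_val \in str_pred }.

HB.instance Definition _ := [isSub for str_val].
HB.instance Definition _ := [Choice of str_type by <:].

HB.instance Definition _ := GRing.isSubmodClosed.Build R (bop V V) str_pred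
  (@str_submod R V).
HB.instance Definition _ := [SubChoice_isSubLmodule of str_type by <:].

Definition str_norm (H : str_type) : R := `|str_val H|.

Lemma str_normD H H' : str_norm (H + H') <= str_norm H + str_norm H'.
Proof. exact: ler_normD. Qed.

Lemma str_normZ k H : str_norm (k *: H) = `|k| * str_norm H.
Proof. exact: normrZ. Qed.

Lemma str_norm_eq0 H : str_norm H = 0 -> H = 0.
Proof. by move=> /normr0_eq0 H0; exact: val_inj. Qed.

HB.instance Definition _ :=
  Lmodule_isNormed.Build R str_type str_normD str_normZ str_norm_eq0.

Lemma str_val_bounded : str_val \in bounded_op.
Proof. by apply: (@bounded_opP _ _ _ _ 1) => [k x y //|x]; rewrite mul1r. Qed.

Definition str_incl : bop str_type (bop V V) := Bop str_val_bounded.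

Lemma str_cauchy_cvg (G : set_system str_type) : ProperFilter G -> cauchy G -> cvg G.
Proof.
move=> PG /cauchyP cG.
have c1 : cvg (str_incl @ G).
  apply: cauchy_cvg; apply/cauchy_exP => d d0; have [p Gp] := cG d d0.
  exists (str_incl p); apply: (@filterS str_type G _ (ball p d) _ _ Gp) => q.
  by rewrite -!ball_normE.
have sl : lim (str_incl @ G) \in str_pred.
  rewrite inE; apply: (@closed_cvg _ _ G _ str_incl (str V)) => //.
    exact: closed_str.
  by near=> H; have := str_valP H; rewrite inE.
apply/cvg_ex; exists (StrType sl); apply/cvgrPdist_lt => d d0.
by have /cvgrPdist_lt/(_ d d0) := c1.
Unshelve. all: by end_near. Qed.

HB.instance Definition _ := Uniform_isComplete.Build str_type str_cauchy_cvg.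

End StrModel.

(** * Exponential charts, Lie algebra and tangent space *)

Section Charts.
Context {R : realType} {V : jbAlgebraType R}.
Implicit Types (g h H : bop V V).

(** Membership of [exp H] passes from the cone group to [Str] by the polar decomposition, then to
    [str] by [exp_Str_str]; the converse holds without restriction on [H]. *)
Lemma exp_chart_radius : exists2 d : R, 0 < d & forall H, `|H| < d ->
  [/\ `|op_exp H - 1| < 2^-1, op_log (op_exp H) = H
    & cone_group V (op_exp H) <-> str V H].
Proof.
have [d d0 dP] := @exp_Str_str R V; have [K K0 KP] := @op_exp_near1 R.
have K20 : 0 < 2^-1 / (K + 1) by rewrite divr_gt0// ltr_wpDl.
exists (Num.min 1 (Num.min d (2^-1 / (K + 1)))); first by rewrite !lt_min ltr01 d0.
move=> H; rewrite !lt_min => /and3P[H1 Hd HK].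
have near1 (t : R) : 0 <= t <= 1 -> `|op_exp (t *: H) - 1| < 2^-1.
  move=> /andP[t0 t1]; have tH : `|t *: H| <= `|H|.
    by rewrite normrZ ger0_norm// ler_piMl.
  rewrite (le_lt_trans (KP _ _ (le_trans tH (ltW H1))))//.
  rewrite (le_lt_trans (ler_wpM2l K0 tH))//.
  move: HK; rewrite ltr_pdivlMr ?ltr_wpDl//; apply: le_lt_trans.
  by rewrite mulrC ler_wpM2l// lerDl.
split.
- by have := near1 1; rewrite scale1r; apply; rewrite ler01 lexx.
- apply: op_expK => t /near1/lt_trans; apply.
  by rewrite invf_lt1 ?ltr1n.
split; last exact: str_exp_cone_group.
by move=> /cone_group_Str; exact: dP.
Qed.

Lemma cone_group_mulVl g h : cone_group V g -> cone_group V (op_inv g * h) ->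
  cone_group V h.
Proof.
move=> gC ghC; have [_ _ hM _] := @subgroup_cone_group R V.
have -> : h = g * (op_inv g * h) by rewrite mulrA mulopV ?mul1r//; case: gC.
exact: hM.
Qed.

Lemma embedded_cone_group : embedded_submanifold (cone_group V).
Proof.
have [d d0 dP] := exp_chart_radius.
move=> a aC; have aG : GL V a by case: aC.
pose near := [set x : bop V V | `|op_inv a * x - 1| < 2^-1].
pose phi x : bop V V := op_log (op_inv a * x).
pose psi H : bop V V := a * op_exp H.
(* Cut down so that [phi] lands in the ball on which [log] inverts [exp]. *)
pose dom := near `&` phi @^-1` [set H | `|H| < d].
pose cod := [set H : bop V V | `|H| < d].
have half1 : (2^-1 : R) < 1 by rewrite invf_lt1 ?ltr1n.
have aM x : op_inv a * x = lmul_op V (op_inv a) x by rewrite lmul_opE.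
have Cmul n (O : set (bop V V)) : Cn_on n O (fun x => op_inv a * x).
  have -> : (fun x => op_inv a * x) = lmul_op V (op_inv a) by apply/funext.
  exact: Cn_on_bop.
have ocod : open cod.
  have -> : cod = ball (0 : bop V V) d.
    by apply/seteqP; split=> H; rewrite -ball_normE /= sub0r normrN.
  exact: ball_open.
have onear : open near.
  have -> : near = (fun x => op_inv a * x) @^-1` ball (1 : bop V V) 2^-1.
    by apply/seteqP; split=> x; rewrite /near -ball_normE /= distrC.
  have := @open_setI_preimage R (bop V V) (bop V V) setT (ball (1 : bop V V) 2^-1)
    (fun x => op_inv a * x) openT (ball_open _ _).
  rewrite setTI; apply.
  by move=> x _; exact: (Cmul 0%N setT x I).
have Cphi n : Cn_on n near phi.
  apply: (@Cn_on_comp _ _ _ _ _ _ [set A : bop V V | `|A - 1| < 2^-1]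
    (fun x => op_inv a * x)) => //.
  exact: op_log_Cn.
have odom : open dom.
  by apply: open_setI_preimage => // x nx; exact: (Cn_on_continuous (Cphi 0%N) nx).
have phiK x : near x -> psi (phi x) = x.
  move=> nx; rewrite /psi /phi op_logK; first by rewrite mulrA mulopV// mul1r.
  exact: lt_trans nx half1.
have psiE H : op_inv a * psi H = op_exp H by rewrite /psi mulrA mulVop// mul1r.
have domP x : dom x -> cod (phi x) /\ psi (phi x) = x.
  by move=> [nx cx]; split=> //; exact: phiK.
have codP H : cod H -> dom (psi H) /\ phi (psi H) = H.
  move=> Hd; have [H1 H2 _] := dP H Hd.
  have phiH : phi (psi H) = H by rewrite /phi psiE.
  split; last exact: phiH.
  split; first by change (`|op_inv a * psi H - 1| < 2^-1); rewrite psiE.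
  by change (`|phi (psi H)| < d); rewrite phiH.
have smphi : smooth_on dom phi.
  by move=> n; apply: Cn_on_subset (Cphi n) => x [].
have smpsi : smooth_on cod psi.
  move=> n; have -> : psi = fun H => lmul_op V a (op_exp H).
    by apply/funext => H; rewrite lmul_opE.
  by apply: Cn_on_lin; exact: op_exp_Cn.
have emb : exists2 c : R, 0 < c & forall u : @str_type R V,
    c * `|u| <= `|str_incl u|.
  by exists 1 => // u; rewrite mul1r.
(* Outside [str V] the retraction takes the default value 0. *)
pose retr (H : bop V V) : @str_type R V := insubd 0 H.
have inclK : cancel (@str_incl R V) retr.
  by move=> u; apply: val_inj; rewrite /retr insubdK//; exact: str_valP.
have flat x : dom x -> (cone_group V x <-> range str_incl (phi x)).
  move=> [nx cx]; have [_ _ eq] := dP (phi x) cx.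
  have expE : op_exp (phi x) = op_inv a * x by rewrite -psiE phiK.
  split=> [xC|[u _ ux]].
    have : cone_group V (op_exp (phi x)).
      rewrite expE; have [_ _ hM hI] := @subgroup_cone_group R V.
      by apply: hM => //; exact: hI.
    move=> /eq sx; have sx' : phi x \in str_pred by rewrite inE.
    by exists (StrType sx').
  apply: (cone_group_mulVl aC); rewrite -expE; apply/eq; rewrite -ux.
  by have := str_valP u; rewrite inE.
exists (@SubmfdChart R (bop V V) (cone_group V) str_type dom cod phi psi str_incl retr
  odom ocod domP codP smphi smpsi emb inclK flat).
split; first by rewrite /near /= mulVop// subrr normr0 invr_gt0.
by change (`|phi a| < d); rewrite /phi mulVop// op_log1 normr0.
Qed.

Lemma cone_group_Banach_Lie : embedded_Banach_Lie_subgroup (cone_group V).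
Proof.
have [sG s1 sM sV] := @subgroup_cone_group R V; split.
- by split.
- exact: closed_cone_group.
- exact: embedded_cone_group.
- apply: (@smooth_between_of_smooth R (bop V V * bop V V)%type (bop V V) _ _ setT) => //.
  + exact: openT.
  + move=> n; have -> : (fun p : bop V V * bop V V => p.1 * p.2) =
        fun p => lmul_op V (fst_op _ _ p) (snd_op _ _ p).
      by apply/funext => p; rewrite lmul_opE.
    by apply: Cn_on_bilin; exact: Cn_on_bop.
  + by move=> p [p1 p2]; exact: sM.
apply: (@smooth_between_of_smooth R (bop V V) (bop V V) _ _ (GL V)) => //.
- exact: open_GL.
- by move=> n; exact: Cn_on_op_inv.
Qed.

Lemma lie_algebra_cone_group : lie_algebra (cone_group V) = str V.
Proof.
have [d d0 dP] := exp_chart_radius.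
apply/seteqP; split=> H HG; last by move=> t; exact/str_exp_cone_group/strZ.
pose t := d / 2 / (`|H| + 1); have t0 : 0 < t by rewrite !divr_gt0// ltr_wpDl.
have tH : `|t *: H| < d.
  rewrite normrZ gtr0_norm// /t mulrAC ltr_pdivrMr ?ltr_wpDl//.
  have := normr_ge0 H; nra.
have [_ _ eq] := dP _ tH.
have -> : H = t^-1 *: (t *: H) by rewrite scalerA mulVf ?gt_eqF// scale1r.
by apply/strZ/eq; exact: HG.
Qed.

Lemma is_derive_ray (W : normedModType R) (f : R -> W) (t : R) (w : W) :
  is_derive t 1 f w <-> is_diff t f (ray w).
Proof.
split=> [[df dE]|[df dE]].
  have dft : differentiable f t by exact/derivable1_diffP.
  apply: DiffDef => //; apply/funext => s; rewrite rayE -dE deriveE//.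
  by rewrite -linearZ /= /GRing.scale /= mulr1.
split; first exact/derivable1_diffP.
by rewrite deriveE// dE rayE scale1r.
Qed.

(** For a curve [f] in the group with velocity [H], [log (f t) / t] lies in [str] for small [t > 0]
    and tends to [H]; closedness of [str] concludes. *)
Lemma tangent_space_cone_group : tangent_space (cone_group V) 1 = str V.
Proof.
have [d d0 dP] := exp_chart_radius.
apply/seteqP; split=> H.
  move=> [f [f0 fG /is_derive_ray fH]].
  have f1 : `|f 0 - 1| < 1 by rewrite f0 subrr normr0.
  have [D fD DE] := op_log_diff f1.
  have DH : D H = H.
    by rewrite -[LHS]mul1r -{1}f0 DE// f0 mul1r mulr1.
  have lH : is_diff (0 : R) (fun s => op_log (f s)) (ray H).
    by have := curve_comp fH fD; rewrite DH.
  have cf := is_diff_bop_continuous fH.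
  have cl := is_diff_bop_continuous lH.
  apply: closed_str => B; rewrite -nbhs_ballE => -[q /= q0 qB].
  have q20 : 0 < q / 2 by rewrite divr_gt0.
  have near1 : \forall s \near (0 : R), `|f s - 1| < 1.
    have /cvgrPdist_lt/(_ 1 ltr01) := cf; apply: filterS => s.
    by rewrite f0 distrC.
  have neard : \forall s \near (0 : R), `|op_log (f s)| < d.
    have /cvgrPdist_lt/(_ d d0) := cl; apply: filterS => s.
    by rewrite f0 op_log1 sub0r normrN.
  move/is_diff_bopP: lH => /(_ _ q20) lH.
  have /nbhs_ballP[r /= r0 rB] : \forall s \near (0 : R), [/\ cone_group V (f s),
      `|f s - 1| < 1, `|op_log (f s)| < d &
      `|op_log (f (0 + s)) - op_log (f 0) - ray H s| <= q / 2 * `|s|].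
    by near=> s; split; near: s.
  pose t := r / 2; have t0 : 0 < t by rewrite divr_gt0.
  have [tG t1 td tH] : [/\ cone_group V (f t),
      `|f t - 1| < 1, `|op_log (f t)| < d &
      `|op_log (f (0 + t)) - op_log (f 0) - ray H t| <= q / 2 * `|t|].
    apply: rB; rewrite -ball_normE /= sub0r normrN gtr0_norm// /t.
    by rewrite ltr_pdivrMr// ltr_pMr// ltr1n.
  exists (t^-1 *: op_log (f t)); split.
    have [_ _ eq] := dP _ td; apply/strZ/eq.
    by rewrite op_logK.
  apply: qB; rewrite -ball_normE /= distrC.
  move: tH; rewrite add0r f0 op_log1 subr0 rayE => tH.
  have -> : t^-1 *: op_log (f t) - H = t^-1 *: (op_log (f t) - t *: H).
    by rewrite scalerBr scalerA mulVf ?gt_eqF// scale1r.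
  rewrite normrZ gtr0_norm ?invr_gt0// ltr_pdivrMl//.
  rewrite (le_lt_trans tH)// (gtr0_norm t0) mulrC ltr_pM2l//.
  by rewrite ltr_pdivrMr// ltr_pMr// ltr1n.
move=> sH; exists (fun t => op_exp (t *: H)); split.
- by rewrite scale0r op_exp0.
- by near=> t; exact/str_exp_cone_group/strZ.
apply/is_derive_ray; have := curve_expZ H 0.
by rewrite scale0r op_exp0 mul1r.
Unshelve. all: by end_near. Qed.

End Charts.

Theorem theorem3p29 (R : realType) (V : jbAlgebraType R) :
  [/\ embedded_Banach_Lie_subgroup (cone_group V),
      tangent_space (cone_group V) 1 = str V,
      lie_algebra (cone_group V) = str V
    & exists (I : Type) (k : I -> bop V V),
      [/\ forall i, jaut V (k i),
          forall i j, i <> j ->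
            connected_component (jaut V) (k i)
              <> connected_component (jaut V) (k j),
          cone_group V = \bigcup_i [set g * k i | g in Str0 V]
        & trivIset setT (fun i => [set g * k i | g in Str0 V])]].
Proof.
split.
- exact: cone_group_Banach_Lie.
- exact: tangent_space_cone_group.
- exact: lie_algebra_cone_group.
- exact: cone_group_decomposition.
Qed.
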